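(* Let $y$ be the output of the original system $$dx(t)=Ax(t)dt+\sum_{i=1}^qN_ix(t-)dM_i(t),\quad x(0)=X_0z_0,\quad y(t)=Cx(t),\quad t\in[0,T],$$ and $\hat y$ the output of the reduced system $$d\hat x(t)=\hat A\hat x(t)dt+\sum_{i=1}^q\hat N_i\hat x(t-)dM_i(t),\quad\hat x(0)=\hat X_0z_0,\quad\hat y(t)=\hat C\hat x(t),\quad t\in[0,T].$$ Then $$\mathbb E\int_0^T\|y(t)-\hat y(t)\|_2^2\,dt\le\Big(\operatorname{tr}(CP(T)C^\top)-2\operatorname{tr}(C\tilde P(T)\hat C^\top)+\operatorname{tr}(\hat C\hat P(T)\hat C^\top)\Big)\|z_0\|_2^2,$$ where $P(T)=\int_0^TF(t)dt$, $\hat P(T)=\int_0^T\hat F(t)dt$, $\tilde P(T)=\int_0^T\tilde F(t)dt$ and $F,\hat F,\tilde F$ are the covariance functions defined in the context.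
   Context: Here $A,N_i\in\mathbb R^{n\times n}$, $X_0\in\mathbb R^{n\times m}$, $C\in\mathbb R^{p\times n}$, $\hat A,\hat N_i\in\mathbb R^{\hat n\times\hat n}$, $\hat X_0\in\mathbb R^{\hat n\times m}$, $\hat C\in\mathbb R^{p\times\hat n}$, $z_0\in\mathbb R^m$ (deterministic), $T>0$. $M=(M_1,\dots,M_q)^\top$ is an $\mathbb R^q$-valued square integrable mean-zero Lévy process with covariance matrix $K_M=(k_{ij})$, i.e. $\mathbb E[M(t)M(t)^\top]=K_Mt$, defined on a filtered probability space $(\Omega,\mathcal F,(\mathcal F_t)_{t\in[0,T]},\mathbb P)$ with right-continuous and complete filtration; $M$ is adapted and its increments $M(t+h)-M(t)$ are independent of $\mathcal F_t$. $x(t-)$ denotes the left limit and $\|\cdot\|_2$ the Euclidean norm. The covariance functions are the solutions of $\dot F=\mathcal L[F]$, $F(0)=X_0X_0^\top$; $\dot{\hat F}=\hat{\mathcal L}[\hat F]$, $\hat F(0)=\hat X_0\hat X_0^\top$; $\dot{\tilde F}=\tilde{\mathcal L}[\tilde F]$, $\tilde F(0)=X_0\hat X_0^\top$, where $\mathcal L(X)=AX+XA^\top+\sum_{i,j=1}^qN_iXN_j^\top k_{ij}$, $\hat{\mathcal L}(X)=\hat AX+X\hat A^\top+\sum_{i,j=1}^q\hat N_iX\hat N_j^\top k_{ij}$, $\tilde{\mathcal L}(X)=AX+X\hat A^\top+\sum_{i,j=1}^qN_iX\hat N_j^\top k_{ij}$. Equivalently, $F(t)=\mathbb E[\Phi(t)X_0X_0^\top\Phi(t)^\top]$,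 $\hat F(t)=\mathbb E[\hat\Phi(t)\hat X_0\hat X_0^\top\hat\Phi(t)^\top]$, $\tilde F(t)=\mathbb E[\Phi(t)X_0\hat X_0^\top\hat\Phi(t)^\top]$, with $\Phi,\hat\Phi$ the fundamental solutions of the two state equations. Throughout, $\mathcal L$ and $\hat{\mathcal L}$ are assumed invertible. *)

(* Defs.v *)
From HB Require Import structures.
From mathcomp Require Import all_boot all_order all_algebra.
From mathcomp Require Import all_classical all_reals all_analysis.
Set Implicit Arguments.
Unset Strict Implicit.
Unset Printing Implicit Defensive.
Import Order.TTheory GRing.Theory Num.Theory.
Import numFieldNormedType.Exports.
Local Open Scope classical_set_scope.
Local Open Scope ring_scope.

(* The Frobenius norm; on column vectors it is the Euclidean norm. (The norm
   `|_| that MathComp-Analysis puts on matrices is the sup norm.) *)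
Definition norm2 (R : realType) (n m : nat) (A : 'M[R]_(n, m)) : R :=
  Num.sqrt (\sum_(i < n) \sum_(j < m) A i j ^+ 2).

Definition mx_integral (R : realType) (n m : nat) (a b : R)
    (F : R -> 'M[R]_(n, m)) : 'M[R]_(n, m) :=
  \matrix_(i < n, j < m)
    Rintegral (@lebesgue_measure R) `[a, b]%classic (fun t => F t i j).

Definition borel_cV (R : realType) (n : nat) : set (set 'cV[R]_n) :=
  <<s [set D | exists (i : 'I_n) (B : set R),
         measurable B /\ D = [set v : 'cV[R]_n | B (v i 0)]] >>.

(* A filtration (Fl t), t in [0, T], satisfying the usual conditions; values of
   Fl outside [0, T] are irrelevant. *)
Record usual_filtration (R : realType) (d : measure_display)
    (Omega : measurableType d) (P : probability Omega R) (T : R)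
    (Fl : R -> set (set Omega)) : Prop := UsualFiltration {
  flt_sigma_algebra : forall t : R, 0 <= t <= T -> sigma_algebra setT (Fl t);
  flt_measurable : forall (t : R) A, 0 <= t <= T -> Fl t A -> measurable A;
  flt_mono : forall s t : R, 0 <= s -> s <= t -> t <= T -> Fl s `<=` Fl t;
  flt_right_continuous : forall (t : R) A, 0 <= t < T ->
    (forall s : R, t < s <= T -> Fl s A) -> Fl t A;
  flt_complete : forall A, P.-negligible A -> Fl 0 A }.

(* Measurability of a matrix-valued map with respect to a sigma-algebra G. *)
Definition mx_measurable_wrt (R : realType) (Omega : Type)
    (G : set (set Omega)) (n m : nat) (X : Omega -> 'M[R]_(n, m)) : Prop :=
  forall (i : 'I_n) (j : 'I_m) (B : set R),
    measurable B -> G [set w | B (X w i j)].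

Definition adapted (R : realType) (Omega : Type) (T : R)
    (Fl : R -> set (set Omega)) (n m : nat)
    (X : R -> Omega -> 'M[R]_(n, m)) : Prop :=
  forall t : R, 0 <= t <= T -> mx_measurable_wrt (Fl t) (X t).

Definition cadlag (R : realType) (T : R) (n m : nat)
    (f : R -> 'M[R]_(n, m)) : Prop :=
  (forall t : R, 0 <= t < T -> f s @[s --> t^'+] --> f t) /\
  (forall t : R, 0 < t <= T -> cvg (f s @[s --> t^'-])).

(* x(t-); the value at t = 0 plays no role below. *)
Definition left_limit (R : realType) (Omega : Type) (n m : nat)
    (x : R -> Omega -> 'M[R]_(n, m)) (t : R) (w : Omega) : 'M[R]_(n, m) :=
  lim (x s w @[s --> t^'-]).

Definition increment (R : realType) (Omega : Type) (q : nat)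
    (M : R -> Omega -> 'cV[R]_q) (t h : R) (w : Omega) : 'cV[R]_q :=
  M (t + h) w - M t w.

(* Square integrable mean-zero Levy process on [0, T] with covariance matrix K,
   relative to the filtration Fl. *)
Record levy_process (R : realType) (d : measure_display)
    (Omega : measurableType d) (P : probability Omega R) (T : R)
    (Fl : R -> set (set Omega)) (q : nat) (K : 'M[R]_q)
    (M : R -> Omega -> 'cV[R]_q) : Prop := LevyProcess {
  levy_adapted : adapted T Fl M;
  levy_cadlag : {ae P, forall w, cadlag T (M ^~ w)};
  levy_start : {ae P, forall w, M 0 w = 0};
  levy_indep_increments : forall (t h : R) A B,
    0 <= t -> 0 <= h -> t + h <= T -> Fl t A -> @borel_cV R q B ->
    P (A `&` increment M t h @^-1` B)
      = (P A * P (increment M t h @^-1` B))%E;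
  levy_stationary_increments : forall (t h : R) B,
    0 <= t -> 0 <= h -> t + h <= T -> @borel_cV R q B ->
    P (increment M t h @^-1` B) = P (increment M 0 h @^-1` B);
  levy_square_integrable : forall (t : R) (i : 'I_q), 0 <= t <= T ->
    P.-integrable setT (fun w => ((M t w i 0) ^+ 2)%:E);
  levy_mean_zero : forall (t : R) (i : 'I_q), 0 <= t <= T ->
    ('E_P[fun w => (M t w i 0)%R] = 0)%E;
  levy_covariance : forall (t : R) (i j : 'I_q), 0 <= t <= T ->
    ('E_P[fun w => ((M t w *m (M t w)^T) i j)%R] = (K i j * t)%:E)%E }.

(* The process sum_(k < N) xi_k 1_{]t_k, t_{k+1}]} with values in R^n. *)
Record step_process (R : realType) (Omega : Type) (n : nat) := StepProcess {
  sp_size : nat;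
  sp_time : nat -> R;
  sp_val : nat -> Omega -> 'cV[R]_n }.

Definition step_eval (R : realType) (Omega : Type) (n : nat)
    (S : step_process R Omega n) (t : R) (w : Omega) : 'cV[R]_n :=
  \sum_(k < sp_size S)
    (if sp_time S k < t <= sp_time S k.+1 then sp_val S k w else 0).

Definition simple_predictable (R : realType) (Omega : Type) (T : R)
    (Fl : R -> set (set Omega)) (n : nat) (S : step_process R Omega n) : Prop :=
  [/\ forall k, (k <= sp_size S)%N -> 0 <= sp_time S k <= T,
      forall k, (k < sp_size S)%N -> sp_time S k <= sp_time S k.+1,
      forall k, (k < sp_size S)%N ->
        mx_measurable_wrt (Fl (sp_time S k)) (sp_val S k) &
      exists c : R, forall k w, (k < sp_size S)%N -> norm2 (sp_val S k w) <= c].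

(* int_0^t S dM^T: the n x q matrix whose i-th column is int_0^t S dM_i. *)
Definition step_integral (R : realType) (Omega : Type) (n q : nat)
    (M : R -> Omega -> 'cV[R]_q) (S : step_process R Omega n)
    (t : R) (w : Omega) : 'M[R]_(n, q) :=
  \sum_(k < sp_size S)
    sp_val S k w *m (M (Num.min (sp_time S k.+1) t) w
                       - M (Num.min (sp_time S k) t) w)^T.

(* The Ito integral of an integrand H in L^2(P (x) dt): the mean-square limit
   of the integrals of simple predictable processes converging to H. The i-th
   column of J t is int_0^t H dM_i. *)
Definition is_ito_integral_L2 (R : realType) (d : measure_display)
    (Omega : measurableType d) (P : probability Omega R) (T : R)
    (Fl : R -> set (set Omega)) (n q : nat) (M : R -> Omega -> 'cV[R]_q)
    (H : R -> Omega -> 'cV[R]_n) (J : R -> Omega -> 'M[R]_(n, q)) : Prop :=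
  adapted T Fl J /\
  exists S : nat -> step_process R Omega n,
    [/\ forall k, simple_predictable T Fl (S k),
        (fun k => \int[P]_w \int[lebesgue_measure]_(s in `[0%R, T])
            ((norm2 (H s w - step_eval (S k) s w) ^+ 2)%:E))%E @ \oo --> 0%E &
        forall t : R, 0 <= t <= T ->
          (fun k => \int[P]_w
              ((norm2 (J t w - step_integral M (S k) t w) ^+ 2)%:E))%E
            @ \oo --> 0%E].

(* The Ito integral of a locally square integrable integrand, by localization
   along stopping times tau_k that eventually reach T. For an adapted process H
   with left-continuous paths (such as x(t-)) such a sequence always exists. *)
Definition is_ito_integral (R : realType) (d : measure_display)
    (Omega : measurableType d) (P : probability Omega R) (T : R)
    (Fl : R -> set (set Omega)) (n q : nat) (M : R -> Omega -> 'cV[R]_q)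
    (H : R -> Omega -> 'cV[R]_n) (I : R -> Omega -> 'M[R]_(n, q)) : Prop :=
  exists tau : nat -> Omega -> R,
    [/\ forall k (t : R), 0 <= t <= T -> Fl t [set w | tau k w <= t],
        forall k w, tau k w <= tau k.+1 w,
        {ae P, forall w, exists k, T <= tau k w} &
        forall k, exists2 J : R -> Omega -> 'M[R]_(n, q),
          is_ito_integral_L2 P T Fl M
            (fun s w => if s <= tau k w then H s w else 0) J &
          forall t : R, 0 <= t <= T ->
            {ae P, forall w, t <= tau k w -> I t w = J t w}].

(* dx(t) = A x(t) dt + sum_i N_i x(t-) dM_i(t) on [0, T], x(0) = x0. *)
Definition sde_solution (R : realType) (d : measure_display)
    (Omega : measurableType d) (P : probability Omega R) (T : R)
    (Fl : R -> set (set Omega)) (n q : nat) (M : R -> Omega -> 'cV[R]_q)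
    (A : 'M[R]_n) (N : 'I_q -> 'M[R]_n) (x0 : 'cV[R]_n)
    (x : R -> Omega -> 'cV[R]_n) : Prop :=
  [/\ adapted T Fl x,
      {ae P, forall w, cadlag T (x ^~ w)} &
      exists2 I : R -> Omega -> 'M[R]_(n, q),
        is_ito_integral P T Fl M (left_limit x) I &
        forall t : R, 0 <= t <= T -> {ae P, forall w,
          x t w = x0 + mx_integral 0 t (fun s => A *m x s w)
                     + \sum_(i < q) N i *m col i (I t w)}].

(* X |-> A X + X B^T + sum_{i,j} N_i X N'_j^T k_ij. *)
Definition lyap_op (R : realType) (n m q : nat) (K : 'M[R]_q)
    (A : 'M[R]_n) (N : 'I_q -> 'M[R]_n) (B : 'M[R]_m) (N' : 'I_q -> 'M[R]_m)
    (X : 'M[R]_(n, m)) : 'M[R]_(n, m) :=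
  A *m X + X *m B^T
    + \sum_(i < q) \sum_(j < q) K i j *: (N i *m X *m (N' j)^T).

(* dF/dt = L(F) on [0, T], F(0) = F0. *)
Definition ivp_solution (R : realType) (n m : nat) (T : R)
    (L : 'M[R]_(n, m) -> 'M[R]_(n, m)) (F0 : 'M[R]_(n, m))
    (F : R -> 'M[R]_(n, m)) : Prop :=
  [/\ F 0 = F0, {within `[0, T], continuous F} &
      forall t : R, 0 < t < T -> is_derive t (1 : R) F (L (F t))].

(* Main.v *)
Require Import Defs.
From mathcomp Require Import all_boot all_order all_algebra.
From mathcomp Require Import all_classical all_reals all_analysis measurable_realfun.
From mathcomp Require Import ring lra.
Import Order.TTheory GRing.Theory Num.Theory.
Import numFieldNormedType.Exports.
Local Open Scope classical_set_scope.
Local Open Scope ring_scope.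

Set Implicit Arguments.
Unset Strict Implicit.
Unset Printing Implicit Defensive.

(** The left-hand side is an integral of second moments: the k-th coordinate of
    C x(t) - Ch xh(t) is a linear combination of the coordinates of the stacked
    state (x(t), xh(t)), so its mean square is a quadratic form in the joint
    covariance matrix Q(t) = E[(x; xh)(x; xh)^T]. If z0 were random with
    identity covariance, Q would be the block matrix G with blocks F, Ft, Ft^T,
    Fh. For a deterministic z0 one has Q(0) = (X z0)(X z0)^T with X = (X0; Xh0),
    which is dominated by |z0|^2 X X^T = |z0|^2 G(0) by Cauchy-Schwarz
    ([psd_rank_one]). Both Q and G solve the Lyapunov equation of the
    block-diagonal system, and the flow of that equation preserves positive
    semidefiniteness; hence |z0|^2 G(t) - Q(t) >= 0 on [0, T]
    ([covariance_comparison]). Evaluating on the rows of (C, -Ch), summing and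
    integrating in time gives the trace expression of the theorem.

    The probabilistic part is the equation for Q. A solution is only assumed to
    satisfy an Ito equation localized by stopping times, so its square
    integrability has to be proved. Stopped before tau_k, the isometry bounds
    the mean square of x(t) by a constant times 1 + int_0^t E|x(s-)|^2 ds; a
    discrete Gronwall argument makes the bound independent of k
    ([energy_bounded]), and Fatou together with the isometry lets k go to
    infinity. The outcome is [sde_solution_L2]: the left limits of x have a
    jointly measurable, square integrable version h, and what the drift leaves
    of x is a mean-square limit of Ito integrals, for which the isometry and the
    orthogonality to the past hold. The isometry itself is an L2 limit of the
    one for step integrands ([step_isometry]), which comes from the independence
    of the increments of M.

    Derivatives of Q are avoided. Drift increments are O(t' - t) and noise
    increments O(sqrt (t' - t)) in mean square, so expanding
    x(t') xh(t')^T around time t gives Q(t') - Q(t) = (t' - t) L(Q(t)) up to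
    O((t' - t)^(3/2)) ([covariance_increment_ode]). A classical solution obeys
    the same relation ([ivp_increment_ode]), and the relation alone implies
    positivity ([increment_ode_psd]): one Euler step is, up to second order, the
    congruence by 1 + (t' - t) A followed by adding the noise term, which is
    positive because K is a covariance matrix; over m steps the errors add up to
    O(1 / sqrt m).

    The time integral in the theorem concerns x(t) itself, for which no joint
    measurability is assumed. Almost every path differs from its left limits at
    countably many times only, so x may be replaced by h; the bound on the
    second moments passes to left limits by Fatou and the continuity of F, Ft
    and Fh, and Tonelli exchanges the two integrals. *)

(** * Square integrable functions *)

Section SquareIntegrable.
Context d (T : measurableType d) (R : realType).
Variable mu : {measure set T -> \bar R}.
Implicit Types f g h : T -> R.

Definition square_integrable f : Prop :=
  measurable_fun setT f /\ (\int[mu]_x ((f x ^+ 2)%:E) < +oo)%E.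

Definition inner f g : R := \int[mu]_x (f x * g x).

Definition l2norm f : R := Num.sqrt (inner f f).

Lemma square_integrable_measurable f :
  square_integrable f -> measurable_fun setT f.
Proof. by case. Qed.

Lemma measurable_square f : square_integrable f ->
  measurable_fun setT (fun x => (f x ^+ 2)%:E).
Proof. by case=> mf _; apply/measurable_EFinP/measurable_funX. Qed.

Lemma integrable_square f : square_integrable f ->
  mu.-integrable setT (fun x => (f x ^+ 2)%:E).
Proof.
move=> [mf foo]; apply/integrableP; split.
  by apply/measurable_EFinP; exact: measurable_funX.
under eq_integral do rewrite gee0_abs ?lee_fin ?sqr_ge0//.
by [].
Qed.

Lemma integrable_mul f g : square_integrable f -> square_integrable g ->
  mu.-integrable setT (EFin \o (fun x => f x * g x)).
Proof.
move=> Lf Lg.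
apply: (@le_integrable _ _ _ mu _ measurableT _
  ((fun x => (f x ^+ 2)%:E) \+ (fun x => (g x ^+ 2)%:E))%E).
- by apply/measurable_EFinP; apply: measurable_funM; [case: Lf|case: Lg].
- move=> x _ /=; rewrite lee_fin; set a := f x; set b := g x.
  rewrite [leRHS]ger0_norm; last by rewrite addr_ge0// sqr_ge0.
  rewrite ler_norml; apply/andP; split; nra.
- by apply: integrableD => //; exact: integrable_square.
Qed.

Lemma square_integrable0 : square_integrable (fun=> 0).
Proof.
split; first exact: measurable_cst.
by under eq_integral do rewrite expr0n/=; rewrite integral0.
Qed.

Lemma square_integrableZ c f :
  square_integrable f -> square_integrable (fun x => c * f x).
Proof.
move=> Lf; split; first by apply: measurable_funM => //; case: Lf.
under eq_integral do rewrite exprMn EFinM.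
rewrite ge0_integralZl//.
- by rewrite lte_mul_pinfty ?lee_fin ?sqr_ge0//; case: Lf.
- by apply/measurable_EFinP/measurable_funX; case: Lf.
- by move=> x _; rewrite lee_fin sqr_ge0.
- by rewrite lee_fin sqr_ge0.
Qed.

Lemma le_square_integrable f g : measurable_fun setT f ->
  square_integrable g -> (forall x, `|f x| <= `|g x|) -> square_integrable f.
Proof.
move=> mf [mg goo] fg; split => //; apply: le_lt_trans goo.
apply: ge0_le_integral => //.
- by move=> x _; rewrite lee_fin sqr_ge0.
- by apply/measurable_EFinP/measurable_funX.
- by apply/measurable_EFinP/measurable_funX.
- by move=> x _; rewrite lee_fin -(ger0_norm (sqr_ge0 (f x)))
    -(ger0_norm (sqr_ge0 (g x))) !normrX lerXn2r ?nnegrE.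
Qed.

Lemma square_integrableD f g : square_integrable f -> square_integrable g ->
  square_integrable (fun x => f x + g x).
Proof.
move=> Lf Lg; have [mf foo] := Lf; have [mg goo] := Lg.
split; first exact: measurable_funD.
apply: (@le_lt_trans _ _ (\int[mu]_x ((2 * f x ^+ 2)%:E + (2 * g x ^+ 2)%:E)))%E.
  apply: ge0_le_integral => //.
  - by move=> x _; rewrite lee_fin sqr_ge0.
  - by apply/measurable_EFinP/measurable_funX; exact: measurable_funD.
  - by apply: emeasurable_funD; apply/measurable_EFinP; apply: measurable_funM => //;
      exact: measurable_funX.
  - move=> x _; rewrite -EFinD lee_fin; set a := f x; set b := g x; have := sqr_ge0 (a - b); nra.
have h (u : T -> R) : square_integrable u ->
    (\int[mu]_x ((2 * u x ^+ 2)%:E) < +oo)%E.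
  move=> Lu; under eq_integral do rewrite EFinM.
  rewrite ge0_integralZl//.
  - by rewrite lte_mul_pinfty ?lee_fin//; case: Lu.
  - by apply/measurable_EFinP/measurable_funX; case: Lu.
  - by move=> x _; rewrite lee_fin sqr_ge0.
have m2 (u : T -> R) : square_integrable u ->
    measurable_fun setT (fun x => (2 * u x ^+ 2)%:E).
  move=> [mu' _]; apply/measurable_EFinP; apply: measurable_funM => //.
  exact: measurable_funX.
rewrite ge0_integralD//; first by rewrite lte_add_pinfty// h.
- by move=> x _; rewrite lee_fin mulr_ge0// sqr_ge0.
- exact: m2.
- by move=> x _; rewrite lee_fin mulr_ge0// sqr_ge0.
- exact: m2.
Qed.

Lemma square_integrableB f g : square_integrable f -> square_integrable g ->
  square_integrable (fun x => f x - g x).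
Proof.
move=> Lf Lg; rewrite (_ : (fun _ => _) = (fun x => f x + (-1) * g x)).
  by apply: square_integrableD => //; exact: square_integrableZ.
by apply/funext => x; rewrite mulN1r.
Qed.

Lemma square_integrable_sum (I : Type) (s : seq I) (f : I -> T -> R) :
  (forall i, square_integrable (f i)) ->
  square_integrable (fun x => \sum_(i <- s) f i x).
Proof.
move=> Lf; elim: s => [|i s IH].
  by under eq_fun do rewrite big_nil; exact: square_integrable0.
by under eq_fun do rewrite big_cons; exact: square_integrableD.
Qed.

Lemma innerC f g : inner f g = inner g f.
Proof. by apply: eq_Rintegral => x _; rewrite mulrC. Qed.

Lemma innerDl f g h : square_integrable f -> square_integrable g ->
  square_integrable h -> inner (fun x => f x + g x) h = inner f h + inner g h.
Proof.
move=> Lf Lg Lh; rewrite /inner; under eq_Rintegral do rewrite mulrDl.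
by rewrite RintegralD//; exact: integrable_mul.
Qed.

Lemma innerZl c f g : square_integrable f -> square_integrable g ->
  inner (fun x => c * f x) g = c * inner f g.
Proof.
move=> Lf Lg; rewrite /inner; under eq_Rintegral do rewrite -mulrA.
by rewrite RintegralZl//; exact: integrable_mul.
Qed.

Lemma inner0l g : inner (fun=> 0) g = 0.
Proof.
rewrite /inner; under eq_Rintegral do rewrite mul0r.
by rewrite /Rintegral integral0.
Qed.

Lemma innerBl f g h : square_integrable f -> square_integrable g ->
  square_integrable h -> inner (fun x => f x - g x) h = inner f h - inner g h.
Proof.
move=> Lf Lg Lh; rewrite /inner; under eq_Rintegral do rewrite mulrBl.
by rewrite RintegralB//; exact: integrable_mul.
Qed.

Lemma innerDr f g h : square_integrable f -> square_integrable g ->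
  square_integrable h -> inner f (fun x => g x + h x) = inner f g + inner f h.
Proof. by move=> *; rewrite innerC innerDl// !(innerC f). Qed.

Lemma innerBr f g h : square_integrable f -> square_integrable g ->
  square_integrable h -> inner f (fun x => g x - h x) = inner f g - inner f h.
Proof. by move=> *; rewrite innerC innerBl// !(innerC f). Qed.

Lemma innerZr c f g : square_integrable f -> square_integrable g ->
  inner f (fun x => c * g x) = c * inner f g.
Proof. by move=> *; rewrite innerC innerZl// innerC. Qed.

Lemma inner0r f : inner f (fun=> 0) = 0.
Proof. by rewrite innerC inner0l. Qed.

Lemma inner_suml (I : Type) (s : seq I) (f : I -> T -> R) g :
  (forall i, square_integrable (f i)) -> square_integrable g ->
  inner (fun x => \sum_(i <- s) f i x) g = \sum_(i <- s) inner (f i) g.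
Proof.
move=> Lf Lg; elim: s => [|i s IH].
  by under eq_fun do rewrite big_nil; rewrite inner0l big_nil.
under eq_fun do rewrite big_cons; rewrite innerDl ?big_cons ?IH//.
exact: square_integrable_sum.
Qed.

Lemma inner_sumr (I : Type) (s : seq I) (f : I -> T -> R) g :
  (forall i, square_integrable (f i)) -> square_integrable g ->
  inner g (fun x => \sum_(i <- s) f i x) = \sum_(i <- s) inner g (f i).
Proof.
by move=> *; rewrite innerC inner_suml//; apply: eq_bigr => i _; rewrite innerC.
Qed.

Lemma inner_sub_sqr f g : square_integrable f -> square_integrable g ->
  inner (fun x => f x - g x) (fun x => f x - g x) =
  inner f f - 2 * inner f g + inner g g.
Proof.
move=> Lf Lg; rewrite (innerBl Lf Lg (square_integrableB Lf Lg)).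
rewrite (innerBr Lf Lf Lg) (innerBr Lg Lf Lg) (innerC g f); ring.
Qed.

Lemma inner_ge0 f : 0 <= inner f f.
Proof. by apply: Rintegral_ge0 => x _; rewrite -expr2 sqr_ge0. Qed.

Lemma EFin_inner f g : square_integrable f -> square_integrable g ->
  (inner f g)%:E = (\int[mu]_x (f x * g x)%:E)%E.
Proof.
move=> Lf Lg; rewrite /inner /Rintegral fineK//.
by apply: integrable_fin_num => //; exact: integrable_mul.
Qed.

Lemma EFin_inner_sqr f : square_integrable f ->
  (inner f f)%:E = (\int[mu]_x (f x ^+ 2)%:E)%E.
Proof. by move=> Lf; rewrite EFin_inner. Qed.

Lemma l2norm_ge0 f : 0 <= l2norm f. Proof. exact: sqrtr_ge0. Qed.

Lemma l2norm_sqr f : l2norm f ^+ 2 = inner f f.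
Proof. by rewrite sqr_sqrtr// inner_ge0. Qed.

Lemma cauchy_schwarz f g : square_integrable f -> square_integrable g ->
  `|inner f g| <= l2norm f * l2norm g.
Proof.
move=> Lf Lg.
have key (t : R) : 0 <= inner f f + 2 * t * inner f g + t ^+ 2 * inner g g.
  have Lt := square_integrableZ t Lg.
  have := inner_ge0 (fun x => f x + t * g x).
  rewrite innerDl ?innerDr ?innerZl ?innerZr//; last exact: square_integrableD.
  by rewrite (innerC g f) => /le_trans; apply; rewrite le_eqVlt; apply/orP; left;
    apply/eqP; ring.
have fg : inner f g ^+ 2 <= inner f f * inner g g.
  have := inner_ge0 g; rewrite le_eqVlt => /predU1P[g0|g0]; last first.
    have := key (- inner f g / inner g g).
    set a := inner f f; set b := inner f g; set c := inner g g in g0 * => H.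
    have {}H : 0 <= (a * c - b ^+ 2) / c.
      by apply: le_trans H _; rewrite le_eqVlt; apply/orP; left; apply/eqP; field;
         rewrite gt_eqF.
    by move: H; rewrite pmulr_lge0 ?invr_gt0// subr_ge0.
  rewrite -g0 mulr0; have [->|b0] := eqVneq (inner f g) 0; first by rewrite expr0n.
  (* If |g| = 0 the quadratic is affine in t; this t gives it the value -1. *)
  have := key (- (inner f f + 1) / (2 * inner f g)); rewrite -g0 mulr0 addr0.
  set a := inner f f; set b := inner f g in b0 * => H.
  suff : 0 <= -1 :> R by rewrite ler0N1.
  by apply: le_trans H _; rewrite le_eqVlt; apply/orP; left; apply/eqP; field.
rewrite -[leLHS]ger0_norm// -(ler_sqr (x := `| _ |)) ?nnegrE ?mulr_ge0 ?l2norm_ge0//.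
by rewrite exprMn !l2norm_sqr real_normK ?num_real// real_normK ?num_real.
Qed.

Lemma l2normZ c f : square_integrable f ->
  l2norm (fun x => c * f x) = `|c| * l2norm f.
Proof.
move=> Lf; rewrite /l2norm innerZl ?innerZr//; last exact: square_integrableZ.
by rewrite mulrA -expr2 sqrtrM ?sqr_ge0// sqrtr_sqr.
Qed.

Lemma ler_l2normD f g : square_integrable f -> square_integrable g ->
  l2norm (fun x => f x + g x) <= l2norm f + l2norm g.
Proof.
move=> Lf Lg; rewrite -ler_sqr ?nnegrE ?addr_ge0 ?l2norm_ge0// l2norm_sqr.
have Lfg := square_integrableD Lf Lg.
rewrite innerDl ?innerDr// sqrrD !l2norm_sqr (innerC g f).
have := cauchy_schwarz Lf Lg; rewrite ler_norml => /andP[_].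
move: (inner _ _) (inner _ _) (inner _ _) => a b c; lra.
Qed.

Lemma ler_l2normB f g : square_integrable f -> square_integrable g ->
  l2norm (fun x => f x - g x) <= l2norm f + l2norm g.
Proof.
move=> Lf Lg; rewrite (_ : (fun _ => _) = (fun x => f x + (-1) * g x)); last first.
  by apply/funext => x; rewrite mulN1r.
apply: (le_trans (ler_l2normD _ _)) => //; first exact: square_integrableZ.
by rewrite l2normZ// normrN1 mul1r.
Qed.

Lemma l2norm0 : l2norm (fun=> 0) = 0.
Proof. by rewrite /l2norm inner0l sqrtr0. Qed.

Lemma ler_l2norm_sum (I : Type) (s : seq I) (f : I -> T -> R) :
  (forall i, square_integrable (f i)) ->
  l2norm (fun x => \sum_(i <- s) f i x) <= \sum_(i <- s) l2norm (f i).
Proof.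
move=> Lf; elim: s => [|i s IH].
  by under eq_fun do rewrite big_nil; rewrite l2norm0 big_nil.
under eq_fun do rewrite big_cons; rewrite big_cons.
apply: (le_trans (ler_l2normD _ _)) => //; first exact: square_integrable_sum.
by rewrite lerD2l.
Qed.

Lemma ler_inner_sqr f g : square_integrable f -> square_integrable g ->
  (forall x, `|f x| <= `|g x|) -> inner f f <= inner g g.
Proof.
move=> Lf Lg fg; rewrite -lee_fin !EFin_inner_sqr//.
apply: ge0_le_integral => //.
- by move=> x _; rewrite lee_fin sqr_ge0.
- by apply/measurable_EFinP/measurable_funX; case: Lf.
- by apply/measurable_EFinP/measurable_funX; case: Lg.
- by move=> x _; rewrite lee_fin -(ger0_norm (sqr_ge0 (f x)))
    -(ger0_norm (sqr_ge0 (g x))) !normrX lerXn2r ?nnegrE.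
Qed.

(** Fatou: L2 balls are closed under pointwise a.e. limits. *)
Lemma l2norm_fatou (u : nat -> T -> R) f (c : R) : measurable_fun setT f ->
  (forall k, square_integrable (u k)) -> (forall k, inner (u k) (u k) <= c) ->
  {ae mu, forall x, u k x @[k --> \oo] --> f x} ->
  square_integrable f /\ inner f f <= c.
Proof.
move=> mf Lu uc uf.
have H : (\int[mu]_x (f x ^+ 2)%:E <= c%:E)%E.
  have m2 (g : T -> R) : measurable_fun setT g ->
      measurable_fun setT (fun x => (g x ^+ 2)%:E).
    by move=> mg; apply/measurable_EFinP/measurable_funX.
  rewrite (@ae_eq_integral _ _ _ mu _ (fun x => limn_einf (fun k => (u k x ^+ 2)%:E)))//.
  - apply: le_trans (fatou _ measurableT _ _) _ => //.
    + by move=> k; apply: m2; case: (Lu k).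
    + by move=> k x _; rewrite lee_fin sqr_ge0.
    rewrite limn_einf_lim; apply: lime_le; first exact: is_cvg_einfs.
    apply: nearW => k; apply: (@le_trans _ _ (\int[mu]_x ((u k x ^+ 2)%:E))%E).
      by apply: ereal_inf_lbound; exists k => /=.
    by rewrite -EFin_inner_sqr// lee_fin.
  - exact: m2.
  - rewrite (_ : (fun _ => _) = fun x =>
        (- limn_esup (fun k => - (u k x ^+ 2)%:E))%E); last first.
      by apply/funext => x; rewrite -limn_einfN; congr limn_einf;
        apply/funext => k /=; rewrite opprK.
    apply: measurableT_comp => //; apply: measurable_fun_limn_esup => // k.
    by apply: measurableT_comp => //; apply: m2; case: (Lu k).
  - apply: filterS uf => x ux _.
    have h : (u k x ^+ 2)%:E @[k --> \oo] --> (f x ^+ 2)%:E.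
      by apply: cvg_EFin; [exact: nearW|apply: cvgM].
    by rewrite is_cvg_limn_einfE; [rewrite (cvg_lim _ h)|apply/cvg_ex; eexists; exact: h].
have Lf : square_integrable f by split => //; exact: le_lt_trans H (ltry _).
by split => //; rewrite -lee_fin EFin_inner_sqr.
Qed.

End SquareIntegrable.

Section SquareIntegrableConvergence.
Context d (T : measurableType d) (R : realType).
Variable mu : {measure set T -> \bar R}.
Implicit Types f g : T -> R.
Local Notation L2 := (square_integrable mu).
Local Notation norm := (l2norm mu).

Lemma square_integrable_ae f g : measurable_fun setT g -> L2 f ->
  {ae mu, forall x, f x = g x} -> L2 g.
Proof.
move=> mg [mf foo] fg; split => //; apply: le_lt_trans foo.
rewrite (@ae_eq_integral _ _ _ mu _ (fun x => (f x ^+ 2)%:E))//.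
- by apply/measurable_EFinP/measurable_funX.
- by apply/measurable_EFinP/measurable_funX.
- by apply: filterS fg => x -> _.
Qed.

Lemma inner_ae f g f' g' : L2 f -> L2 f' -> L2 g -> L2 g' ->
  {ae mu, forall x, f x = f' x} -> {ae mu, forall x, g x = g' x} ->
  inner mu f g = inner mu f' g'.
Proof.
move=> [mf _] [mf' _] [mg _] [mg' _] ff' gg'; rewrite /inner /Rintegral; congr fine.
apply: ae_eq_integral => //.
- by apply/measurable_EFinP/measurable_funM.
- by apply/measurable_EFinP/measurable_funM.
- by apply: filterS2 ff' gg' => x -> -> _.
Qed.

(** Continuity of the inner product: every isometry below passes to mean-square
    limits through it. *)
Lemma inner_cvg (u v : nat -> T -> R) f g :
  (forall k, L2 (u k)) -> (forall k, L2 (v k)) -> L2 f -> L2 g ->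
  norm (fun x => u k x - f x) @[k --> \oo] --> 0 ->
  norm (fun x => v k x - g x) @[k --> \oo] --> 0 ->
  inner mu (u k) (v k) @[k --> \oo] --> inner mu f g.
Proof.
move=> Lu Lv Lf Lg uf vg.
have Luf k := square_integrableB (Lu k) Lf.
have Lvg k := square_integrableB (Lv k) Lg.
apply/cvgrPdist_le => /= e e0.
pose r k := norm (fun x => u k x - f x) * (norm (fun x => v k x - g x) + norm g)
            + norm f * norm (fun x => v k x - g x).
have r0 : r k @[k --> \oo] --> 0.
  rewrite -[0](_ : 0 * (0 + norm g) + norm f * 0 = 0); last first.
    by rewrite mul0r mulr0 addr0.
  by apply: cvgD; apply: cvgM => //; [apply: cvgD => //; exact: cvg_cst|exact: cvg_cst].
near=> k.
apply: (@le_trans _ _ (r k)); last first.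
  apply: le_trans (ler_norm _) _; rewrite -[r k]subr0 -normrN opprB.
  by near: k; move/cvgrPdist_le : r0; exact.
rewrite distrC.
have -> : inner mu (u k) (v k) - inner mu f g =
    inner mu (fun x => u k x - f x) (v k) + inner mu f (fun x => v k x - g x).
  by rewrite innerBl// innerBr//; lra.
apply: le_trans (ler_normD _ _) _; apply: lerD; last exact: cauchy_schwarz.
apply: le_trans (cauchy_schwarz _ _) _ => //; apply: ler_wpM2l; first exact: l2norm_ge0.
apply: le_trans _ (ler_l2normD (Lvg k) Lg).
by rewrite le_eqVlt; apply/orP; left; apply/eqP; congr norm; apply/funext => x; lra.
Unshelve. all: by end_near. Qed.

End SquareIntegrableConvergence.

Section Independence.
Context d (T : measurableType d) (R : realType) (P : probability T R).

(** The joint law of an independent pair is the product of its two laws, so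
    Fubini factors the expectation of the product. *)
Lemma independent_integral_mul (X Y : T -> R) :
  measurable_fun setT X -> measurable_fun setT Y ->
  P.-integrable setT (EFin \o X) -> P.-integrable setT (EFin \o Y) ->
  (forall A B : set R, measurable A -> measurable B ->
     P (X @^-1` A `&` Y @^-1` B) = (P (X @^-1` A) * P (Y @^-1` B))%E) ->
  P.-integrable setT (EFin \o (fun w => X w * Y w)) /\
  \int[P]_w (X w * Y w) = (\int[P]_w X w) * (\int[P]_w Y w).
Proof.
move=> mX mY iX iY XY.
pose X' : {RV P >-> R} := mfun_Sub (mem_set mX).
pose Y' : {RV P >-> R} := mfun_Sub (mem_set mY).
have mXY : measurable_fun setT (fun w => (X w, Y w)).
  exact/measurable_fun_pair.
pose XY' : {mfun T >-> _} := mfun_Sub (mem_set mXY).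
pose law := pushforward P XY'.
have lawE : forall S, measurable S ->
    (distribution P X' \x distribution P Y')%E S = law S.
  apply: product_measure_unique => A B mA mB.
  by rewrite /law /pushforward -XY//.
pose g (z : R * R) := (z.1 * z.2)%:E.
have mg : measurable_fun setT g.
  by apply/measurable_EFinP/measurable_funM.
have absE (h : R * R -> \bar R) : measurable_fun setT h ->
    (forall z, 0 <= h z)%E ->
    (\int[P]_w h (X w, Y w) =
     \int[distribution P X']_x \int[distribution P Y']_y h (x, y))%E.
  move=> mh h0; rewrite -(fubini_tonelli1 h)//.
  rewrite (eq_measure_integral law); last by move=> A mA _; first [exact: lawE|exact/esym/lawE].
  by rewrite ge0_integral_pushforward.
have iXY : P.-integrable setT (EFin \o (fun w => X w * Y w)).
  apply/integrableP; split; first by apply/measurable_EFinP/measurable_funM.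
  have mabs : measurable_fun setT (fun y : R => `|y%:E|%E).
    exact: measurableT_comp.
  have -> : (\int[P]_w `|(EFin \o (fun w => (X w * Y w)%R)) w| =
      \int[distribution P X']_x \int[distribution P Y']_y `|g (x, y)|)%E.
    by apply: (absE (fun z => `|g z|%E)) => //; exact: measurableT_comp.
  rewrite (eq_integral (fun x : R =>
      `|x%:E| * \int[distribution P Y']_y `|y%:E|)%E).
    rewrite ge0_integralZr//; last exact: integral_ge0.
    rewrite !ge0_integral_pushforward//.
    move/integrableP : iX => [_ +]; move/integrableP : iY => [_].
    move=> /= Yoo Xoo.
    rewrite lte_mul_pinfty//; first exact: integral_ge0.
    by rewrite ge0_fin_numE//; exact: integral_ge0.
  move=> x _; rewrite -ge0_integralZl//.
  by apply: eq_integral => y _; rewrite -abseM.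
split=> //.
have idX : (distribution P X').-integrable setT (fun x : R => x%:E).
  by apply: integrable_pushforward => //; exact/measurable_EFinP.
have idY : (distribution P Y').-integrable setT (fun x : R => x%:E).
  by apply: integrable_pushforward => //; exact/measurable_EFinP.
have ig : (distribution P X' \x distribution P Y')%E.-integrable setT g.
  apply/integrableP; split => //.
  rewrite (eq_measure_integral law); last by move=> A mA _; exact: lawE.
  rewrite ge0_integral_pushforward//; last exact: measurableT_comp.
  by move/integrableP : iXY => [].
have E : (\int[P]_w (X w * Y w)%:E = (\int[P]_w (X w)%:E) * \int[P]_w (Y w)%:E)%E.
  transitivity (\int[law]_z g z)%E; first by rewrite integral_pushforward.
  transitivity (\int[distribution P X' \x distribution P Y']_z g z)%E.
    by apply: eq_measure_integral => A mA _; exact/esym/lawE.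
  rewrite -integral12_prod_meas1//.
  rewrite (eq_integral (fun x : R =>
      x%:E * \int[distribution P Y']_y y%:E)%E); last first.
    move=> x _; rewrite -integralZl//.
  have fY : (\int[distribution P Y']_y y%:E = \int[P]_w (Y w)%:E)%E.
    by rewrite integral_pushforward.
  have fX : (\int[distribution P X']_y y%:E = \int[P]_w (X w)%:E)%E.
    by rewrite integral_pushforward.
  have finY : (\int[P]_w (Y w)%:E)%E \is a fin_num by exact: integrable_fin_num.
  by rewrite fY -(fineK finY) integralZr// fX.
rewrite /Rintegral E fineM//.
- exact: (integrable_fin_num measurableT iX).
- exact: (integrable_fin_num measurableT iY).
Qed.
End Independence.

(** * Second moments of the Levy increments *)

Section MeasurableWrt.
Context d (Omega : measurableType d) (R : realType).
Implicit Types (G : set (set Omega)) (f g : Omega -> R).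

Definition measurable_wrt G f := forall B : set R, measurable B -> G (f @^-1` B).

Lemma measurable_wrtP G f : sigma_algebra setT G ->
  measurable_wrt G f <->
  measurable_fun (setT : set (g_sigma_algebraType G)) (f : g_sigma_algebraType G -> R).
Proof.
move=> sG; split=> [mf _ B mB|mf B mB].
  by rewrite setTI; apply: sub_sigma_algebra; exact: mf.
have := mf measurableT B mB; rewrite setTI.
by rewrite /measurable/= sigma_algebra_id.
Qed.

Lemma measurable_wrtM G f g : sigma_algebra setT G ->
  measurable_wrt G f -> measurable_wrt G g -> measurable_wrt G (fun w => f w * g w).
Proof.
by move=> sG /(measurable_wrtP _ sG) mf /(measurable_wrtP _ sG) mg;
  apply/(measurable_wrtP _ sG); exact: measurable_funM.
Qed.

Lemma measurable_wrtB G f g : sigma_algebra setT G ->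
  measurable_wrt G f -> measurable_wrt G g -> measurable_wrt G (fun w => f w - g w).
Proof.
by move=> sG /(measurable_wrtP _ sG) mf /(measurable_wrtP _ sG) mg;
  apply/(measurable_wrtP _ sG); exact: measurable_funB.
Qed.

End MeasurableWrt.

Section LevyMoments.
Context (R : realType) d (Omega : measurableType d) (P : probability Omega R).
Context (T : R) (Fl : R -> set (set Omega)).
Hypothesis Fl_usual : usual_filtration P T Fl.
Context (q : nat) (K : 'M[R]_q) (M : R -> Omega -> 'cV[R]_q).
Hypothesis M_levy : levy_process P T Fl K M.
Local Notation L2 := (square_integrable P).

Lemma filtration_measurable_fun t (f : Omega -> R) : 0 <= t <= T ->
  measurable_wrt (Fl t) f -> measurable_fun setT f.
Proof.
move=> tT mf _ B mB; rewrite setTI.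
exact: (flt_measurable Fl_usual tT (mf B mB)).
Qed.

Lemma filtration_measurable_wrtS s t (f : Omega -> R) : 0 <= s -> s <= t -> t <= T ->
  measurable_wrt (Fl s) f -> measurable_wrt (Fl t) f.
Proof. move=> s0 st tT mf B mB; exact: (flt_mono Fl_usual s0 st tT (mf B mB)). Qed.

Lemma levy_measurable_wrt t i : 0 <= t <= T ->
  measurable_wrt (Fl t) (fun w => M t w i 0).
Proof. by move=> tT B mB; exact: (levy_adapted M_levy tT). Qed.

Lemma levy_L2 t i : 0 <= t <= T -> L2 (fun w => M t w i 0).
Proof.
move=> tT; split.
  exact: filtration_measurable_fun tT (levy_measurable_wrt i tT).
exact: (integrable_lty measurableT (levy_square_integrable M_levy i tT)).
Qed.

Definition levy_increment i s t w := M t w i 0 - M s w i 0.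

Lemma levy_increment_L2 i s t : 0 <= s <= T -> 0 <= t <= T ->
  L2 (levy_increment i s t).
Proof. by move=> sT tT; apply: square_integrableB; exact: levy_L2. Qed.

Lemma borel_cV_coord (i : 'I_q) :
  measurable_fun (setT : set (g_sigma_algebraType
    [set D | exists (i : 'I_q) (B : set R),
         measurable B /\ D = [set v : 'cV[R]_q | B (v i 0)]]))
    (fun v : 'cV[R]_q => v i 0).
Proof.
move=> _ B mB; rewrite setTI; apply: sub_sigma_algebra.
by exists i, B.
Qed.

Lemma integrable_L2 (f : Omega -> R) : L2 f -> P.-integrable setT (EFin \o f).
Proof.
move=> Lf; have L1 : L2 (fun=> 1).
  split; first exact: measurable_cst.
  under eq_integral do rewrite expr1n.
  by rewrite integral_cst// mul1e; apply: (@le_lt_trans _ _ 1%E);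
    [exact: probability_le1|exact: ltry].
by have := integrable_mul Lf L1; under eq_fun do rewrite mulr1.
Qed.

(** The form in which independence is used: [phi] is a coordinate of the
    increment, for the martingale property, or a product of two coordinates,
    for the isometry. *)
Lemma levy_increment_independent (eta : Omega -> R) (phi : 'cV[R]_q -> R) s t :
  0 <= s -> s <= t -> t <= T -> measurable_wrt (Fl s) eta ->
  P.-integrable setT (EFin \o eta) ->
  (forall B : set R, measurable B -> borel_cV (phi @^-1` B)) ->
  P.-integrable setT (EFin \o (fun w => phi (M t w - M s w))) ->
  P.-integrable setT (EFin \o (fun w => eta w * phi (M t w - M s w))) /\
  \int[P]_w (eta w * phi (M t w - M s w)) =
    (\int[P]_w eta w) * (\int[P]_w phi (M t w - M s w)).
Proof.
move=> s0 st tT meta ieta mphi iphi.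
have sT : 0 <= s <= T by rewrite s0 (le_trans st).
apply: independent_integral_mul => //.
- exact: filtration_measurable_fun meta.
- by apply/measurable_EFinP; exact: (measurable_int P).
- move=> A B mA mB.
  have := @levy_indep_increments _ _ _ _ _ _ _ _ _ M_levy s (t - s) (eta @^-1` A)
    (phi @^-1` B).
  rewrite /increment subrKC; apply => //; first by rewrite subr_ge0.
  - exact: meta.
  - exact: mphi.
Qed.

Lemma levy_mean t i : 0 <= t <= T -> \int[P]_w (M t w i 0) = 0.
Proof.
by move=> tT; have := levy_mean_zero M_levy i tT; rewrite unlock /Rintegral => ->.
Qed.

Lemma levy_covarianceE t i j : 0 <= t <= T ->
  inner P (fun w => M t w i 0) (fun w => M t w j 0) = K i j * t.
Proof.
move=> tT; have := levy_covariance M_levy i j tT; rewrite unlock.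
rewrite /inner /Rintegral => E; rewrite -[RHS]/(fine (K i j * t)%:E) -E.
congr fine; apply: eq_integral => w _; congr EFin.
by rewrite mxE big_ord1 !mxE.
Qed.

(** The martingale property in L2: the increment is independent of the past and
    has mean zero. *)
Lemma levy_orthogonal (eta : Omega -> R) s t i : 0 <= s -> s <= t -> t <= T ->
  L2 eta -> measurable_wrt (Fl s) eta -> inner P eta (levy_increment i s t) = 0.
Proof.
move=> s0 st tT Leta meta.
have sT : 0 <= s <= T by rewrite s0 (le_trans st).
have tT' : 0 <= t <= T by rewrite tT (le_trans s0).
have dE : levy_increment i s t = (fun w => (fun v : 'cV_q => v i 0) (M t w - M s w)).
  by apply/funext => w; rewrite /= !mxE.
have [//|||] := @levy_increment_independent eta (fun v => v i 0) s t s0 st tT meta.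
- exact: integrable_L2.
- by move=> B mB; have := borel_cV_coord i measurableT mB; rewrite setTI.
- have := integrable_L2 (levy_increment_L2 i sT tT').
  by rewrite dE.
move=> _; rewrite /inner dE /= => ->.
under [X in _ * X]eq_Rintegral do rewrite !mxE.
rewrite RintegralB//; first by rewrite !levy_mean// subrr mulr0.
- by apply: integrable_L2; exact: levy_L2.
- by apply: integrable_L2; exact: levy_L2.
Qed.

(** The mixed second moment at the times s and t is the one at time s, since the
    increment is orthogonal to M(s). *)
Lemma levy_increment_covariance s t i j : 0 <= s -> s <= t -> t <= T ->
  inner P (levy_increment i s t) (levy_increment j s t) = K i j * (t - s).
Proof.
move=> s0 st tT.
have sT : 0 <= s <= T by rewrite s0 (le_trans st).
have tT' : 0 <= t <= T by rewrite tT (le_trans s0).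
have Ms k : L2 (fun w => M s w k 0) by exact: levy_L2.
have Mt k : L2 (fun w => M t w k 0) by exact: levy_L2.
have o k l : inner P (fun w => M s w k 0) (fun w => M t w l 0) = K k l * s.
  have := levy_orthogonal l s0 st tT (Ms k) (levy_measurable_wrt k sT).
  rewrite /levy_increment innerBr// => /eqP; rewrite subr_eq0 => /eqP ->.
  exact: levy_covarianceE.
rewrite /levy_increment innerBl ?innerBr//; last exact: square_integrableB.
rewrite o levy_covarianceE// levy_covarianceE// innerC o.
suff -> : K j i * s = K i j * s by lra.
by rewrite -levy_covarianceE// innerC levy_covarianceE.
Qed.

Lemma levy_cov_sym i j : 0 < T -> K i j = K j i.
Proof.
move=> T0; apply: (@mulIf _ T); first by rewrite gt_eqF.
have TT : 0 <= T <= T by rewrite lexx ltW.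
by rewrite -!levy_covarianceE// innerC.
Qed.

(** The second moments of an increment conditionally on the past: what makes the
    isometry hold for random step values. *)
Lemma levy_increment_covariance_wrt (eta : Omega -> R) s t i j :
  0 <= s -> s <= t -> t <= T -> L2 eta -> measurable_wrt (Fl s) eta ->
  P.-integrable setT (EFin \o
    (fun w => eta w * (levy_increment i s t w * levy_increment j s t w))) /\
  \int[P]_w (eta w * (levy_increment i s t w * levy_increment j s t w)) =
    (\int[P]_w eta w) * (K i j * (t - s)).
Proof.
move=> s0 st tT Leta meta.
have sT : 0 <= s <= T by rewrite s0 (le_trans st).
have tT' : 0 <= t <= T by rewrite tT (le_trans s0).
pose phi (v : 'cV[R]_q) := v i 0 * v j 0.
have dE : (fun w => phi (M t w - M s w)) =
    (fun w => levy_increment i s t w * levy_increment j s t w).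
  by apply/funext => w; rewrite /phi !mxE.
have [//|||] := @levy_increment_independent eta phi s t s0 st tT meta.
- exact: integrable_L2.
- move=> B mB.
  have := measurable_funM (borel_cV_coord i) (borel_cV_coord j).
  by move=> /(_ measurableT B mB); rewrite setTI.
- rewrite dE; apply: (integrable_mul (levy_increment_L2 i sT tT')).
  exact: levy_increment_L2.
have -> : (fun w => eta w * phi (M t w - M s w)) =
    (fun w => eta w * (levy_increment i s t w * levy_increment j s t w)).
  by apply/funext => w; rewrite /phi !mxE.
by rewrite dE -levy_increment_covariance.
Qed.

End LevyMoments.

(** * The isometry for integrals of step processes *)

Section Strip.
Context (R : realType) d (Omega : measurableType d) (P : probability Omega R).
Implicit Types (h g : R * Omega -> R) (eta : Omega -> R).

Definition strip (a b : R) h (p : R * Omega) : R :=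
  if a < p.1 <= b then h p else 0.

Local Notation time_space := ((@lebesgue_measure R \x P)%E).

(** The length of the intersection of (a, b] and (a', b']. *)
Definition overlap (a b a' b' : R) : R :=
  Num.max 0 (Num.min b b' - Num.max a a').

Lemma measurable_strip a b h :
  measurable_fun setT h -> measurable_fun setT (strip a b h).
Proof.
move=> mh; apply: measurable_fun_ifT => //.
apply: measurable_and.
- by apply: measurable_fun_ltr => //; exact: measurable_fst.
- by apply: measurable_fun_ler => //; exact: measurable_fst.
Qed.

Lemma strip_L2 a b h :
  square_integrable time_space h -> square_integrable time_space (strip a b h).
Proof.
move=> Lh; apply: (le_square_integrable _ Lh) => [|p].
  by apply: measurable_strip; case: Lh.
by rewrite /strip; case: ifP => // _; rewrite normr0.
Qed.

Lemma stripM a b a' b' h g p :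
  strip a b h p * strip a' b' g p =
  strip (Num.max a a') (Num.min b b') (fun p => h p * g p) p.
Proof.
rewrite /strip gt_max le_min.
by case: (a < _); case: (a' < _); case: (_ <= b); case: (_ <= b');
  rewrite /= ?mulr0 ?mul0r.
Qed.

Lemma strip_strip a b a' b' h :
  strip a b (strip a' b' h) = strip (Num.max a a') (Num.min b b') h.
Proof.
apply/funext => p; rewrite /strip gt_max le_min.
by case: (a < _); case: (a' < _); case: (_ <= b); case: (_ <= b').
Qed.

Lemma lebesgue_measure_itv_oc (a b : R) :
  lebesgue_measure `]a, b]%classic = (Num.max 0 (b - a))%:E.
Proof.
rewrite lebesgue_measure_itv/= lte_fin; case: ltP => ab.
  by rewrite -EFinB max_r// subr_ge0 ltW.
by rewrite max_l// subr_le0.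
Qed.

Let estrip (a b : R) (f : Omega -> \bar R) (p : R * Omega) : \bar R :=
  if a < p.1 <= b then f p.2 else 0%E.

Lemma integral_strip_snd a b (f : Omega -> \bar R) :
  measurable_fun setT f -> (forall w, 0 <= f w)%E ->
  (\int[time_space]_p estrip a b f p =
   (Num.max 0 (b - a))%:E * \int[P]_w f w)%E.
Proof.
move=> mf f0; rewrite /time_space fubini_tonelli1; last 2 first.
- apply: measurable_fun_ifT => //; last exact: measurableT_comp.
  apply: measurable_and.
  + by apply: measurable_fun_ltr => //; exact: measurable_fst.
  + by apply: measurable_fun_ler => //; exact: measurable_fst.
- by move=> p; rewrite /estrip; case: ifP.
rewrite -lebesgue_measure_itv_oc.
have FE (s : R) : (fubini_F P (estrip a b f) s =
    (\1_(`]a, b]%classic) s)%:E * \int[P]_w f w)%E.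
  rewrite /fubini_F /estrip /= indicE; case: (boolP (a < s <= b)) => ab.
    by rewrite mem_set /= ?in_itv// mul1e.
  by rewrite memNset /= ?in_itv/= ?(negbTE ab)// mul0e integral0.
transitivity (\int[lebesgue_measure]_s ((\1_(`]a, b]%classic) s)%:E * \int[P]_w f w))%E.
  by apply: eq_integral => s _; exact: FE.
rewrite ge0_integralZr//.
- by rewrite integral_indic// setIT.
- by apply/measurable_EFinP.
- exact: integral_ge0.
Qed.

Lemma strip_snd_L2 a b eta : square_integrable P eta ->
  square_integrable time_space (strip a b (eta \o snd)).
Proof.
move=> [meta foo]; split.
  by apply: measurable_strip; exact: measurableT_comp.
under eq_integral => p _.
  rewrite (_ : _%:E = estrip a b (fun w => (eta w ^+ 2)%:E) p); last first.
    by rewrite /strip /estrip; case: ifP => //; rewrite expr0n.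
  over.
rewrite (integral_strip_snd a b (f := fun w => (eta w ^+ 2)%:E)).
- by rewrite lte_mul_pinfty// ?lee_fin ?le_max ?lexx//.
- by apply/measurable_EFinP/measurable_funX.
- by move=> w; rewrite lee_fin sqr_ge0.
Qed.

(** For a single [xi] the integrand is a square and Tonelli applies; the general
    case follows by polarization. *)
Lemma inner_strip_snd a b a' b' eta eta' :
  square_integrable P eta -> square_integrable P eta' ->
  inner time_space (strip a b (eta \o snd)) (strip a' b' (eta' \o snd)) =
  overlap a b a' b' * inner P eta eta'.
Proof.
suff key xi : square_integrable P xi ->
    inner time_space (strip a b (xi \o snd)) (strip a' b' (xi \o snd)) =
    overlap a b a' b' * inner P xi xi.
  move=> Le Le'.
  have LD := square_integrableD Le Le'.
  have comm a1 b1 a2 b2 (u v : Omega -> R) :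
      inner time_space (strip a1 b1 (u \o snd)) (strip a2 b2 (v \o snd)) =
      inner time_space (strip a1 b1 (v \o snd)) (strip a2 b2 (u \o snd)).
    rewrite /inner; apply: eq_Rintegral => p _; rewrite !stripM /strip.
    by case: ifP => //= _; rewrite mulrC.
  have sD a1 b1 : strip a1 b1 ((fun w => eta w + eta' w) \o snd) =
      (fun p => strip a1 b1 (eta \o snd) p + strip a1 b1 (eta' \o snd) p).
    by apply/funext => p; rewrite /strip; case: ifP => //; rewrite addr0.
  have E := key _ LD; rewrite !sD in E.
  have S1 := strip_snd_L2 a b Le; have S2 := strip_snd_L2 a b Le'.
  have S3 := strip_snd_L2 a' b' Le; have S4 := strip_snd_L2 a' b' Le'.
  have S5 := square_integrableD S3 S4.
  rewrite (innerDl S1 S2 S5) (innerDr S1 S3 S4) (innerDr S2 S3 S4) in E.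
  rewrite (comm _ _ _ _ eta' eta) !key// in E.
  rewrite (innerDl Le Le' LD) !innerDr// (innerC _ eta' eta) in E.
  lra.
move=> Lxi; have [mxi _] := Lxi.
apply: EFin_inj; rewrite EFin_inner; [|exact: strip_snd_L2..].
rewrite EFinM EFin_inner_sqr//.
rewrite -(integral_strip_snd _ _ (f := fun w => (xi w ^+ 2)%:E)).
- apply: eq_integral => p _; by rewrite stripM /strip /estrip; case: ifP.
- by apply/measurable_EFinP/measurable_funX.
- by move=> w; rewrite lee_fin sqr_ge0.
Qed.

End Strip.

Section StepIntegral.
Context (R : realType) d (Omega : measurableType d) (P : probability Omega R).
Context (T : R) (T_gt0 : 0 < T) (Fl : R -> set (set Omega)).
Hypothesis Fl_usual : usual_filtration P T Fl.
Context (q : nat) (K : 'M[R]_q) (M : R -> Omega -> 'cV[R]_q).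
Hypothesis M_levy : levy_process P T Fl K M.
Local Notation L2 := (square_integrable P).
Local Notation time_space := ((@lebesgue_measure R \x P)%E).
Local Notation dM := (levy_increment M).

Definition bounded_wrt s (xi : Omega -> R) :=
  measurable_wrt (Fl s) xi /\ exists c, forall w, `|xi w| <= c.

Lemma bounded_mul_L2 s xi f : 0 <= s <= T -> bounded_wrt s xi -> L2 f ->
  L2 (fun w => xi w * f w).
Proof.
move=> sT [mxi [c xic]] Lf; have [mf _] := Lf.
apply: (le_square_integrable _ (square_integrableZ c Lf)).
  by apply: measurable_funM => //; exact: (filtration_measurable_fun Fl_usual sT mxi).
by move=> w; rewrite !normrM ler_wpM2r// (le_trans (xic w))// ler_norm.
Qed.

Lemma cst_L2 (c : R) : L2 (fun=> c).
Proof.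
split; first exact: measurable_cst.
rewrite integral_cst//; apply: (@le_lt_trans _ _ ((c ^+ 2)%:E * 1)%E).
  by apply: lee_wpmul2l; [rewrite lee_fin sqr_ge0|exact: probability_le1].
by rewrite mule1 ltry.
Qed.

Lemma bounded_L2 s xi : 0 <= s <= T -> bounded_wrt s xi -> L2 xi.
Proof.
move=> sT bxi; have := bounded_mul_L2 sT bxi (cst_L2 1).
by under eq_fun do rewrite mulr1.
Qed.

Lemma bounded_wrtS s t xi : 0 <= s -> s <= t -> t <= T ->
  bounded_wrt s xi -> bounded_wrt t xi.
Proof.
by move=> s0 st tT [mxi bxi]; split => //; exact: (filtration_measurable_wrtS Fl_usual s0 st tT mxi).
Qed.

Lemma bounded_wrtM s xi xi' : 0 <= s <= T -> bounded_wrt s xi -> bounded_wrt s xi' ->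
  bounded_wrt s (fun w => xi w * xi' w).
Proof.
move=> sT [mxi [c xic]] [mxi' [c' xic']]; split.
  by apply: measurable_wrtM => //; exact: (flt_sigma_algebra Fl_usual sT).
by exists (c * c') => w; rewrite normrM ler_pM.
Qed.

Lemma levy_increment_wrt i s r t : 0 <= s <= t -> 0 <= r <= t -> t <= T ->
  measurable_wrt (Fl t) (dM i s r).
Proof.
move=> /andP[s0 st] /andP[r0 rt] tT.
have sT := le_trans st tT; have rT := le_trans rt tT.
apply: measurable_wrtB.
- by apply: (flt_sigma_algebra Fl_usual); rewrite (le_trans s0).
- by apply: (filtration_measurable_wrtS Fl_usual r0 rt tT);
    apply: (levy_measurable_wrt M_levy); rewrite r0.
- by apply: (filtration_measurable_wrtS Fl_usual s0 st tT);
    apply: (levy_measurable_wrt M_levy); rewrite s0.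
Qed.

Lemma levy_incrementD i s r t w : dM i s t w = dM i s r w + dM i r t w.
Proof. by rewrite /levy_increment; lra. Qed.

Lemma levy_incrementxx i s w : dM i s s w = 0.
Proof. by rewrite /levy_increment subrr. Qed.

Let elem xi i s r w := xi w * dM i s r w.

Let elem_L2 xi i s r : 0 <= s -> s <= r -> r <= T -> bounded_wrt s xi ->
  L2 (elem xi i s r).
Proof.
move=> s0 sr rT bxi.
have sT : 0 <= s <= T by rewrite s0 (le_trans sr).
apply: (bounded_mul_L2 sT bxi); apply: levy_increment_L2 M_levy _ _ _ _ _ => //.
by rewrite rT (le_trans s0).
Qed.

(** All that happened before s' is known when the later increment starts. *)
Let elem_disjoint xi xi' i j s r s' r' :
  0 <= s -> s <= r -> r <= s' -> s' <= r' -> r' <= T ->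
  bounded_wrt s xi -> bounded_wrt s' xi' ->
  inner P (elem xi i s r) (elem xi' j s' r') = 0.
Proof.
move=> s0 sr rs' sr' rT' bxi bxi'.
have ss' := le_trans sr rs'; have s0' := le_trans s0 ss'.
have sT' : 0 <= s' <= T by rewrite s0' (le_trans sr').
have bxi2 := bounded_wrtS s0 ss' (le_trans sr' rT') bxi.
have bb := bounded_wrtM sT' bxi2 bxi'.
pose eta w := (xi w * xi' w) * dM i s r w.
have -> : inner P (elem xi i s r) (elem xi' j s' r') = inner P eta (dM j s' r').
  by apply: eq_Rintegral => w _; rewrite /elem /eta; ring.
apply: (levy_orthogonal Fl_usual M_levy j s0' sr' rT').
- apply: (bounded_mul_L2 sT' bb); apply: (levy_increment_L2 Fl_usual M_levy).
    by rewrite s0 (le_trans ss')//; case/andP: sT'.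
  by rewrite (le_trans s0 sr) (le_trans rs')//; case/andP: sT'.
- apply: measurable_wrtM; first exact: (flt_sigma_algebra Fl_usual sT').
  + by case: bb.
  + by apply: levy_increment_wrt; rewrite ?s0 ?(le_trans s0 sr)//; case/andP: sT'.
Qed.

(** The longer interval is cut at r; beyond r, the previous lemma applies. *)
Let elem_same_start_le xi xi' i j s r r' : 0 <= s -> s <= r -> r <= r' -> r' <= T ->
  bounded_wrt s xi -> bounded_wrt s xi' ->
  inner P (elem xi i s r) (elem xi' j s r') = K i j * (r - s) * inner P xi xi'.
Proof.
move=> s0 sr rr' rT' bxi bxi'.
have rT := le_trans rr' rT'.
have sT : 0 <= s <= T by rewrite s0 (le_trans sr).
have r0 := le_trans s0 sr.
have bb := bounded_wrtM sT bxi bxi'.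
have bxi'r := bounded_wrtS s0 sr rT bxi'.
have -> : elem xi' j s r' = fun w => elem xi' j s r w + elem xi' j r r' w.
  by apply/funext => w; rewrite /elem -mulrDr -levy_incrementD.
rewrite innerDr; [|exact: elem_L2..|exact: elem_L2].
rewrite (@elem_disjoint xi xi' i j s r r r')// addr0.
have [_ /=] := levy_increment_covariance_wrt Fl_usual M_levy i j s0 sr rT
  (bounded_L2 sT bb) bb.1.
rewrite /inner mulrC => <-.
by apply: eq_Rintegral => w _; rewrite /elem; ring.
Qed.

Let elem_same_start xi xi' i j s r r' : 0 <= s ->
  s <= r -> s <= r' -> r <= T -> r' <= T -> bounded_wrt s xi -> bounded_wrt s xi' ->
  inner P (elem xi i s r) (elem xi' j s r') =
  K i j * (Num.min r r' - s) * inner P xi xi'.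
Proof.
move=> s0 sr sr' rT rT' bxi bxi'; case: (leP r r') => rr'.
  exact: elem_same_start_le.
by rewrite innerC elem_same_start_le// ?(ltW rr')// (innerC P xi')
  (levy_cov_sym M_levy j i T_gt0).
Qed.

(** The interval that starts earlier is cut at the start of the other one, which
    leaves two intervals with a common start. *)
Let elem_inner_le xi xi' i j s r s' r' : 0 <= s -> s <= s' ->
  s <= r -> s' <= r' -> r <= T -> r' <= T -> bounded_wrt s xi -> bounded_wrt s' xi' ->
  inner P (elem xi i s r) (elem xi' j s' r') =
  K i j * (overlap s r s' r' * inner P xi xi').
Proof.
move=> s0 ss' sr sr' rT rT' bxi bxi'; rewrite /overlap (max_r ss').
have s0' := le_trans s0 ss'.
have bxi2 := bounded_wrtS s0 ss' (le_trans sr' rT') bxi.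
have [rs'|s'r] := leP r s'.
  rewrite elem_disjoint// max_l ?mul0r ?mulr0// subr_le0.
  by rewrite ge_min rs'.
have -> : elem xi i s r = fun w => elem xi i s s' w + elem xi i s' r w.
  by apply/funext => w; rewrite /elem -mulrDr -levy_incrementD.
have s'r' := ltW s'r.
rewrite innerDl; [|apply: elem_L2 => //; exact: le_trans sr' rT'|exact: elem_L2|exact: elem_L2].
rewrite elem_disjoint// add0r elem_same_start// max_r ?mulrA// subr_ge0.
by rewrite le_min s'r' sr'.
Qed.

Lemma elementary_isometry xi xi' i j s r s' r' : 0 <= s -> 0 <= s' ->
  s <= r -> s' <= r' -> r <= T -> r' <= T -> bounded_wrt s xi -> bounded_wrt s' xi' ->
  inner P (fun w => xi w * dM i s r w) (fun w => xi' w * dM j s' r' w) =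
  K i j * inner time_space (strip s r (xi \o snd)) (strip s' r' (xi' \o snd)).
Proof.
move=> s0 s0' sr sr' rT rT' bxi bxi'.
rewrite inner_strip_snd; last 2 first.
- by apply: bounded_L2 bxi; rewrite s0 (le_trans sr).
- by apply: bounded_L2 bxi'; rewrite s0' (le_trans sr').
have [ss'|/ltW s's] := leP s s'; first exact: elem_inner_le.
rewrite innerC (@elem_inner_le xi' xi j i s' r' s r)// (innerC P xi').
by rewrite (levy_cov_sym M_levy j i T_gt0) /overlap (minC r') (maxC s').
Qed.

Section Steps.
Context (n : nat).
Implicit Types (S : step_process R Omega n).

Definition step_coord S a (p : R * Omega) : R := step_eval S p.1 p.2 a 0.

Let xi S (k : nat) a w : R := sp_val S k w a 0.

Lemma step_coordE S a : step_coord S a =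
  fun p => \sum_(k < sp_size S)
    strip (sp_time S k) (sp_time S k.+1) (xi S k a \o snd) p.
Proof.
apply/funext => p; rewrite /step_coord /step_eval summxE; apply: eq_bigr => k _.
by rewrite /strip /=; case: ifP => //; rewrite mxE.
Qed.

Lemma step_integralE S t a i : (fun w => step_integral M S t w a i) =
  fun w => \sum_(k < sp_size S) xi S k a w *
    dM i (Num.min (sp_time S k) t) (Num.min (sp_time S k.+1) t) w.
Proof.
apply/funext => w; rewrite /step_integral summxE; apply: eq_bigr => k _.
by rewrite mxE big_ord1 !mxE.
Qed.

Lemma ler_norm2 m l (A : 'M[R]_(m, l)) a b : `|A a b| <= norm2 A.
Proof.
rewrite /norm2 -sqrtr_sqr ler_wsqrtr// (bigD1 a)//= (bigD1 b)//= -addrA lerDl.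
by rewrite addr_ge0// sumr_ge0// => c _; rewrite ?sumr_ge0// => *; rewrite sqr_ge0.
Qed.

Lemma simple_times S : simple_predictable T Fl S -> forall k : 'I_(sp_size S),
  [/\ 0 <= sp_time S k, sp_time S k <= sp_time S k.+1 & sp_time S k.+1 <= T].
Proof.
move=> [tT inc _ _] k; split; last by have /andP[] := tT k.+1 (ltn_ord k).
  by have /andP[] := tT k (ltnW (ltn_ord k)).
exact: inc.
Qed.

Lemma simple_bounded S a : simple_predictable T Fl S -> forall k : 'I_(sp_size S),
  bounded_wrt (sp_time S k) (xi S k a).
Proof.
move=> [tT inc mS [c Sc]] k; split; first by move=> B mB; exact: mS.
by exists c => w; apply: le_trans (ler_norm2 _ _ _) (Sc k w _).
Qed.

Lemma step_coord_L2 S a : simple_predictable T Fl S ->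
  square_integrable time_space (step_coord S a).
Proof.
move=> sS; rewrite step_coordE; apply: square_integrable_sum => k.
apply: strip_snd_L2; have [t0 t1 t2] := simple_times sS k.
by apply: bounded_L2 (simple_bounded a sS k); rewrite t0 (le_trans t1).
Qed.

Lemma term_zero S (k : nat) t a i : t <= sp_time S k -> sp_time S k <= sp_time S k.+1 ->
  (fun w => xi S k a w *
    dM i (Num.min (sp_time S k) t) (Num.min (sp_time S k.+1) t) w) = fun=> 0.
Proof.
move=> tk kk; apply/funext => w.
by rewrite (min_r tk) (min_r (le_trans tk kk)) levy_incrementxx mulr0.
Qed.

Lemma term_L2 S (k : 'I_(sp_size S)) t a i : simple_predictable T Fl S -> 0 <= t <= T ->
  L2 (fun w => xi S k a w *
    dM i (Num.min (sp_time S k) t) (Num.min (sp_time S k.+1) t) w).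
Proof.
move=> sS /andP[t0 tT]; have [t1 t2 t3] := simple_times sS k.
have /orP[tk|kt] := le_total t (sp_time S k).
  by rewrite term_zero//; exact: square_integrable0.
rewrite ?(min_l kt); apply: elem_L2 => //.
- by rewrite le_min t2.
- by rewrite ge_min t3.
- exact: simple_bounded.
Qed.

Lemma step_integral_L2 S t a i : simple_predictable T Fl S -> 0 <= t <= T ->
  L2 (fun w => step_integral M S t w a i).
Proof.
by move=> sS tT; rewrite step_integralE; apply: square_integrable_sum => k;
  exact: term_L2.
Qed.

End Steps.

(** Bilinearity reduces this to two intervals, since stopping at t cuts each
    interval of the process at t. *)
Lemma step_isometry n n' (S : step_process R Omega n) (S' : step_process R Omega n')
    t t' a b i j :
  simple_predictable T Fl S -> simple_predictable T Fl S' ->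
  0 <= t <= T -> 0 <= t' <= T ->
  inner P (fun w => step_integral M S t w a i) (fun w => step_integral M S' t' w b j) =
  K i j * inner time_space (strip 0 t (step_coord S a)) (strip 0 t' (step_coord S' b)).
Proof.
move=> sS sS' tT tT'.
rewrite !step_integralE !step_coordE.
have sumE (h : R * Omega -> R) m (h_ : 'I_m -> R * Omega -> R) u :
    (strip 0 u (fun p => \sum_(k < m) h_ k p)) =
    fun p => \sum_(k < m) strip 0 u (h_ k) p.
  apply/funext => p; rewrite /strip; case: ifP => // _.
  by rewrite big1.
rewrite !sumE//.
have L1 := fun k => term_L2 k a i sS tT; have L2' := fun k => term_L2 k b j sS' tT'.
have S1 (k : 'I_(sp_size S)) : square_integrable time_space
    (strip 0 t (strip (sp_time S k) (sp_time S k.+1) ((fun w => sp_val S k w a 0) \o snd))).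
  apply/strip_L2/strip_snd_L2; have [t0 t1 t2] := simple_times sS k.
  by apply: bounded_L2 (simple_bounded a sS k); rewrite t0 (le_trans t1).
have S2 (k : 'I_(sp_size S')) : square_integrable time_space
    (strip 0 t' (strip (sp_time S' k) (sp_time S' k.+1) ((fun w => sp_val S' k w b 0) \o snd))).
  apply/strip_L2/strip_snd_L2; have [t0 t1 t2] := simple_times sS' k.
  by apply: bounded_L2 (simple_bounded b sS' k); rewrite t0 (le_trans t1).
rewrite inner_suml//; last exact: square_integrable_sum.
rewrite inner_suml//; last exact: square_integrable_sum.
rewrite mulr_sumr; apply: eq_bigr => k _.
rewrite inner_sumr// inner_sumr// mulr_sumr; apply: eq_bigr => l _.
change (inner P (fun w => sp_val S k w a 0 *
    dM i (Num.min (sp_time S k) t) (Num.min (sp_time S k.+1) t) w)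
  (fun w => sp_val S' l w b 0 *
    dM j (Num.min (sp_time S' l) t') (Num.min (sp_time S' l.+1) t') w) =
  K i j * inner time_space
    (strip 0 t (strip (sp_time S k) (sp_time S k.+1)
      ((fun w => sp_val S k w a 0) \o snd)))
    (strip 0 t' (strip (sp_time S' l) (sp_time S' l.+1)
      ((fun w => sp_val S' l w b 0) \o snd)))).
have [t0 t1 t2] := simple_times sS k; have [t0' t1' t2'] := simple_times sS' l.
have empty u v w h : u <= v -> strip 0 u (strip v w h) = (fun=> 0 : R) :> (R * Omega -> R).
  move=> uv; apply/funext => p; rewrite /strip.
  case: ifP => // /andP[_ pu]; case: ifP => // /andP[+ _].
  by rewrite ltNge (le_trans pu uv).
have cut u v w h : 0 <= v -> strip 0 u (strip v w h) = strip v (Num.min w u) h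
    :> (R * Omega -> R).
  by move=> v0; rewrite strip_strip max_r// minC.
have /orP[tk|kt] := le_total t (sp_time S k).
  by rewrite (term_zero _ _ tk t1) (empty _ _ _ _ tk) !inner0l mulr0.
have /orP[tl|lt] := le_total t' (sp_time S' l).
  by rewrite (term_zero _ _ tl t1') (empty _ _ _ _ tl) !inner0r mulr0.
rewrite !cut// (min_l kt) (min_l lt); apply: elementary_isometry => //.
- by rewrite le_min t1.
- by rewrite le_min t1'.
- by rewrite ge_min t2.
- by rewrite ge_min t2'.
- exact: simple_bounded.
- exact: simple_bounded.
Qed.

(** Between t and t' each term of the integral is an increment over a part (u, v]
    of (t, t'] multiplied by a value known at u. *)
Lemma step_orthogonal n (S : step_process R Omega n) t t' a i eta :
  simple_predictable T Fl S -> 0 <= t -> t <= t' -> t' <= T ->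
  L2 eta -> measurable_wrt (Fl t) eta ->
  inner P eta (fun w => step_integral M S t' w a i - step_integral M S t w a i) = 0.
Proof.
move=> sS t0 tt' tT' Leta meta.
have tT : 0 <= t <= T by rewrite t0 (le_trans tt').
have tT2 : 0 <= t' <= T by rewrite tT' (le_trans t0).
rewrite innerBr//; [|exact: step_integral_L2..].
rewrite !step_integralE !inner_sumr//; [|by move=> k; exact: term_L2..].
rewrite -sumrB big1// => k _.
have [k0 k1 k2] := simple_times sS k.
rewrite -innerBr//; [|exact: term_L2..].
set x := fun w => sp_val S k w a 0.
have /orP[tk|kt] := le_total t' (sp_time S k).
  rewrite (_ : (fun _ => _) = fun=> 0) ?inner0r//; apply/funext => w.
  have tk2 := le_trans tk k1.
  rewrite (min_r tk) (min_r tk2) (min_r (le_trans tt' tk)) (min_r (le_trans tt' tk2)).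
  by rewrite !levy_incrementxx !mulr0 subrr.
pose u := Num.max t (sp_time S k).
pose v := Num.max t (Num.min (sp_time S k.+1) t').
have uv : u <= v.
  by rewrite /u /v le_max2// le_min k1.
have u0 : 0 <= u by rewrite le_max t0.
have vT : v <= T by rewrite ge_max (andP tT).2 ge_min tT' orbT.
have uT : 0 <= u <= T by rewrite u0 (le_trans uv).
have bx := simple_bounded a sS k.
have bxu := bounded_wrtS k0 (_ : sp_time S k <= u) (andP uT).2 bx.
have {}bxu : bounded_wrt u x by apply: bxu; rewrite le_max lexx orbT.
rewrite (_ : inner P _ _ = inner P (fun w => x w * eta w) (dM i u v)).
  apply: (levy_orthogonal Fl_usual M_levy) => //.
  - exact: bounded_mul_L2 bxu Leta.
  - apply: measurable_wrtM; first exact: (flt_sigma_algebra Fl_usual uT).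
      by case: bxu.
    apply: (filtration_measurable_wrtS Fl_usual t0 _ (andP uT).2 meta).
    by rewrite le_max lexx.
apply: eq_Rintegral => w _; rewrite -mulrBr -/(x w) mulrCA mulrA; congr (_ * _).
rewrite (min_l kt) /u /v.
case/orP: (le_total (sp_time S k.+1) t) => k1t.
  have kt1 := le_trans k1 k1t.
  rewrite (min_l k1t) (min_l kt1) (max_l kt1) (min_l (le_trans k1t tt')) (max_l k1t).
  by rewrite subrr levy_incrementxx.
case/orP: (le_total t (sp_time S k)) => tk1.
  rewrite (min_r k1t) (min_r tk1) levy_incrementxx subr0 (max_r tk1) max_r//.
  by rewrite le_min k1t.
rewrite (min_r k1t) (min_l tk1) (max_l tk1) max_r; last first.
  by rewrite le_min k1t.
by rewrite /levy_increment; lra.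
Qed.

End StepIntegral.

(** * Mean-square limits of step integrals *)

Section LowerIntegral.
Import HBNNSimple.
Context d (X : measurableType d) (R : realType) (mu : {measure set X -> \bar R}).

(** Nonnegative integrals are suprema over simple functions, hence monotone
    even without measurability. *)
Lemma le_integral_nonmeasurable (D : set X) (f g : X -> \bar R) :
  (forall x, D x -> 0 <= f x)%E -> (forall x, D x -> f x <= g x)%E ->
  (\int[mu]_(x in D) f x <= \int[mu]_(x in D) g x)%E.
Proof.
move=> f0 fg; have g0 x : D x -> (0 <= g x)%E.
  by move=> Dx; exact: le_trans (f0 _ Dx) (fg _ Dx).
rewrite !ge0_integralE// ge_ereal_sup// => _ [h /= hf <-].
apply: le_ereal_sup_tmp; exists (sintegral mu h) => //.
exists h => // x; apply: le_trans (hf x) _.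
by rewrite !patchE; case: ifPn => // /set_mem; exact: fg.
Qed.

(** Here the measurable function is the smaller one: its integral does not see the
    exceptional null set. *)
Lemma le_integral_ae_measurable_l (f g : X -> \bar R) :
  measurable_fun setT f -> (forall x, 0 <= f x)%E -> (forall x, 0 <= g x)%E ->
  {ae mu, forall x, f x <= g x}%E ->
  (\int[mu]_x f x <= \int[mu]_x g x)%E.
Proof.
move=> mf f0 g0 [N [mN N0 fgN]].
rewrite (ge0_negligible_integral mN)//.
rewrite integral_mkcond; apply: le_integral_nonmeasurable => x _.
  by rewrite patchE; case: ifP.
rewrite patchE; case: ifPn => // /set_mem [_ xN].
by apply: contrapT => H; apply: xN; apply: fgN => /=.
Qed.

(** Here the measurable function is the larger one: it may be set to +oo on the
    exceptional null set. *)
Lemma le_integral_ae_measurable_r (f g : X -> \bar R) :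
  measurable_fun setT g -> (forall x, 0 <= f x)%E -> (forall x, 0 <= g x)%E ->
  {ae mu, forall x, f x <= g x}%E ->
  (\int[mu]_x f x <= \int[mu]_x g x)%E.
Proof.
move=> mg f0 g0 [N [mN N0 fgN]].
pose g' x := (if x \in N then +oo else g x)%E.
apply: (@le_trans _ _ (\int[mu]_x g' x)%E).
  apply: le_integral_nonmeasurable => // x _; rewrite /g'; case: ifPn => [_|].
    by rewrite leey.
  by rewrite notin_setE => xN; apply: contrapT => H; apply: xN; exact: fgN.
rewrite (@ae_eq_integral _ _ _ mu setT g g')//.
- apply: measurable_fun_ifT => //; apply: (measurable_fun_bool true).
  rewrite setTI (_ : _ @^-1` _ = N)//; apply/seteqP; split => x /=.
    by move/set_mem.
  by move/mem_set.
- exists N; split => // x /= H; apply: contrapT => xN; apply: H => _.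
  by rewrite /g' memNset.
Qed.

End LowerIntegral.

Section ItoLimit.
Context (R : realType) d (Omega : measurableType d) (P : probability Omega R).
Context (T : R) (T_gt0 : 0 < T) (Fl : R -> set (set Omega)).
Hypothesis Fl_usual : usual_filtration P T Fl.
Context (q : nat) (K : 'M[R]_q) (M : R -> Omega -> 'cV[R]_q).
Hypothesis M_levy : levy_process P T Fl K M.
Local Notation L2 := (square_integrable P).
Local Notation time_space := ((@lebesgue_measure R \x P)%E).

Lemma strip_cvg (u : nat -> R * Omega -> R) f a b :
  (forall k, square_integrable time_space (u k)) -> square_integrable time_space f ->
  l2norm time_space (fun p => u k p - f p) @[k --> \oo] --> 0 ->
  l2norm time_space (fun p => strip a b (u k) p - strip a b f p) @[k --> \oo] --> 0.
Proof.
move=> Lu Lf uf; apply: squeeze_cvgr (cvg_cst 0) uf.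
apply: nearW => k; rewrite l2norm_ge0/= ler_wsqrtr//.
have LB := square_integrableB (Lu k) Lf.
rewrite (_ : (fun p => _) = strip a b (fun p => u k p - f p)); last first.
  by apply/funext => p; rewrite /strip; case: ifP; rewrite ?subrr.
apply: ler_inner_sqr => //; first exact: strip_L2.
by move=> p; rewrite /strip; case: ifP => // _; rewrite normr0.
Qed.

(** The approximation that defines the Ito integral, restated for a jointly
    measurable integrand and with L2 norms on the product space, where limits of
    inner products can be taken. *)
Definition ito_limit n (h : 'I_n -> R * Omega -> R) (J : R -> Omega -> 'M[R]_(n, q)) :=
  [/\ forall a, square_integrable time_space (h a),
      forall t a i, 0 <= t <= T -> L2 (fun w => J t w a i) &
      exists S : nat -> step_process R Omega n,
        [/\ forall k, simple_predictable T Fl (S k),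
            forall a, l2norm time_space (fun p => step_coord (S k) a p - h a p)
              @[k --> \oo] --> 0 &
            forall t a i, 0 <= t <= T ->
              l2norm P (fun w => step_integral M (S k) t w a i - J t w a i)
                @[k --> \oo] --> 0]].

Lemma ito_isometry n n' (h : 'I_n -> R * Omega -> R) J
    (h' : 'I_n' -> R * Omega -> R) J' t t' a b i j :
  ito_limit h J -> ito_limit h' J' -> 0 <= t <= T -> 0 <= t' <= T ->
  inner P (fun w => J t w a i) (fun w => J' t' w b j) =
  K i j * inner time_space (strip 0 t (h a)) (strip 0 t' (h' b)).
Proof.
move=> [Lh LJ [S [sS Sh SJ]]] [Lh' LJ' [S' [sS' Sh' SJ']]] tT tT'.
have Lc := fun k => step_coord_L2 Fl_usual a (sS k).
have Lc' := fun k => step_coord_L2 Fl_usual b (sS' k).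
have c1 := inner_cvg (fun k => step_integral_L2 Fl_usual M_levy a i (sS k) tT)
  (fun k => step_integral_L2 Fl_usual M_levy b j (sS' k) tT')
  (LJ _ a i tT) (LJ' _ b j tT') (SJ _ a i tT) (SJ' _ b j tT').
have c2 := inner_cvg (fun k => strip_L2 0 t (Lc k)) (fun k => strip_L2 0 t' (Lc' k))
  (strip_L2 0 t (Lh a)) (strip_L2 0 t' (Lh' b))
  (strip_cvg 0 t Lc (Lh a) (Sh a)) (strip_cvg 0 t' Lc' (Lh' b) (Sh' b)).
rewrite -(cvg_lim (@Rhausdorff R) c1); apply: cvg_lim => //.
rewrite (_ : (fun k => _) = fun k => K i j *
    inner time_space (strip 0 t (step_coord (S k) a)) (strip 0 t' (step_coord (S' k) b))).
  by apply: cvgM => //; exact: cvg_cst.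
by apply/funext => k; exact: (step_isometry T_gt0 Fl_usual M_levy).
Qed.

Lemma ito_orthogonal n (h : 'I_n -> R * Omega -> R) J t t' a i eta :
  ito_limit h J -> 0 <= t -> t <= t' -> t' <= T ->
  L2 eta -> measurable_wrt (Fl t) eta ->
  inner P eta (fun w => J t' w a i - J t w a i) = 0.
Proof.
move=> [Lh LJ [S [sS Sh SJ]]] t0 tt' tT' Leta meta.
have tT : 0 <= t <= T by rewrite t0 (le_trans tt').
have tT2 : 0 <= t' <= T by rewrite tT' (le_trans t0).
have LS u : 0 <= u <= T -> forall k, L2 (fun w => step_integral M (S k) u w a i).
  by move=> uT k; exact: (step_integral_L2 Fl_usual M_levy).
have e0 : l2norm P (fun w => eta w - eta w) @[_ --> \oo] --> (0 : R).
  under eq_fun do under [X in l2norm _ X]eq_fun do rewrite subrr.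
  by rewrite l2norm0; exact: cvg_cst.
have c t1 (t1T : 0 <= t1 <= T) := @inner_cvg _ _ _ P (fun=> eta) _ eta _ (fun=> Leta) (LS _ t1T) Leta
  (LJ _ a i t1T) e0 (SJ _ a i t1T).
have cB : (inner P eta (fun w => step_integral M (S k) t' w a i) -
    inner P eta (fun w => step_integral M (S k) t w a i)) @[k --> \oo] -->
    inner P eta (fun w => J t' w a i) - inner P eta (fun w => J t w a i).
  by apply: cvgB; exact: c.
rewrite innerBr//; [|exact: LJ..].
rewrite -(cvg_lim (@Rhausdorff R) cB); apply: cvg_lim => //.
rewrite (_ : (fun k => _) = fun=> 0); first exact: cvg_cst.
apply/funext => k /=; rewrite -innerBr//; [|exact: LS..].
exact: (step_orthogonal Fl_usual M_levy).
Qed.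

Lemma l2norm_cvg_le d' (X : measurableType d') (mu : {measure set X -> \bar R})
    (u : nat -> X -> R) (F : nat -> \bar R) :
  (forall k, measurable_fun setT (u k)) ->
  (forall k, (\int[mu]_x (u k x ^+ 2)%:E <= F k)%E) -> F @ \oo --> 0%E ->
  l2norm mu (u k) @[k --> \oo] --> 0.
Proof.
move=> mu_ uF F0.
apply/cvgrPdist_lt => /= e e0.
have : \forall k \near \oo, (F k < (e ^+ 2)%:E)%E.
  by apply: (F0 [set y | (y < _)%E]); apply: open_ereal_lt'; rewrite lte_fin exprn_gt0.
apply: filterS => k Fk; rewrite sub0r normrN ger0_norm ?l2norm_ge0//.
have Lu : square_integrable mu (u k).
  by split => //; apply: le_lt_trans (uF k) (lt_trans Fk (ltry _)).
rewrite -ltr_sqr ?nnegrE ?l2norm_ge0 ?ltW// l2norm_sqr -lte_fin EFin_inner_sqr//.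
exact: le_lt_trans Fk.
Qed.

Lemma norm2_sqr_ge m l (A : 'M[R]_(m, l)) a b : A a b ^+ 2 <= norm2 A ^+ 2.
Proof.
by rewrite -[leLHS]real_normK ?num_real// ler_sqr ?nnegrE ?sqrtr_ge0// ler_norm2.
Qed.

(** Passage from the defining approximation of the Ito integral, which speaks
    of an iterated integral of a possibly non-measurable integrand, to a
    jointly measurable version [h] of that integrand. *)
Lemma ito_limit_of_ito n (H : R -> Omega -> 'cV[R]_n) J (h : 'I_n -> R * Omega -> R) :
  is_ito_integral_L2 P T Fl M H J ->
  (forall a, measurable_fun setT (h a)) ->
  (forall a p, ~~ (0 < p.1 <= T) -> h a p = 0) ->
  {ae P, forall w, forall s, 0 < s <= T -> forall a, H s w a 0 = h a (s, w)} ->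
  ito_limit h J.
Proof.
move=> [aJ [S [sS SH SJ]]] mh h0 Hh.
have mJ t a i : 0 <= t <= T -> measurable_fun setT (fun w => J t w a i).
  by move=> tT; apply: (filtration_measurable_fun Fl_usual tT); exact: aJ.
have LS k a : square_integrable time_space (step_coord (S k) a).
  exact: (step_coord_L2 Fl_usual).
have mS k a := square_integrable_measurable (LS k a).
have mB k a : measurable_fun setT (fun p => step_coord (S k) a p - h a p).
  exact: (measurable_funB (mS k a) (mh a)).
have bound k a : (\int[time_space]_p ((step_coord (S k) a p - h a p) ^+ 2)%:E <=
    \int[P]_w \int[lebesgue_measure]_(s in `[0%R, T])
            ((norm2 (H s w - step_eval (S k) s w) ^+ 2)%:E))%E.
  have mB2 : measurable_fun setT (fun p => ((step_coord (S k) a p - h a p) ^+ 2)%:E).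
    by apply/measurable_EFinP/measurable_funX.
  rewrite fubini_tonelli2//; last by move=> p; rewrite lee_fin sqr_ge0.
  apply: le_integral_ae_measurable_l.
  - apply: measurable_fun_fubini_tonelli_G => // p; by rewrite lee_fin sqr_ge0.
  - by move=> w; apply: integral_ge0 => s _; rewrite lee_fin sqr_ge0.
  - by move=> w; apply: integral_ge0 => s _; rewrite lee_fin sqr_ge0.
  apply: filterS Hh => w Hw; rewrite /fubini_G.
  rewrite [leRHS]integral_mkcond; apply: le_integral_nonmeasurable => s _.
    by rewrite lee_fin sqr_ge0.
  have [sT|sT] := boolP (0 < s <= T).
    rewrite patchE mem_set; last first.
      by rewrite /= in_itv/=; case/andP: sT => /ltW -> ->.
    rewrite lee_fin -Hw// -[leLHS]sqrrN opprB.
    by apply: le_trans _ (norm2_sqr_ge _ a 0); rewrite !mxE.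
  rewrite [step_coord _ _ _](_ : _ = 0) ?h0//.
    rewrite subr0 expr0n/= patchE; case: ifP => // _.
    by rewrite lee_fin sqr_ge0.
  rewrite step_coordE big1// => l _; rewrite /strip/=; case: ifPn => // sl.
  have [t0 t1 t2] := simple_times (sS k) l.
  case/andP: sl => /(le_lt_trans t0) s0 /le_trans/(_ t2) s1.
  by rewrite s0 s1 in sT.
have cvg1 a : l2norm time_space (fun p => step_coord (S k) a p - h a p)
    @[k --> \oo] --> 0.
  apply: (l2norm_cvg_le _ _ SH) => k; [exact: mB|exact: bound].
have boundJ k t a i : 0 <= t <= T ->
    (\int[P]_w ((step_integral M (S k) t w a i - J t w a i) ^+ 2)%:E <=
     \int[P]_w ((norm2 (J t w - step_integral M (S k) t w) ^+ 2)%:E))%E.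
  move=> tT; apply: le_integral_nonmeasurable => w _; first by rewrite lee_fin sqr_ge0.
  rewrite lee_fin -[leLHS]sqrrN opprB.
  by apply: le_trans _ (norm2_sqr_ge _ a i); rewrite !mxE.
have LSJ k t a i : 0 <= t <= T -> L2 (fun w => step_integral M (S k) t w a i).
  exact: (step_integral_L2 Fl_usual M_levy).
(* The approximants are square integrable and at a finite distance of [f]. *)
have fin d' (X : measurableType d') (mu : {measure set X -> \bar R})
    (u : nat -> X -> R) (f : X -> R) (F : nat -> \bar R) : measurable_fun setT f ->
    (forall k, square_integrable mu (u k)) ->
    (forall k, (\int[mu]_x ((u k x - f x) ^+ 2)%:E <= F k)%E) -> F @ \oo --> 0%E ->
    square_integrable mu f.
  move=> mf Lu uF F0.
  have : \forall k \near \oo, (F k < 1%:E)%E.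
    by apply: (F0 [set y | (y < _)%E]); apply: open_ereal_lt'; rewrite lte_fin.
  move=> [k _ /(_ k (leqnn k)) Fk].
  have LB : square_integrable mu (fun x => u k x - f x).
    split; first by apply: measurable_funB => //; case: (Lu k).
    exact: le_lt_trans (uF k) (lt_trans Fk (ltry _)).
  have := square_integrableB (Lu k) LB.
  by under eq_fun do rewrite opprB addrC subrK.
split.
- by move=> a; apply: (fin _ _ time_space (fun k => step_coord (S k) a) (h a) _ (mh a) _ _ SH) => k; [exact: LS|exact: bound].
- move=> t a i tT.
  by apply: (fin _ _ P (fun k w => step_integral M (S k) t w a i) _ _ (mJ t a i tT) _ _ (SJ t tT)) => k; [exact: LSJ|exact: boundJ].
exists S; split => // t a i tT.
apply: (l2norm_cvg_le _ _ (SJ t tT)) => k; last exact: boundJ.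
apply: measurable_funB; last exact: mJ.
by case: (LSJ k t a i tT).
Qed.

End ItoLimit.

(** * Paths with left limits *)

Section Jumps.
Context (R : realType).

Lemma countable_subsingleton (X : Type) (A : set X) :
  (forall x y, A x -> A y -> x = y) -> countable A.
Proof.
move=> A1; have [[x Ax]|nA] := pselect (exists x, A x).
  apply: (@sub_countable _ _ _ [set x]); last exact: countable1.
  by apply: subset_card_le => y Ay; exact: A1.
by rewrite (_ : A = set0)// -subset0 => x Ax; apply: nA; exists x.
Qed.

(** An upward jump at [t] is witnessed by a rational level p and a rational time
    r < t such that [f] stays below p on (r, t) and exceeds it at [t]; such a
    pair determines [t]. *)
Lemma countable_jumps_up (f l : R -> R) (D : set R) :
  (forall t, D t -> f s @[s --> t^'-] --> l t) ->
  countable [set t | D t /\ l t < f t].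
Proof.
move=> fl.
pose F (z : rat * rat) := [set t : R | [/\ ratr z.1 < t, ratr z.2 < f t &
   forall s, ratr z.1 < s -> s < t -> f s < ratr z.2]].
have cF : countable (\bigcup_(z in [set: rat * rat]) F z).
  apply: bigcup_countable => // z _.
  apply: countable_subsingleton => t u [zt ft H] [zu fu Hu].
  case: (ltgtP t u) => // [tu|ut].
    by have := Hu _ zt tu; rewrite ltNge (ltW ft).
  by have := H _ zu ut; rewrite ltNge (ltW fu).
apply: sub_countable cF; apply: subset_card_le => t [Dt lft].
have [p /= pin] := rat_in_itvoo lft.
have : \forall s \near t^'-, f s < ratr p.
  by apply: (cvgr_lt (l t)); [exact: fl|move: pin; rewrite in_itv/= => /andP[]].
rewrite near_withinE => -[e /= e0 He].
have [|r /=] := @rat_in_itvoo _ (t - e) t; first by rewrite ltrBlDr ltrDl.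
rewrite in_itv/= => /andP[r1 r2].
exists (r, p) => //; split => //=; first by move: pin; rewrite in_itv/= => /andP[].
move=> s rs st; apply: He => //=.
by rewrite ger0_norm ?subr_ge0 ?ltW//; lra.
Qed.

Lemma countable_jumps (f l : R -> R) (D : set R) :
  (forall t, D t -> f s @[s --> t^'-] --> l t) ->
  countable [set t | D t /\ f t <> l t].
Proof.
move=> fl.
apply: (@sub_countable _ _ _ (\bigcup_(b in [set: bool])
   if b then [set t | D t /\ l t < f t] else [set t | D t /\ - l t < - f t])).
  apply: subset_card_le => t [Dt /eqP]; rewrite neq_lt => /orP[h|h].
    by exists false => //; split; rewrite ?ltrN2.
  by exists true.
apply: bigcup_countable => // -[] _; first exact: countable_jumps_up.
by apply: (@countable_jumps_up (- f) (- l)) => t Dt; apply: cvgN; exact: fl.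
Qed.

Lemma measurable_fun_countable (f g : R -> R) (D : set R) : measurable D ->
  measurable_fun setT g -> countable [set s | D s /\ f s <> g s] ->
  measurable_fun D f.
Proof.
move=> mD mg cC _ B mB.
set C := [set s | _] in cC.
have m1 (A : set R) : countable A -> measurable A.
  by apply: countable_measurable => t; exact: measurable_set1.
rewrite (_ : D `&` f @^-1` B = (D `&` g @^-1` B `\` C) `|` (C `&` f @^-1` B)).
  apply: measurableU.
    apply: measurableD; last exact: m1.
    by apply: measurableI => //; rewrite -[X in measurable X]setTI; exact: mg.
  by apply: m1; apply: sub_countable cC; apply: subset_card_le => s [].
apply/seteqP; split => [s [Ds Bs]|s [[[Ds Bs] nC]|[[Ds _] Bs]]].
- have [fg|fg] := pselect (f s = g s); last by right.
  by left; split; [split => //=; rewrite -fg|case].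
- by split => //=; rewrite (_ : f s = g s)//; apply: contrapT => fg; apply: nC.
- by [].
Qed.

(** Integrals along a path do not distinguish the path, which need not be
    measurable beforehand, from its left limits. *)
Lemma integral_countable (f g : R -> R) (D : set R) : measurable D ->
  measurable_fun setT g -> countable [set s | D s /\ f s <> g s] ->
  (\int[lebesgue_measure]_(s in D) (f s)%:E =
   \int[lebesgue_measure]_(s in D) (g s)%:E)%E.
Proof.
move=> mD mg cC; apply: ae_eq_integral => //.
- by apply/measurable_EFinP; exact: (measurable_fun_countable mD mg cC).
- by apply/measurable_EFinP; exact: measurable_funTS.
exists [set s | D s /\ f s <> g s]; split.
- by apply: countable_measurable cC => t; exact: measurable_set1.
- exact: countable_lebesgue_measure0.
- move=> s /= /not_implyP [Ds fg]; split => // e; apply: fg; by rewrite e.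
Qed.

End Jumps.

Section LeftLimits.
Context (R : realType) d (Omega : measurableType d).
Context (T : R) (T_gt0 : 0 < T).

Lemma grid_le (m i : nat) : (i <= m.+1)%N -> i%:R * (T / m.+1%:R) <= T.
Proof.
move=> im; rewrite mulrA ler_pdivrMr ?ltr0n// mulrC ler_pM2l//.
by rewrite ler_nat.
Qed.

Lemma grid_cell (m : nat) (s : R) : 0 < s <= T -> exists i : 'I_m.+1,
  i%:R * (T / m.+1%:R) < s <= i.+1%:R * (T / m.+1%:R).
Proof.
move=> /andP[s0 sT]; set dl := T / m.+1%:R.
have dl0 : 0 < dl by rewrite divr_gt0.
have ex : exists i, s <= i.+1%:R * dl.
  by exists m; rewrite /dl mulrCA divff ?mulr1// pnatr_eq0.
pose i := ex_minn ex.
have im : (i < m.+1)%N.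
  rewrite /i; case: ex_minnP => j _ /(_ m); rewrite ltnS; apply.
  by rewrite /dl mulrCA divff ?mulr1// pnatr_eq0.
exists (Ordinal im) => /=; rewrite /i; case: ex_minnP => j sj jmin.
rewrite sj andbT; case: j sj jmin => [|j] sj jmin; first by rewrite mul0r.
by rewrite ltNge; apply/negP => /jmin; rewrite ltnn.
Qed.

Context (f : R -> Omega -> R).

Let grid m (p : R * Omega) : R := \sum_(i < m.+1)
  strip (i%:R * (T / m.+1%:R)) (i.+1%:R * (T / m.+1%:R))
    ((f (i%:R * (T / m.+1%:R))) \o snd) p.

Let gridE m s w : 0 < s <= T -> exists r, [/\ 0 <= r, r < s,
  s - r <= T / m.+1%:R & grid m (s, w) = f r w].
Proof.
move=> sT; have [i /andP[i1 i2]] := grid_cell m sT; set dl := T / m.+1%:R in i1 i2 *.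
have dl0 : 0 < dl by rewrite divr_gt0.
exists (i%:R * dl); split => //.
- by rewrite mulr_ge0// ltW.
- by rewrite lerBlDl -[X in _ + X]mul1r -mulrDl natr1.
rewrite /grid (bigD1 i)//= big1 ?addr0; first by rewrite /strip/= -/dl i1 i2.
move=> j ji; rewrite /strip/= -/dl; case: ifPn => // /andP[j1 j2].
move: ji; rewrite neq_ltn => /orP[ji|ij].
  have : j.+1%:R * dl <= i%:R * dl by rewrite ler_pM2r// ler_nat.
  by move=> /(le_trans j2)/le_lt_trans/(_ i1); rewrite ltxx.
have : i.+1%:R * dl <= j%:R * dl by rewrite ler_pM2r// ler_nat.
by move=> /(le_trans i2)/le_lt_trans/(_ j1); rewrite ltxx.
Qed.

Let gridN m s w : ~~ (0 < s <= T) -> grid m (s, w) = 0.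
Proof.
move=> sT; apply: big1 => i _; rewrite /strip/=; case: ifPn => // /andP[s1 s2].
have dl0 : 0 < T / m.+1%:R by rewrite divr_gt0.
move: sT; rewrite (le_lt_trans _ s1)/=; last by rewrite mulr_ge0// ltW.
by rewrite (le_trans s2)// grid_le.
Qed.

(** Left limits are limits of the values at the last point of finer and finer
    grids, whence their joint measurability. *)
Lemma measurable_left_limits (N : set Omega) (h : R * Omega -> R) :
  (forall t, 0 <= t <= T -> measurable_fun setT (f t)) ->
  measurable N ->
  (forall s w, 0 < s <= T -> ~ N w -> f r w @[r --> s^'-] --> h (s, w)) ->
  (forall s w, ~~ (0 < s <= T) \/ N w -> h (s, w) = 0) ->
  measurable_fun setT h.
Proof.
move=> mf mN fh h0.
apply: (measurable_fun_cvg (h := fun m p => \1_(~` N) p.2 * grid m p)).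
- move=> m; apply: measurable_funM.
    apply: measurableT_comp; last exact: measurable_snd.
    by apply: measurable_indic; exact: measurableC.
  apply: measurable_sum => i; apply: measurable_strip.
  apply: measurableT_comp => //; apply: mf; apply/andP; split.
    by rewrite mulr_ge0// divr_ge0// ltW.
  by rewrite grid_le// ltnW.
move=> [s w] _ /=.
have [Nw|Nw] := pselect (N w).
  rewrite (h0 s w (or_intror Nw)).
  rewrite (_ : (fun _ => _) = fun=> 0); first exact: cvg_cst.
  by apply/funext => m; rewrite indicE memNset ?mul0r// => /(_ Nw).
have [sT|sT] := boolP (0 < s <= T); last first.
  rewrite (h0 s w (or_introl sT)).
  rewrite (_ : (fun _ => _) = fun=> 0); first exact: cvg_cst.
  by apply/funext => m; rewrite gridN// mulr0.
rewrite (_ : (fun _ => _) = fun m => grid m (s, w)); last first.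
  by apply/funext => m; rewrite indicE mem_set ?mul1r.
have [r rP] := choice (fun m => @gridE m s w sT).
rewrite (_ : (fun _ => _) = fun m => f (r m) w); last first.
  by apply/funext => m; case: (rP m).
have /cvg_at_leftP := fh s w sT Nw; apply; split; first by move=> m; case: (rP m).
apply/cvgrPdist_le => /= e e0.
have c : T / m.+1%:R @[m --> \oo] --> 0.
  by rewrite -[0](mulr0 T); apply: cvgM; [exact: cvg_cst|exact: cvg_harmonic].
move/cvgrPdist_le : c => /(_ e e0); apply: filterS => m.
rewrite sub0r normrN ger0_norm ?divr_ge0 ?(ltW T_gt0)// => Tm.
have [r0 rs sr _] := rP m.
by rewrite ger0_norm ?subr_ge0 ?(ltW rs)// (le_trans sr).
Qed.

End LeftLimits.

(** * Time integrals of random functions *)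

Section TimeIntegral.
Context (R : realType) d (Omega : measurableType d) (P : probability Omega R).
Local Notation L2 := (square_integrable P).
Local Notation time_space := ((@lebesgue_measure R \x P)%E).
Implicit Types (h : R * Omega -> R).

Definition time_integral h a b w : R :=
  \int[lebesgue_measure]_s strip a b h (s, w).

Let integral_indic_oc (a b : R) :
  (\int[lebesgue_measure]_s (\1_(`]a, b]%classic) s)%:E = (Num.max 0 (b - a))%:E)%E.
Proof. by rewrite integral_indic// setIT; exact: lebesgue_measure_itv_oc. Qed.

Let cst1 : L2 (fun=> 1).
Proof. exact: (cst_L2 P 1). Qed.

Lemma integrable_strip h a b : square_integrable time_space h ->
  time_space.-integrable setT (EFin \o strip a b h).
Proof.
move=> Lh.
have := integrable_mul (strip_L2 a b Lh) (strip_snd_L2 a b cst1).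
rewrite (_ : (fun x => _) = strip a b h)//; apply/funext => p.
by rewrite /strip; case: ifP; rewrite /= ?mulr1 ?mulr0.
Qed.

Lemma strip_section_L2_ae h a b : square_integrable time_space h ->
  {ae P, forall w, square_integrable lebesgue_measure (fun s => strip a b h (s, w))}.
Proof.
move=> Lh; have Ls := strip_L2 a b Lh.
have := ae_integrable2 (integrable_square Ls).
apply: filterS => w /= iw; split.
  by apply: measurableT_comp; [case: Ls|exact: pair2_measurable].
exact: (integrable_lty measurableT iw).
Qed.

Lemma strip_section_integrable h a b w :
  square_integrable lebesgue_measure (fun s => strip a b h (s, w)) ->
  lebesgue_measure.-integrable setT (fun s => (strip a b h (s, w))%:E).
Proof.
move=> Lw.
have L1 : square_integrable lebesgue_measure (\1_(`]a, b]%classic) : R -> R).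
  split; first exact: measurable_indic.
  under eq_integral do rewrite indicE expr2 -natrM mulnb andbb -indicE.
  by rewrite integral_indic_oc ltry.
have := integrable_mul Lw L1.
rewrite (_ : (fun x => _) = fun s => strip a b h (s, w))//; apply/funext => s.
rewrite /strip indicE /=; case: ifPn => ab; last by rewrite mul0r.
by rewrite mem_set ?mulr1//= in_itv.
Qed.

Lemma measurable_time_integral h a b : square_integrable time_space h ->
  measurable_fun setT (time_integral h a b).
Proof.
move=> Lh; apply: measurableT_comp; first exact: fine_measurable.
exact: (measurable_fubini_G (integrable_strip a b Lh)).
Qed.

(** Cauchy-Schwarz against the indicator of (a, b]. *)
Lemma time_integral_sqr_le h a b w : a <= b ->
  square_integrable lebesgue_measure (fun s => strip a b h (s, w)) ->
  (((time_integral h a b w) ^+ 2)%:E <=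
    (b - a)%:E * \int[lebesgue_measure]_s ((strip a b h (s, w)) ^+ 2)%:E)%E.
Proof.
move=> ab Lw.
have L1 : square_integrable lebesgue_measure (\1_(`]a, b]%classic) : R -> R).
  split; first exact: measurable_indic.
  under eq_integral do rewrite indicE expr2 -natrM mulnb andbb -indicE.
  by rewrite integral_indic_oc ltry.
have -> : time_integral h a b w =
    inner lebesgue_measure (fun s => strip a b h (s, w)) (\1_(`]a, b]%classic)).
  apply: eq_Rintegral => s _.
  rewrite /strip indicE /=; case: ifPn => s1; last by rewrite mul0r.
  by rewrite mem_set ?mulr1//= in_itv.
have i1 : inner lebesgue_measure (\1_(`]a, b]%classic) : R -> R) (\1_(`]a, b]%classic)) = b - a.
  apply: EFin_inj; rewrite EFin_inner//.
  under eq_integral do rewrite indicE -natrM mulnb andbb -indicE.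
  by rewrite integral_indic_oc max_r// subr_ge0.
rewrite -EFin_inner_sqr// -EFinM lee_fin.
have H := cauchy_schwarz Lw L1.
rewrite -[leLHS]real_normK ?num_real//.
apply: (le_trans (lerXn2r 2 _ _ H)); rewrite ?nnegrE ?mulr_ge0 ?l2norm_ge0//.
by rewrite exprMn !l2norm_sqr i1 mulrC.
Qed.

Lemma integral_strip_sqr h a b : square_integrable time_space h ->
  (\int[P]_w \int[lebesgue_measure]_s ((strip a b h (s, w)) ^+ 2)%:E =
   (inner time_space (strip a b h) (strip a b h))%:E)%E.
Proof.
move=> Lh; rewrite EFin_inner_sqr; last exact: strip_L2.
rewrite fubini_tonelli2//.
- exact: (measurable_square (strip_L2 a b Lh)).
- by move=> p; rewrite lee_fin sqr_ge0.
Qed.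

Lemma time_integral_L2 h a b : a <= b -> square_integrable time_space h ->
  L2 (time_integral h a b) /\
  inner P (time_integral h a b) (time_integral h a b) <=
    (b - a) * inner time_space (strip a b h) (strip a b h).
Proof.
move=> ab Lh; have mt := measurable_time_integral a b Lh.
have H : (\int[P]_w ((time_integral h a b w) ^+ 2)%:E <=
    ((b - a) * inner time_space (strip a b h) (strip a b h))%:E)%E.
  have mG : measurable_fun setT
      (fun w => \int[lebesgue_measure]_s ((strip a b h (s, w)) ^+ 2)%:E)%E.
    have f0 (p : R * Omega) : (0 <= ((strip a b h p) ^+ 2)%:E)%E.
      by rewrite lee_fin sqr_ge0.
    have m2 := measurable_square (strip_L2 a b Lh).
    by have := measurable_fun_fubini_tonelli_G (m1 := lebesgue_measure) _ m2 f0.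
  rewrite EFinM -integral_strip_sqr// -ge0_integralZl//; last 2 first.
  - by move=> w _; apply: integral_ge0 => s _; rewrite lee_fin sqr_ge0.
  - by rewrite lee_fin subr_ge0.
  apply: ae_ge0_le_integral => //.
  - by move=> w _; rewrite lee_fin sqr_ge0.
  - by apply/measurable_EFinP/measurable_funX.
  - move=> w _; apply: mule_ge0; first by rewrite lee_fin subr_ge0.
    by apply: integral_ge0 => s _; rewrite lee_fin sqr_ge0.
  - exact: measurable_funeM.
  - apply: filterS (strip_section_L2_ae a b Lh) => w Lw _.
    exact: time_integral_sqr_le.
have Lt : L2 (time_integral h a b) by split => //; exact: le_lt_trans H (ltry _).
by split => //; rewrite -lee_fin EFin_inner_sqr.
Qed.

Lemma time_integral_inner h a b xi : a <= b -> square_integrable time_space h ->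
  L2 xi ->
  inner P (time_integral h a b) xi =
  inner time_space (strip a b h) (strip a b (xi \o snd)).
Proof.
move=> ab Lh Lxi; have [Lt _] := time_integral_L2 ab Lh.
have Ls := strip_L2 a b Lh; have Lx := strip_snd_L2 a b Lxi.
apply: EFin_inj; rewrite !EFin_inner//.
have ip := integrable_mul Ls Lx.
rewrite -(integral21_prod_meas1 ip).
apply: ae_eq_integral => //.
- by apply/measurable_EFinP/measurable_funM; [case: Lt|case: Lxi].
- exact: measurable_fubini_G ip.
apply: filterS (strip_section_L2_ae a b Lh) => w Lw _.
have iw := strip_section_integrable Lw.
have fin : (\int[lebesgue_measure]_s (strip a b h (s, w))%:E \is a fin_num)%E.
  exact: (integrable_fin_num measurableT iw).
rewrite EFinM /time_integral /Rintegral fineK// -integralZr//.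
apply: eq_integral => s _; rewrite /strip /=; case: ifP => // _.
by rewrite !mul0r mul0e.
Qed.

Lemma time_integralD h a b c w : a <= b -> b <= c ->
  square_integrable lebesgue_measure (fun s => strip a c h (s, w)) ->
  time_integral h a c w = time_integral h a b w + time_integral h b c w.
Proof.
move=> ab bc Lw; have iw := strip_section_integrable Lw.
have sub u v : a <= u -> v <= c ->
    lebesgue_measure.-integrable setT (fun s => (strip u v h (s, w))%:E).
  move=> au vc; apply: strip_section_integrable.
  have -> : (fun s => strip u v h (s, w)) = fun s => \1_(`]u, v]%classic) s * strip a c h (s, w).
    apply/funext => s; rewrite /strip indicE /=; case: ifPn => uv.
      rewrite mem_set/= ?in_itv// mul1r; case/andP: uv => us sv.
      by rewrite (le_lt_trans au us) (le_trans sv vc).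
    by rewrite memNset/= ?in_itv/= ?(negbTE uv)// mul0r.
  apply: (le_square_integrable _ Lw).
    by apply: measurable_funM; [exact: measurable_indic|case: Lw].
  move=> s; rewrite normrM indicE; case: (_ \in _); first by rewrite normr1 mul1r.
  by rewrite normr0 mul0r.
rewrite /time_integral -RintegralD//; [|exact: sub..].
apply: eq_Rintegral => s _; rewrite /strip /=.
case: (ltP a s) => as_; case: (leP s c) => sc; case: (leP s b) => sb;
  case: (ltP b s) => bs /=; rewrite ?addr0 ?add0r//; exfalso; lra.
Qed.

Lemma strip_sqr_le h a b B : a <= b -> square_integrable time_space h ->
  (forall s, a < s <= b -> (\int[P]_w ((h (s, w)) ^+ 2)%:E <= B%:E)%E) ->
  inner time_space (strip a b h) (strip a b h) <= (b - a) * B.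
Proof.
move=> ab Lh hB.
have m2 := measurable_square (strip_L2 a b Lh).
rewrite -lee_fin EFin_inner_sqr; last exact: strip_L2.
rewrite fubini_tonelli1//; last by move=> p; rewrite lee_fin sqr_ge0.
apply: (@le_trans _ _ (\int[lebesgue_measure]_s (B%:E * (\1_(`]a, b]%classic) s)%:E))%E).
  apply: le_integral_nonmeasurable => s _.
    by apply: integral_ge0 => w _; rewrite lee_fin sqr_ge0.
  rewrite /fubini_F /strip indicE/=; case: (boolP (a < s <= b)) => sab.
    by rewrite mem_set/= ?in_itv// mule1; exact: hB.
  rewrite memNset/= ?in_itv/= ?(negbTE sab)// mule0.
  by rewrite expr0n/= integral0.
have [ab'|ab'] := ltP a b; last first.
  have -> : b = a by lra.
  rewrite subrr mul0r (_ : `]a, a]%classic = set0).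
    by under eq_integral do rewrite indicE in_set0 mule0; rewrite integral0.
  by apply/seteqP; split => s //=; rewrite in_itv/= => /andP[/lt_le_trans h1/h1]; rewrite ltxx.
have B0 : 0 <= B.
  rewrite -lee_fin; apply: le_trans (hB b _); last by rewrite ab' lexx.
  by apply: integral_ge0 => w _; rewrite lee_fin sqr_ge0.
rewrite ge0_integralZl//; last by apply/measurable_EFinP; exact: measurable_indic.
by rewrite integral_indic_oc max_r ?subr_ge0// mulrC EFinM.
Qed.

End TimeIntegral.

(** * Square integrability of a localized solution *)

Section ItoMartingale.
Context (R : realType) d (Omega : measurableType d) (P : probability Omega R).
Context (T : R) (Fl : R -> set (set Omega)).
Context (q : nat) (M : R -> Omega -> 'cV[R]_q).
Local Notation L2 := (square_integrable P).
Local Notation time_space := ((@lebesgue_measure R \x P)%E).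

(** The noise part sum_i N_i int_0^t h dM_i of a solution, characterized as a
    mean-square limit of Ito integrals. The integrands [g k] are those of the
    localized integrals, so that no integral of [h] itself has to be built. *)
Definition ito_martingale n (N : 'I_q -> 'M[R]_n) (h : 'I_n -> R * Omega -> R)
    (Z : 'I_n -> R -> Omega -> R) :=
  [/\ forall a, square_integrable time_space (h a),
      forall a t, 0 <= t <= T -> L2 (Z a t) &
      exists (g : nat -> 'I_n -> R * Omega -> R) (J : nat -> R -> Omega -> 'M[R]_(n, q)),
        [/\ forall k, ito_limit P T Fl M (g k) (J k),
            forall a, l2norm time_space (fun p => g k a p - h a p) @[k --> \oo] --> 0 &
            forall a t, 0 <= t <= T ->
              l2norm P (fun w => (\sum_(z : 'I_q * 'I_n) N z.1 a z.2 * J k t w z.2 z.1)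
                - Z a t w) @[k --> \oo] --> 0]].

End ItoMartingale.

Section LocalizedSolution.
Context (R : realType) d (Omega : measurableType d) (P : probability Omega R).
Context (T : R) (T_gt0 : 0 < T) (Fl : R -> set (set Omega)).
Hypothesis Fl_usual : usual_filtration P T Fl.
Context (q : nat) (K : 'M[R]_q) (M : R -> Omega -> 'cV[R]_q).
Hypothesis M_levy : levy_process P T Fl K M.
Local Notation L2 := (square_integrable P).
Local Notation time_space := ((@lebesgue_measure R \x P)%E).

Context (n : nat) (A : 'M[R]_n) (N : 'I_q -> 'M[R]_n) (x0 : 'cV[R]_n).
Context (x : R -> Omega -> 'cV[R]_n) (tau : nat -> Omega -> R).
Context (J : nat -> R -> Omega -> 'M[R]_(n, q)).
Context (h : 'I_n -> R * Omega -> R) (N0 : set Omega).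

Definition stopped k a (p : R * Omega) : R := if p.1 <= tau k p.2 then h a p else 0.

Local Notation hk := stopped.

Hypothesis mN0 : measurable N0.
Hypothesis PN0 : P N0 = 0%E.
Hypothesis mh : forall a, measurable_fun setT (h a).
Hypothesis h_out : forall a s w, ~~ (0 < s <= T) \/ N0 w -> h a (s, w) = 0.
Hypothesis h_left : forall a s w, 0 < s <= T -> ~ N0 w ->
  x r w a 0 @[r --> s^'-] --> h a (s, w).
Hypothesis mx : forall t a, 0 <= t <= T -> measurable_fun setT (fun w => x t w a 0).
Hypothesis mtau : forall k t, 0 <= t <= T -> measurable [set w | tau k w <= t].
Hypothesis tau_mono : forall k w, tau k w <= tau k.+1 w.
Hypothesis tau_reach : forall w, ~ N0 w -> exists k, T <= tau k w.
Hypothesis J_ito : forall k, ito_limit P T Fl M (hk k) (J k).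
Hypothesis x_eq : forall k t, 0 <= t <= T -> {ae P, forall w, t <= tau k w ->
  forall a, x t w a 0 = x0 a 0 + \sum_c A a c * time_integral (hk k c) 0 t w
    + \sum_(z : 'I_q * 'I_n) N z.1 a z.2 * J k t w z.2 z.1}.

Let Lhk k a : square_integrable time_space (hk k a).
Proof. by case: (J_ito k). Qed.

Let LJ k t a i : 0 <= t <= T -> L2 (fun w => J k t w a i).
Proof. by case: (J_ito k) => _ + _; apply. Qed.

(** The expectation of the integral over (0, t] of the squared norm of the stopped
    integrand, to which the Gronwall argument applies. *)
Let energy k t : R :=
  \sum_c inner time_space (strip 0 t (hk k c)) (strip 0 t (hk k c)).

Lemma strip_split_inner (g : R * Omega -> R) a b c : a <= b -> b <= c ->
  square_integrable time_space g ->
  inner time_space (strip a c g) (strip a c g) =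
  inner time_space (strip a b g) (strip a b g) + inner time_space (strip b c g) (strip b c g).
Proof.
move=> ab bc Lg.
have L1 := strip_L2 a b Lg; have L2' := strip_L2 b c Lg.
have -> : strip a c g = fun p => strip a b g p + strip b c g p.
  apply/funext => p; rewrite /strip.
  case: (ltP a p.1) => h1; case: (leP p.1 c) => h2; case: (leP p.1 b) => h3;
  case: (ltP b p.1) => h4 /=; rewrite ?addr0 ?add0r//; exfalso; lra.
have o : inner time_space (strip a b g) (strip b c g) = 0.
  rewrite /inner (_ : (fun x0 => _) = fun=> 0); first by rewrite /Rintegral integral0.
  apply/funext => p; rewrite /strip.
  case: (ltP a p.1) => h1; case: (leP p.1 c) => h2; case: (leP p.1 b) => h3;
  case: (ltP b p.1) => h4 /=; rewrite ?mulr0 ?mul0r//; exfalso; lra.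
have o' : inner time_space (strip b c g) (strip a b g) = 0.
  by rewrite -o; exact: innerC.
rewrite (innerDl L1 L2' (square_integrableD L1 L2')).
by rewrite (innerDr L1 L1 L2') (innerDr L2' L1 L2') o o' addr0 add0r.
Qed.

Let energy_ge0 k t : 0 <= energy k t.
Proof. by apply: sumr_ge0 => c _; exact: inner_ge0. Qed.

Let energy_mono k t t' : 0 <= t -> t <= t' -> energy k t <= energy k t'.
Proof.
move=> t0 tt'; apply: ler_sum => c _.
by rewrite (strip_split_inner t0 tt')// lerDl inner_ge0.
Qed.

Let comp_le k t c : inner time_space (strip 0 t (hk k c)) (strip 0 t (hk k c)) <= energy k t.
Proof.
by rewrite /energy (bigD1 c)//= lerDl; apply: sumr_ge0 => ? _; exact: inner_ge0.
Qed.

Let rhs k a t w : R := x0 a 0 + \sum_c A a c * time_integral (hk k c) 0 t w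
    + \sum_(z : 'I_q * 'I_n) N z.1 a z.2 * J k t w z.2 z.1.

Let c1 : R := \sum_a (`|x0 a 0| + \sum_c `|A a c| * Num.sqrt T
   + \sum_(z : 'I_q * 'I_n) `|N z.1 a z.2| * Num.sqrt (K z.1 z.1)).

Lemma l2norm_cst (c : R) : l2norm P (fun=> c) = `|c|.
Proof.
rewrite /l2norm /inner Rintegral_cst// -expr2.
by rewrite (_ : fine _ = 1) ?mulr1 ?sqrtr_sqr//= probability_setT.
Qed.

Lemma ito_l2norm (g : 'I_n -> R * Omega -> R) J' t a i : ito_limit P T Fl M g J' ->
  0 <= t <= T -> l2norm P (fun w => J' t w a i) =
    Num.sqrt (K i i) * l2norm time_space (strip 0 t (g a)).
Proof.
move=> gJ tT; have K0 : 0 <= K i i.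
  have TT : 0 <= T <= T by rewrite lexx ltW.
  have := levy_covarianceE M_levy i i TT.
  by move=> E; rewrite -(pmulr_lge0 _ T_gt0) -E inner_ge0.
by rewrite /l2norm (ito_isometry T_gt0 Fl_usual M_levy a a i i gJ gJ tT tT) sqrtrM.
Qed.

Let rhs_L2 k a t : 0 <= t <= T -> L2 (rhs k a t).
Proof.
move=> tT; have /andP[t0 _] := tT.
apply: square_integrableD.
  apply: square_integrableD; first exact: cst_L2.
  apply: square_integrable_sum => c; apply: square_integrableZ.
  by case: (time_integral_L2 t0 (Lhk k c)).
by apply: square_integrable_sum => z; apply: square_integrableZ; exact: LJ.
Qed.

Let rhs_bound k a t : 0 <= t <= T ->
  inner P (rhs k a t) (rhs k a t) <= 2 * c1 ^+ 2 * (1 + energy k t).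
Proof.
move=> tT; have /andP[t0 tT1] := tT; set E := energy k t.
have E0 : 0 <= E by exact: energy_ge0.
have Lt c : L2 (time_integral (hk k c) 0 t) by case: (time_integral_L2 t0 (Lhk k c)).
have LN z : L2 (fun w => N z.1 a z.2 * J k t w z.2 z.1).
  by apply: square_integrableZ; exact: LJ.
have LA c : L2 (fun w => A a c * time_integral (hk k c) 0 t w).
  exact: square_integrableZ.
have sE c : l2norm time_space (strip 0 t (hk k c)) <= Num.sqrt E.
  by rewrite ler_wsqrtr// comp_le.
have H : l2norm P (rhs k a t) <= c1 * (1 + Num.sqrt E).
  pose b1 := `|x0 a 0|; pose b2 := \sum_c `|A a c| * Num.sqrt T.
  pose b3 := \sum_(z : 'I_q * 'I_n) `|N z.1 a z.2| * Num.sqrt (K z.1 z.1).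
  have c1b : b1 + b2 + b3 <= c1.
    rewrite /c1 (bigD1 a)//= -[leLHS]addr0 lerD//; apply: sumr_ge0 => i _.
    rewrite !addr_ge0//; apply: sumr_ge0 => *; rewrite mulr_ge0// sqrtr_ge0//.
  have b20 : 0 <= b2 by apply: sumr_ge0 => *; rewrite mulr_ge0// sqrtr_ge0.
  have b30 : 0 <= b3 by apply: sumr_ge0 => *; rewrite mulr_ge0// sqrtr_ge0.
  apply: (@le_trans _ _ (b1 + b2 * Num.sqrt E + b3 * Num.sqrt E)).
    apply: le_trans (ler_l2normD _ _) _.
    - apply: square_integrableD; first exact: cst_L2.
      exact: square_integrable_sum.
    - exact: square_integrable_sum.
    apply: lerD.
      apply: le_trans (ler_l2normD _ _) _; first exact: cst_L2.
        exact: square_integrable_sum.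
      rewrite l2norm_cst lerD2l.
      apply: le_trans (ler_l2norm_sum _ _) _ => //.
      rewrite mulr_suml; apply: ler_sum => c _.
      rewrite l2normZ// -mulrA ler_wpM2l//.
      have [_ B] := time_integral_L2 t0 (Lhk k c); rewrite subr0 in B.
      apply: (@le_trans _ _ (Num.sqrt t * l2norm time_space (strip 0 t (hk k c)))).
        by rewrite /l2norm -sqrtrM// ler_wsqrtr.
      by apply: ler_pM; [exact: sqrtr_ge0|exact: l2norm_ge0|rewrite ler_wsqrtr|exact: sE].
    apply: le_trans (ler_l2norm_sum _ _) _ => //.
    rewrite mulr_suml; apply: ler_sum => z _.
    rewrite l2normZ; last exact: LJ.
    rewrite -mulrA ler_wpM2l//.
    rewrite (ito_l2norm _ _ (J_ito k))// ler_wpM2l ?sqrtr_ge0//.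
  have s0 := sqrtr_ge0 E; have b10 : 0 <= b1 by exact: normr_ge0.
  nra.
rewrite -l2norm_sqr.
have c10 : 0 <= c1.
  apply: sumr_ge0 => i _.
  rewrite !addr_ge0//; apply: sumr_ge0 => *; rewrite mulr_ge0// sqrtr_ge0//.
have s0 := sqrtr_ge0 E.
apply: (le_trans (lerXn2r 2 _ _ H)); rewrite ?nnegrE ?mulr_ge0 ?l2norm_ge0 ?addr_ge0//.
rewrite exprMn [leRHS](_ : _ = c1 ^+ 2 * (2 * (1 + E))); last by ring.
apply: ler_wpM2l; first exact: sqr_ge0.
have := sqr_sqrtr E0; move: (Num.sqrt E) s0 => s s0 <-.
have := sqr_ge0 (1 - s); nra.
Qed.

(** The left limits of the cut state are the stopped left limits [stopped]. The
    inequality is strict because a stopping time provides the events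
    tau <= t. *)
Let cut k a t w : R := if t < tau k w then x t w a 0 else 0.

Let mind k t : 0 <= t <= T -> measurable_fun setT (\1_[set w | t < tau k w] : Omega -> R).
Proof.
move=> tT; apply: measurable_indic.
rewrite (_ : [set w | t < tau k w] = ~` [set w | tau k w <= t]).
  by apply: measurableC; exact: mtau.
by apply/seteqP; split => w /=; rewrite ltNge => /negP.
Qed.

Let cutE k a t : cut k a t = fun w => \1_[set w | t < tau k w] w * x t w a 0.
Proof.
apply/funext => w; rewrite /cut indicE; case: ifPn => tw.
  by rewrite mem_set// mul1r.
by rewrite memNset ?mul0r//=; exact/negP.
Qed.

Let cut_L2 k a t : 0 <= t <= T -> L2 (cut k a t) /\
  inner P (cut k a t) (cut k a t) <= 2 * c1 ^+ 2 * (1 + energy k t).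
Proof.
move=> tT.
pose u w := \1_[set w | t < tau k w] w * rhs k a t w.
have Lr := rhs_L2 k a tT.
have uler w : `|u w| <= `|rhs k a t w|.
  rewrite /u normrM indicE; case: (_ \in _); first by rewrite normr1 mul1r.
  by rewrite normr0 mul0r.
have Lu : L2 u.
  apply: (le_square_integrable _ Lr) => //.
  by apply: measurable_funM; [exact: mind|case: Lr].
have ucut : {ae P, forall w, u w = cut k a t w}.
  apply: filterS (x_eq k tT) => w H; rewrite /u cutE indicE.
  have [tw|tw] := boolP (w \in _); last by rewrite !mul0r.
  by rewrite !mul1r H//; move: tw; rewrite inE /= => /ltW.
have mcut : measurable_fun setT (cut k a t).
  by rewrite cutE; apply: measurable_funM; [exact: mind|exact: mx].
have Lc := square_integrable_ae mcut Lu ucut.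
split => //.
have -> : inner P (cut k a t) (cut k a t) = inner P u u.
  by apply: inner_ae => //; apply: filterS ucut => w ->.
by apply: le_trans (ler_inner_sqr Lu Lr uler) _; exact: rhs_bound.
Qed.

(** The bound on the states before s passes to the left limit at s by Fatou. *)
Let section_bound k a s : 0 < s <= T ->
  (\int[P]_w ((hk k a (s, w)) ^+ 2)%:E <= (2 * c1 ^+ 2 * (1 + energy k s))%:E)%E.
Proof.
move=> sT; have /andP[s0 sT1] := sT.
pose r (m : nat) : R := s - s / m.+1%:R.
have r0 m : 0 <= r m.
  by rewrite subr_ge0 ler_pdivrMr ?ltr0n// ler_peMr ?ler1n// ltW.
have rs m : r m < s by rewrite ltrBlDr ltrDl divr_gt0.
have rT m : 0 <= r m <= T by rewrite r0 (le_trans (ltW (rs m))).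
have rcvg : r m @[m --> \oo] --> s.
  rewrite -[X in _ --> X]subr0 -[X in _ --> _ - X](mulr0 s).
  apply: cvgB; first exact: cvg_cst.
  by apply: cvgM; [exact: cvg_cst|exact: cvg_harmonic].
have [] := @l2norm_fatou _ _ _ P (fun m => cut k a (r m)) (fun w => hk k a (s, w))
  (2 * c1 ^+ 2 * (1 + energy k s)).
- apply: measurableT_comp; last exact: pair1_measurable.
  exact: square_integrable_measurable (Lhk k a).
- by move=> m; case: (cut_L2 k a (rT m)).
- move=> m; case: (cut_L2 k a (rT m)) => _ /le_trans; apply.
  apply: ler_wpM2l; first by rewrite mulr_ge0 ?sqr_ge0.
  by rewrite lerD2l; apply: energy_mono => //; exact: ltW.
- exists N0; split => // w /= H; apply: contrapT => Nw; apply: H.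
  rewrite /stopped /=; case: ifPn => stau.
    rewrite (_ : (fun m => _) = fun m => x (r m) w a 0); last first.
      by apply/funext => m; rewrite /cut (lt_le_trans (rs m) stau).
    by have /cvg_at_leftP := @h_left a _ _ sT Nw; apply.
  rewrite -ltNge in stau; apply: cvg_near_cst.
  have : \forall m \near \oo, tau k w < r m by exact: (cvgr_gt s).
  by apply: filterS => m tr; rewrite /cut ltNge (ltW tr).
move=> Ls H; rewrite -EFin_inner_sqr// lee_fin//.
Qed.

Let rate : R := n%:R * (2 * c1 ^+ 2).

Let energy_step k t t' : 0 <= t -> t <= t' -> t' <= T ->
  energy k t' <= energy k t + rate * (1 + energy k t') * (t' - t).
Proof.
move=> t0 tt' tT'; rewrite /energy.
under [leLHS]eq_bigr do rewrite (strip_split_inner t0 tt')//.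
rewrite big_split/= lerD2l -/(energy k t').
apply: (@le_trans _ _ (\sum_(c < n) (t' - t) * (2 * c1 ^+ 2 * (1 + energy k t')))).
  apply: ler_sum => c _; apply: strip_sqr_le => // s /andP[ts st'].
  apply: le_trans (section_bound _ _ _) _.
    by rewrite (le_lt_trans t0 ts) (le_trans st').
  rewrite lee_fin; apply: ler_wpM2l; first by rewrite mulr_ge0 ?sqr_ge0.
  by rewrite lerD2l; apply: energy_mono => //; exact: le_trans t0 (ltW ts).
rewrite sumr_const card_ord -mulr_natl /rate.
by rewrite le_eqVlt; apply/orP; left; apply/eqP; ring.
Qed.

(** Discrete Gronwall: on a time mesh of step at most 1 / (2 rate), each step at
    most doubles 1 + energy, whatever the localization index [k]. *)
Lemma energy_bounded : exists B, forall k, energy k T <= B.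
Proof.
have rate0 : 0 <= rate.
  by apply: mulr_ge0 => //; apply: mulr_ge0 => //; exact: sqr_ge0.
have rT0 : 0 <= 2 * rate * T.
  by apply: mulr_ge0; [exact: mulr_ge0|exact: ltW].
pose m := Num.bound (2 * rate * T).
have hm : 2 * rate * T < m%:R by exact: archi_boundP.
have mR : 0 < m%:R :> R by exact: le_lt_trans hm.
exists (2 ^+ m) => k.
pose t (j : nat) : R := j%:R * (T / m%:R).
have dl0 : 0 < T / m%:R by rewrite divr_gt0.
have tm : t m = T by rewrite /t mulrCA divff ?mulr1// gt_eqF.
suff H j : (j <= m)%N -> 1 + energy k (t j) <= 2 ^+ j.
  by have := H m (leqnn m); rewrite tm; move: (2 ^+ m) => B; lra.
elim: j => [_|j IH jm].
  rewrite expr0 /t mul0r /energy big1 ?addr0// => c _.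
  rewrite (_ : strip 0 0 _ = fun=> 0) ?inner0l//; apply/funext => p.
  by rewrite /strip; case: ifPn => // /andP[/lt_le_trans h1/h1]; rewrite ltxx.
have {}IH := IH (ltnW jm).
have tj0 : 0 <= t j by rewrite mulr_ge0// ltW.
have tjj : t j.+1 - t j = T / m%:R by rewrite /t -mulrBl -natrB// subSnn mul1r.
have tle : t j <= t j.+1 by rewrite -subr_ge0 tjj ltW.
have tT : t j.+1 <= T by rewrite -tm /t ler_pM2r// ler_nat.
have := energy_step k tj0 tle tT; rewrite tjj.
have half : rate * (T / m%:R) <= 1 / 2.
  by rewrite mulrA ler_pdivrMr//; lra.
have E0 := energy_ge0 k (t j.+1).
move: IH; rewrite exprS; move: E0; move: (energy k (t j.+1)) (energy k (t j)) => E1 E0.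
move: half; move: (T / m%:R) => dl half E10; move: (2 ^+ j) => B IH H.
nra.
Qed.

Let tau_le k l w : (k <= l)%N -> tau k w <= tau l w.
Proof.
by move=> kl; have /nondecreasing_seqP := fun j => tau_mono j w; apply.
Qed.

Let stopped_eventually c p : \forall k \near \oo, hk k c p = h c p.
Proof.
case: p => s w; have [[sT Nw]|H] := pselect (0 < s <= T /\ ~ N0 w).
  have [k0 Tk0] := tau_reach Nw.
  exists k0 => // k /= k0k; rewrite /stopped /=.
  by rewrite (le_trans _ (le_trans Tk0 (tau_le _ k0k)))//; case/andP: sT.
apply: nearW => k; rewrite /stopped h_out ?if_same//.
have [Nw|Nw] := pselect (N0 w); first by right.
by left; apply/negP => sT; exact: H.
Qed.

Let inner_stopped_le B : (forall k, energy k T <= B) ->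
  forall k c, inner time_space (hk k c) (hk k c) <= B.
Proof.
move=> eB k c; apply: le_trans (eB k); apply: le_trans (comp_le k T c).
rewrite (_ : strip 0 T (hk k c) = hk k c)//; apply/funext => -[s w].
rewrite /strip /=; case: ifPn => // sT.
by rewrite /stopped h_out ?if_same//; left.
Qed.

(** At each point the stopped integrands are eventually equal to [h], and their
    norms are bounded in k. *)
Let h_L2 c : square_integrable time_space (h c).
Proof.
have [B eB] := energy_bounded.
have [] := @l2norm_fatou _ _ _ time_space (hk ^~ c) (h c) B.
- exact: mh.
- by move=> k; exact: Lhk.
- by move=> k; exact: inner_stopped_le.
- by apply: aeW => p; apply: cvg_near_cst; exact: stopped_eventually.
by [].
Qed.

Let stopped_cvg c : l2norm time_space (fun p => hk k c p - h c p) @[k --> \oo] --> 0.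
Proof.
have LB k := square_integrableB (Lhk k c) (h_L2 c).
have key : (\int[time_space]_p ((hk k c p - h c p) ^+ 2)%:E)%E @[k --> \oo] --> 0%E.
  have [] // := @dominated_convergence _ _ _ time_space _ measurableT
    (fun k p => ((hk k c p - h c p) ^+ 2)%:E) (fun=> 0%E) (fun p => (h c p ^+ 2)%:E)
    (fun k => measurable_square (LB k)) (measurable_cst _) _ (integrable_square (h_L2 c)).
  - apply: aeW => p _; apply: cvg_near_cst.
    by apply: filterS (stopped_eventually c p) => k ->; rewrite subrr expr0n.
  - apply: aeW => p k _; rewrite gee0_abs ?lee_fin ?sqr_ge0//.
    rewrite /stopped; case: ifP => _; first by rewrite subrr expr0n sqr_ge0.
    by rewrite sub0r sqrrN.
  by move=> _ _; rewrite integral0.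
apply: l2norm_cvg_le key => k //.
exact: square_integrable_measurable (LB k).
Qed.

Lemma ito_l2norm_sub (g g' : 'I_n -> R * Omega -> R) J1 J2 t a i :
  ito_limit P T Fl M g J1 -> ito_limit P T Fl M g' J2 -> 0 <= t <= T ->
  l2norm P (fun w => J1 t w a i - J2 t w a i) =
  Num.sqrt (K i i) * l2norm time_space (fun p => strip 0 t (g a) p - strip 0 t (g' a) p).
Proof.
move=> gJ gJ' tT; have K0 : 0 <= K i i.
  have TT : 0 <= T <= T by rewrite lexx ltW.
  have := levy_covarianceE M_levy i i TT.
  by move=> E; rewrite -(pmulr_lge0 _ T_gt0) -E inner_ge0.
have L1 : L2 (fun w => J1 t w a i) by case: gJ => _ + _; apply.
have L1' : L2 (fun w => J2 t w a i) by case: gJ' => _ + _; apply.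
have Lg : square_integrable time_space (strip 0 t (g a)).
  by apply: strip_L2; case: gJ.
have Lg' : square_integrable time_space (strip 0 t (g' a)).
  by apply: strip_L2; case: gJ'.
have iso g1 g2 J1' J2' := @ito_isometry _ _ _ _ _ T_gt0 _ Fl_usual _ _ _ M_levy _ _
  g1 J1' g2 J2' t t a a i i.
rewrite /l2norm -sqrtrM//; congr Num.sqrt.
have -> : inner P (fun w => J1 t w a i - J2 t w a i) (fun w => J1 t w a i - J2 t w a i) =
  K i i * (inner time_space (strip 0 t (g a)) (strip 0 t (g a))
    - 2 * inner time_space (strip 0 t (g a)) (strip 0 t (g' a))
    + inner time_space (strip 0 t (g' a)) (strip 0 t (g' a))).
  rewrite (inner_sub_sqr L1 L1') (iso g g)// (iso g g')// (iso g' g')//; ring.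
by congr (_ * _); apply/esym; exact: inner_sub_sqr.
Qed.

(** What the drift leaves of the state: the noise part, obtained without a
    stochastic integral of [h]. *)
Definition sde_remainder a t w : R :=
  x t w a 0 - x0 a 0 - \sum_c A a c * time_integral (h c) 0 t w.

Local Notation Z := sde_remainder.

Let Zk k a t w : R := \sum_(z : 'I_q * 'I_n) N z.1 a z.2 * J k t w z.2 z.1.

Let Zk_L2 k a t : 0 <= t <= T -> L2 (Zk k a t).
Proof.
move=> tT; apply: square_integrable_sum => z; apply: square_integrableZ.
exact: LJ.
Qed.

Let mZ a t : 0 <= t <= T -> measurable_fun setT (Z a t).
Proof.
move=> tT; have /andP[t0 _] := tT.
apply: measurable_funB.
  by apply: measurable_funB; [exact: mx|exact: measurable_cst].
by apply: measurable_sum => c; apply: measurable_funM => //;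
  exact: measurable_time_integral.
Qed.

Let Zk_eventually a t : 0 <= t <= T ->
  {ae P, forall w, \forall k \near \oo, Zk k a t w = Z a t w}.
Proof.
move=> tT.
have H : {ae P, forall w, forall k, t <= tau k w -> Zk k a t w = Z a t w}.
  apply: ae_foralln => k; apply: filterS (x_eq k tT) => w Hw tw.
  rewrite /sde_remainder (Hw tw a).
  rewrite (eq_bigr (fun c => A a c * time_integral (h c) 0 t w)); last first.
    move=> c _; congr (_ * _); apply: eq_Rintegral => s _.
    rewrite /strip /stopped /=; case: ifP => // /andP[_ st].
    by rewrite (le_trans st tw).
  by rewrite /Zk; lra.
have N0ae : {ae P, forall w, ~ N0 w}.
  by exists N0; split => // w /= /contrapT.
apply: filterS2 H N0ae => w Hw Nw.
have [k0 Tk0] := tau_reach Nw.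
exists k0 => // k /= k0k; apply: Hw.
have /andP[_ tT1] := tT; exact: le_trans tT1 (le_trans Tk0 (tau_le _ k0k)).
Qed.

Let err k : R := \sum_c l2norm time_space (fun p => hk k c p - h c p).

Let err_cvg : err k @[k --> \oo] --> 0.
Proof.
rewrite /err; elim: (index_enum _) => [|c s IH].
  by under eq_fun do rewrite big_nil; exact: cvg_cst.
under eq_fun do rewrite big_cons.
by have := cvgD (stopped_cvg c) IH; rewrite addr0; apply.
Qed.

Let cZ a : R := \sum_(z : 'I_q * 'I_n) `|N z.1 a z.2| * Num.sqrt (K z.1 z.1).

(** The isometry carries the convergence of the stopped integrands over to the
    noise parts. *)
Let Zk_cauchy k l a t : 0 <= t <= T ->
  l2norm P (fun w => Zk k a t w - Zk l a t w) <= cZ a * (err k + err l).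
Proof.
move=> tT.
rewrite (_ : (fun w => _) = (fun w => \sum_(z : 'I_q * 'I_n)
    N z.1 a z.2 * (J k t w z.2 z.1 - J l t w z.2 z.1))); last first.
  by apply/funext => w; rewrite /Zk -sumrB; apply: eq_bigr => z _; rewrite mulrBr.
have LB z : L2 (fun w => J k t w z.2 z.1 - J l t w z.2 z.1).
  by apply: square_integrableB; exact: LJ.
apply: le_trans (ler_l2norm_sum _ _) _ => [z|]; first exact: square_integrableZ.
rewrite /cZ mulr_suml; apply: ler_sum => z _.
rewrite l2normZ// -mulrA ler_wpM2l//.
rewrite (ito_l2norm_sub _ _ (J_ito k) (J_ito l) tT) ler_wpM2l ?sqrtr_ge0//.
have part m c : l2norm time_space (fun p => hk m c p - h c p) <= err m.
  by rewrite /err (bigD1 c)//= lerDl; apply: sumr_ge0 => *; exact: l2norm_ge0.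
have LBk m c := square_integrableB (Lhk m c) (h_L2 c).
apply: (@le_trans _ _ (l2norm time_space
   (fun p => (hk k z.2 p - h z.2 p) - (hk l z.2 p - h z.2 p)))).
  rewrite ler_wsqrtr//.
  rewrite (_ : (fun p => strip _ _ _ p - _) = strip 0 t
     (fun p => (hk k z.2 p - h z.2 p) - (hk l z.2 p - h z.2 p))); last first.
    apply/funext => p; rewrite /strip; case: ifP => _; last by rewrite subrr.
    by lra.
  apply: ler_inner_sqr.
  - by apply: strip_L2; exact: square_integrableB.
  - exact: square_integrableB.
  - by move=> p; rewrite /strip; case: ifP => // _; rewrite normr0.
by apply: le_trans (ler_l2normB (LBk k _) (LBk l _)) _; rewrite lerD.
Qed.

(** The mean-square limit of a Cauchy sequence is identified by its almost sure
    limit, through Fatou. *)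
Let Zk_cvg a t : 0 <= t <= T ->
  L2 (Z a t) /\ l2norm P (fun w => Zk k a t w - Z a t w) @[k --> \oo] --> 0.
Proof.
move=> tT.
have cZ0 : 0 <= cZ a by apply: sumr_ge0 => *; rewrite mulr_ge0// sqrtr_ge0.
have err0 k : 0 <= err k by apply: sumr_ge0 => *; exact: l2norm_ge0.
have fat k e : 0 <= e -> (\forall l \near \oo, cZ a * (err k + err l) <= e) ->
    L2 (fun w => Zk k a t w - Z a t w) /\ l2norm P (fun w => Zk k a t w - Z a t w) <= e.
  move=> e0 [l0 _ H].
  have [] := @l2norm_fatou _ _ _ P (fun l w => Zk k a t w - Zk (l + l0)%N a t w)
     (fun w => Zk k a t w - Z a t w) (e ^+ 2).
  - by apply: measurable_funB; [case: (Zk_L2 k a tT)|exact: mZ].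
  - by move=> l; apply: square_integrableB; exact: Zk_L2.
  - move=> l; rewrite -l2norm_sqr lerXn2r ?nnegrE ?l2norm_ge0//.
    by apply: le_trans (Zk_cauchy _ _ _ tT) (H _ _) => /=; rewrite leq_addl.
  - apply: filterS (Zk_eventually a tT) => w Hw.
    apply: cvg_near_cst; case: Hw => m _ Hm.
    by exists m => // l /= ml; rewrite (Hm (l + l0)%N)//= (leq_trans ml)// leq_addr.
  move=> LB; rewrite -l2norm_sqr ler_sqr ?nnegrE ?l2norm_ge0// => H2.
have small e : 0 < e -> \forall k \near \oo, cZ a * err k <= e.
  move=> e0; have c0 : cZ a * err k @[k --> \oo] --> 0.
    by rewrite -[X in _ --> X](mulr0 (cZ a)); apply: cvgM => //; exact: cvg_cst.
  move/cvgrPdist_le : c0 => /(_ e e0); apply: filterS => k.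
  by rewrite sub0r normrN ger0_norm// mulr_ge0.
have fatk k : L2 (fun w => Zk k a t w - Z a t w) /\
     l2norm P (fun w => Zk k a t w - Z a t w) <= cZ a * err k + 1.
  apply: fat; first by rewrite addr_ge0// mulr_ge0.
  by apply: filterS (small 1 ltr01) => l; rewrite mulrDr lerD2l.
split.
  have := square_integrableB (Zk_L2 0 a tT) (fatk 0%N).1.
  by under eq_fun do rewrite opprB addrC subrK.
apply/cvgrPdist_le => /= e e0.
have e2 : 0 < e / 2 by rewrite divr_gt0.
apply: filterS (small _ e2) => k ke.
rewrite sub0r normrN ger0_norm ?l2norm_ge0//.
apply: (fat k e (ltW e0) _).2.
by apply: filterS (small _ e2) => l le; rewrite mulrDr; lra.
Qed.

Lemma remainder_ito_martingale : ito_martingale P T Fl M N h Z.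
Proof.
split; [exact: h_L2|by move=> a t /(Zk_cvg a)[]|].
by exists hk, J; split => // a t /(Zk_cvg a)[].
Qed.

End LocalizedSolution.

(** * Solutions of the state equation *)

Lemma Rintegral_lincomb d (X : measurableType d) (R : realType)
    (mu : {measure set X -> \bar R}) (D : set X) (I : Type) (s : seq I) (c : I -> R)
    (f : I -> X -> R) : measurable D ->
  (forall i, mu.-integrable D (EFin \o f i)) ->
  mu.-integrable D (EFin \o (fun u => \sum_(i <- s) c i * f i u)) /\
  \int[mu]_(u in D) (\sum_(i <- s) c i * f i u) = \sum_(i <- s) c i * \int[mu]_(u in D) f i u.
Proof.
move=> mD fi.
have iZ i : mu.-integrable D (EFin \o (fun u => c i * f i u)).
  rewrite (_ : _ \o _ = fun u => ((c i)%:E * (EFin \o f i) u)%E)//.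
  exact: integrableZl.
elim: s => [|i s [IH1 IH2]].
  rewrite big_nil; split.
    by rewrite (_ : _ \o _ = cst 0%E); [exact: integrable0|apply/funext => u /=; rewrite big_nil].
  under eq_Rintegral do rewrite big_nil.
  by rewrite /Rintegral integral0.
rewrite big_cons (_ : (fun u => _) = (fun u => c i * f i u + \sum_(j <- s) c j * f j u)); last first.
  by apply/funext => u; rewrite big_cons.
split; last by rewrite RintegralD// RintegralZl// IH2.
rewrite (_ : _ \o _ = ((EFin \o (fun u => c i * f i u)%R) \+
  (EFin \o (fun u => \sum_(j <- s) c j * f j u)%R))%E)//.
exact: integrableD.
Qed.

Section SdeSolution.
Context (R : realType) d (Omega : measurableType d) (P : probability Omega R).
Context (T : R) (T_gt0 : 0 < T) (Fl : R -> set (set Omega)).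
Hypothesis Fl_usual : usual_filtration P T Fl.
Context (q : nat) (K : 'M[R]_q) (M : R -> Omega -> 'cV[R]_q).
Hypothesis M_levy : levy_process P T Fl K M.

Lemma left_limit_coord n (x : R -> Omega -> 'cV[R]_n) s w a : cadlag T (x ^~ w) ->
  0 < s <= T -> x r w a 0 @[r --> s^'-] --> left_limit x s w a 0.
Proof.
move=> [_ cx] sT; have c := cx s sT.
exact: (continuous_cvg _ (@coord_continuous _ _ _ a 0 _) c).
Qed.

(** A solution is square integrable, although its definition only provides
    localized integrals: [h] is the left limit of x, made zero outside (0, T] and on
    a null set that contains the paths that are not cadlag; the rest is the
    localization argument of [remainder_ito_martingale]. *)
Lemma sde_solution_L2 n (A : 'M[R]_n) (N : 'I_q -> 'M[R]_n) x0 x :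
  sde_solution P T Fl M A N x0 x ->
  exists h : 'I_n -> R * Omega -> R,
    [/\ ito_martingale P T Fl M N h (sde_remainder A x0 x h),
        forall a s w, ~~ (0 < s <= T) -> h a (s, w) = 0 &
        {ae P, forall w, forall a s, 0 < s <= T ->
          x r w a 0 @[r --> s^'-] --> h a (s, w)}].
Proof.
move=> [ax cx [I [tau [tau_stop tau_mono tau_reach tau_ito]] x_eq]].
have {}tau_ito k : exists J, is_ito_integral_L2 P T Fl M
    (fun s w => if s <= tau k w then left_limit x s w else 0) J /\
    forall t, 0 <= t <= T -> {ae P, forall w, t <= tau k w -> I t w = J t w}.
  by have [J ? ?] := tau_ito k; exists J.
have [J JP] := choice tau_ito.
have [N0 [mN0 PN0 N0P]] : {ae P, forall w, cadlag T (x ^~ w) /\ exists k, T <= tau k w}.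
  by apply: filterS2 cx tau_reach.
have good w : ~ N0 w -> cadlag T (x ^~ w) /\ exists k, T <= tau k w.
  by move=> Nw; apply: contrapT => H; apply: Nw; exact: N0P.
pose h a (p : R * Omega) : R :=
  if (0 < p.1 <= T) && (p.2 \notin N0) then left_limit x p.1 p.2 a 0 else 0.
have h_out a s w : ~~ (0 < s <= T) \/ N0 w -> h a (s, w) = 0.
  rewrite /h /= => -[/negbTE -> //|Nw].
  by rewrite (mem_set Nw) andbF.
have h_left a s w : 0 < s <= T -> ~ N0 w -> x r w a 0 @[r --> s^'-] --> h a (s, w).
  move=> sT Nw; rewrite /h /= sT memNset//=.
  by apply: left_limit_coord => //; case: (good w Nw).
have mx t a : 0 <= t <= T -> measurable_fun setT (fun w => x t w a 0).
  by move=> tT; apply: (filtration_measurable_fun Fl_usual tT) => B; exact: ax.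
have mtau k t : 0 <= t <= T -> measurable [set w | tau k w <= t].
  by move=> tT; apply: (flt_measurable Fl_usual tT); exact: tau_stop.
have mh a : measurable_fun setT (h a).
  apply: (measurable_left_limits T_gt0 (f := fun t w => x t w a 0) (N := N0)) => //.
  - by move=> t; exact: mx.
  - by move=> s w; exact: h_left.
  - by move=> s w; exact: h_out.
have mstop k c : measurable_fun setT (stopped tau h k c).
  apply: (measurable_left_limits T_gt0
    (f := fun t w => if t < tau k w then x t w c 0 else 0) (N := N0)) => //.
  - move=> t tT; rewrite (_ : (fun w => _) =
        fun w => \1_(~` [set w | tau k w <= t]) w * x t w c 0).
      apply: measurable_funM; last exact: mx.
      by apply: measurable_indic; apply: measurableC; exact: mtau.
    apply/funext => w; rewrite indicE; case: ifPn => tw.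
      by rewrite mem_set ?mul1r//= => H; move: tw; rewrite ltNge H.
    by rewrite memNset ?mul0r//= => H; apply: H; rewrite /= leNgt.
  - move=> s w sT Nw; rewrite /stopped /=; case: ifPn => stau.
      have hl := h_left c s w sT Nw; apply: cvg_trans hl.
      apply: near_eq_cvg; near=> r; have rs : r < s by near: r; exact: nbhs_left_lt.
      by rewrite (lt_le_trans rs stau).
    rewrite -ltNge in stau; apply: cvg_near_cst.
    near=> r; have tr : tau k w < r by near: r; exact: nbhs_left_gt.
    by rewrite ltNge (ltW tr).
  - by move=> s w H; rewrite /stopped h_out ?if_same.
have J_ito k : ito_limit P T Fl M (stopped tau h k) (J k).
  have [JI _] := JP k.
  apply: (ito_limit_of_ito Fl_usual M_levy JI) => //.
  - move=> b [s w] /= sT; rewrite /stopped h_out ?if_same//; by left.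
  - exists N0; split => // w /= H; apply: contrapT => Nw; apply: H => s sT b.
    rewrite /stopped /= /h /= sT memNset//=; case: ifP => //.
    by rewrite mxE.
have tau_reach' w : ~ N0 w -> exists k, T <= tau k w by case/good.
exists h; split; last first.
- by exists N0; split => // w /= H; apply: contrapT => Nw; apply: H => b s sT; exact: h_left.
- by move=> b s w sT; apply: h_out; left.
apply: (remainder_ito_martingale T_gt0 Fl_usual M_levy mN0 PN0 mh h_out h_left mx mtau
  tau_mono tau_reach' J_ito).
move=> k t tT; have /andP[t0 tT1] := tT.
have Lsec : {ae P, forall w, forall c, square_integrable lebesgue_measure
    (fun s => strip 0 t (stopped tau h k c) (s, w))}.
  apply: filter_forall => c; apply: strip_section_L2_ae.
  by case: (J_ito k).
have N0ae : {ae P, forall w, ~ N0 w}.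
  by exists N0; split => // w /= /contrapT.
have [_ IJ] := JP k.
apply: filterS2 (filterI (x_eq t tT) (IJ t tT)) (filterI Lsec N0ae).
move=> w [xw Iw] [Lw Nw] ttau b.
rewrite xw [in LHS]mxE [in LHS]mxE; congr (_ + _ + _); last first.
  rewrite summxE -(pair_bigA _ (fun i c => N i b c * J k t w c i))/=.
  apply: eq_bigr => i _; rewrite mxE; apply: eq_bigr => c _.
  by rewrite mxE Iw.
rewrite mxE -(Rintegral_lincomb _ _ measurableT _).2; last first.
  by move=> c; apply: strip_section_integrable; exact: Lw.
pose g s := \sum_c A b c * strip 0 t (stopped tau h k c) (s, w).
have mg : measurable_fun setT g.
  by apply: measurable_sum => c; apply: measurable_funM => //; case: (Lw c).
rewrite /Rintegral; congr fine.
rewrite (@integral_countable _ _ g)//.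
- rewrite [LHS]integral_mkcond; congr (integral _ _ _); apply/funext => s.
  rewrite patchE; case: ifPn => //; rewrite notin_setE/= in_itv/= => sT.
  rewrite /strip big1 // => c _; case: ifPn => [/andP[s0 st]|]; last by rewrite mulr0.
  by exfalso; apply: sT; rewrite (ltW s0).
- have [cw _] := good w Nw.
  apply: (@sub_countable _ _ _ (\bigcup_(o in [set: option 'I_n])
     if o is Some c then [set s | 0 < s <= T /\ x s w c 0 <> h c (s, w)] else [set 0])).
    apply: subset_card_le => s [] /=; rewrite in_itv/= => /andP[s0 st].
    rewrite mxE => neq; have [->|sn0] := eqVneq s 0; first by exists None.
    have sT : 0 < s <= T by rewrite lt_neqAle eq_sym sn0 s0/= (le_trans st).
    apply: contrapT => H; apply: neq; apply: eq_bigr => c _; congr (_ * _).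
    apply: contrapT => xs; apply: H; exists (Some c) => //; split => // xh.
    apply: xs; rewrite /strip /stopped /= st (le_trans st ttau) andbT.
    by case/andP: sT => ->.
  apply: bigcup_countable => // -[c|] _; last exact: countable1.
  apply: (@countable_jumps _ (fun s => x s w c 0) (fun s => h c (s, w))
    [set s | 0 < s <= T]) => s sT.
  exact: h_left.
Unshelve. all: by end_near. Qed.

End SdeSolution.

(** * Isometry and orthogonality of the noise part *)

Lemma cvg_sum_seq (R : realType) (I : Type) (s : seq I) (u : I -> nat -> R) (l : I -> R) :
  (forall i, u i k @[k --> \oo] --> l i) ->
  (\sum_(i <- s) u i k) @[k --> \oo] --> \sum_(i <- s) l i.
Proof.
move=> ul; elim: s => [|i s IH].
  by under eq_fun do rewrite big_nil; rewrite big_nil; exact: cvg_cst.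
under eq_fun do rewrite big_cons; rewrite big_cons.
by apply: cvgD => //; exact: ul.
Qed.

Section Martingales.
Context (R : realType) d (Omega : measurableType d) (P : probability Omega R).
Context (T : R) (T_gt0 : 0 < T) (Fl : R -> set (set Omega)).
Hypothesis Fl_usual : usual_filtration P T Fl.
Context (q : nat) (K : 'M[R]_q) (M : R -> Omega -> 'cV[R]_q).
Hypothesis M_levy : levy_process P T Fl K M.
Local Notation L2 := (square_integrable P).
Local Notation time_space := ((@lebesgue_measure R \x P)%E).

Lemma martingale_orthogonal n (N : 'I_q -> 'M[R]_n) h Z a t t' eta :
  ito_martingale P T Fl M N h Z -> 0 <= t -> t <= t' -> t' <= T ->
  L2 eta -> measurable_wrt (Fl t) eta ->
  inner P eta (fun w => Z a t' w - Z a t w) = 0.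
Proof.
move=> [Lh LZ [g [J [gJ gh JZ]]]] t0 tt' tT' Leta meta.
have tT : 0 <= t <= T by rewrite t0 (le_trans tt').
have tT2 : 0 <= t' <= T by rewrite tT' (le_trans t0).
have LJ k u z : 0 <= u <= T -> L2 (fun w => J k u w z.2 z.1).
  by case: (gJ k) => _ + _; apply.
pose S k u w := \sum_(z : 'I_q * 'I_n) N z.1 a z.2 * J k u w z.2 z.1.
have LS k u : 0 <= u <= T -> L2 (S k u).
  move=> uT; apply: square_integrable_sum => z; apply: square_integrableZ.
  exact: (LJ k u z).
have e0 : l2norm P (fun w => eta w - eta w) @[_ --> \oo] --> (0 : R).
  under eq_fun do under [X in l2norm _ X]eq_fun do rewrite subrr.
  by rewrite l2norm0; exact: cvg_cst.
have c u (uT : 0 <= u <= T) := @inner_cvg _ _ _ P (fun=> eta) (fun k => S k u) eta (Z a u)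
  (fun=> Leta) (fun k => LS k u uT) Leta (LZ a u uT) e0 (JZ a u uT).
have cB : (inner P eta (S k t') - inner P eta (S k t)) @[k --> \oo] -->
    inner P eta (Z a t') - inner P eta (Z a t).
  by apply: cvgB; exact: c.
rewrite innerBr//; [|exact: LZ..].
rewrite -(cvg_lim (@Rhausdorff R) cB); apply: cvg_lim => //.
rewrite (_ : (fun k => _) = fun=> 0); first exact: cvg_cst.
apply/funext => k.
have LN u z : 0 <= u <= T -> L2 (fun w => N z.1 a z.2 * J k u w z.2 z.1).
  by move=> uT; apply: square_integrableZ; exact: LJ.
rewrite /S !inner_sumr//; [|by move=> z; exact: LN..].
rewrite -sumrB big1// => z _.
rewrite !innerZr//; [|exact: LJ..].
rewrite -mulrBr -innerBr//; [|exact: LJ..].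
by rewrite (ito_orthogonal Fl_usual M_levy _ _ (gJ k))// mulr0.
Qed.

Lemma martingale_isometry n n' (N : 'I_q -> 'M[R]_n) (N' : 'I_q -> 'M[R]_n')
    h h' Z Z' a b t t' :
  ito_martingale P T Fl M N h Z -> ito_martingale P T Fl M N' h' Z' ->
  0 <= t <= T -> 0 <= t' <= T ->
  inner P (Z a t) (Z' b t') = \sum_(z : 'I_q * 'I_n) \sum_(y : 'I_q * 'I_n')
    N z.1 a z.2 * N' y.1 b y.2 * K z.1 y.1 *
    inner time_space (strip 0 t (h z.2)) (strip 0 t' (h' y.2)).
Proof.
move=> [Lh LZ [g [J [gJ gh JZ]]]] [Lh' LZ' [g' [J' [gJ' gh' JZ']]]] tT tT'.
have Lg k c : square_integrable time_space (g k c) by case: (gJ k).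
have Lg' k c : square_integrable time_space (g' k c) by case: (gJ' k).
have LJ k z : L2 (fun w => J k t w z.2 z.1).
  by case: (gJ k) => _ + _; apply.
have LJ' k z : L2 (fun w => J' k t' w z.2 z.1).
  by case: (gJ' k) => _ + _; apply.
pose S k w := \sum_(z : 'I_q * 'I_n) N z.1 a z.2 * J k t w z.2 z.1.
pose S' k w := \sum_(z : 'I_q * 'I_n') N' z.1 b z.2 * J' k t' w z.2 z.1.
have LS k : L2 (S k).
  by apply: square_integrable_sum => z; apply: square_integrableZ; exact: (LJ k z).
have LS' k : L2 (S' k).
  by apply: square_integrable_sum => z; apply: square_integrableZ; exact: (LJ' k z).
have c1 := inner_cvg LS LS' (LZ a t tT) (LZ' b t' tT') (JZ a t tT) (JZ' b t' tT').
rewrite -(cvg_lim (@Rhausdorff R) c1); apply: cvg_lim => //.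
have SE k : inner P (S k) (S' k) = \sum_(z : 'I_q * 'I_n) \sum_(y : 'I_q * 'I_n')
    N z.1 a z.2 * N' y.1 b y.2 * K z.1 y.1 *
    inner time_space (strip 0 t (g k z.2)) (strip 0 t' (g' k y.2)).
  rewrite inner_suml//; last by move=> z; exact: square_integrableZ.
  apply: eq_bigr => z _; rewrite inner_sumr; last 2 first.
  - by move=> y; exact: square_integrableZ.
  - exact: square_integrableZ.
  apply: eq_bigr => y _; rewrite innerZl//; last exact: square_integrableZ.
  rewrite innerZr//.
  by rewrite (ito_isometry T_gt0 Fl_usual M_levy _ _ _ _ (gJ k) (gJ' k))//; ring.
pose u z y k := N z.1 a z.2 * N' y.1 b y.2 * K z.1 y.1 *
    inner time_space (strip 0 t (g k z.2)) (strip 0 t' (g' k y.2)).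
rewrite (_ : (fun k => inner P (S k) (S' k)) = fun k => \sum_z \sum_y u z y k); last first.
  by apply/funext => k; exact: SE.
apply: (cvg_sum_seq _ (u := fun z k => \sum_y u z y k)) => z.
apply: (cvg_sum_seq _ (u := u z)) => y; apply: cvgM; first exact: cvg_cst.
apply: inner_cvg.
- by move=> k; apply: strip_L2.
- by move=> k; apply: strip_L2.
- exact: strip_L2.
- exact: strip_L2.
- exact: (strip_cvg _ _ (Lg ^~ z.2)).
- exact: (strip_cvg _ _ (Lg' ^~ y.2)).
Qed.

Lemma strip_incr (t t' : R) (f : R * Omega -> R) : 0 <= t -> t <= t' ->
  strip t t' f = fun p => strip 0 t' f p - strip 0 t f p.
Proof.
move=> t0 tt'; apply/funext => p; rewrite /strip.
case: (ltP 0 p.1) => h1; case: (leP p.1 t') => h2; case: (leP p.1 t) => h3;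
  case: (ltP t p.1) => h4 /=; rewrite ?subr0 ?subrr//; exfalso; lra.
Qed.

(** The integrals over (0, t] and (0, t'] differ by the one over (t, t']. *)
Lemma martingale_increment_isometry n n' (N : 'I_q -> 'M[R]_n) (N' : 'I_q -> 'M[R]_n')
    h h' Z Z' a b t t' :
  ito_martingale P T Fl M N h Z -> ito_martingale P T Fl M N' h' Z' ->
  0 <= t -> t <= t' -> t' <= T ->
  inner P (fun w => Z a t' w - Z a t w) (fun w => Z' b t' w - Z' b t w) =
  \sum_(z : 'I_q * 'I_n) \sum_(y : 'I_q * 'I_n')
    N z.1 a z.2 * N' y.1 b y.2 * K z.1 y.1 *
    inner time_space (strip t t' (h z.2)) (strip t t' (h' y.2)).
Proof.
move=> HZ HZ' t0 tt' tT'.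
have tT : 0 <= t <= T by rewrite t0 (le_trans tt').
have tT2 : 0 <= t' <= T by rewrite tT' (le_trans t0).
have [Lh LZ _] := HZ; have [Lh' LZ' _] := HZ'.
have L1 := LZ a t tT; have L2' := LZ a t' tT2.
have L3 := LZ' b t tT; have L4 := LZ' b t' tT2.
rewrite (innerBl L2' L1 (square_integrableB L4 L3)) !innerBr//.
rewrite !(martingale_isometry _ _ HZ HZ')//.
rewrite -!sumrB; apply: eq_bigr => z _; rewrite -!sumrB; apply: eq_bigr => y _.
have S u := strip_L2 0 u (Lh z.2); have S' u := strip_L2 0 u (Lh' y.2).
rewrite !(strip_incr _ t0 tt').
have -> : inner time_space (fun p => strip 0 t' (h z.2) p - strip 0 t (h z.2) p)
    (fun p => strip 0 t' (h' y.2) p - strip 0 t (h' y.2) p) =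
   (inner time_space (strip 0 t' (h z.2)) (strip 0 t' (h' y.2)) -
    inner time_space (strip 0 t' (h z.2)) (strip 0 t (h' y.2))) -
   (inner time_space (strip 0 t (h z.2)) (strip 0 t' (h' y.2)) -
    inner time_space (strip 0 t (h z.2)) (strip 0 t (h' y.2))).
  rewrite (innerBl (S t') (S t) (square_integrableB (S' t') (S' t))).
  by rewrite (innerBr (S t') (S' t') (S' t)) (innerBr (S t) (S' t') (S' t)).
ring.
Qed.

End Martingales.

(** * Mean-square regularity of the state *)

Section Regularity.
Context (R : realType) d (Omega : measurableType d) (P : probability Omega R).
Context (T : R) (T_gt0 : 0 < T) (Fl : R -> set (set Omega)).
Hypothesis Fl_usual : usual_filtration P T Fl.
Context (q : nat) (K : 'M[R]_q) (M : R -> Omega -> 'cV[R]_q).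
Hypothesis M_levy : levy_process P T Fl K M.
Local Notation L2 := (square_integrable P).
Local Notation time_space := ((@lebesgue_measure R \x P)%E).

Context (n : nat) (A : 'M[R]_n) (N : 'I_q -> 'M[R]_n) (x0 : 'cV[R]_n).
Context (x : R -> Omega -> 'cV[R]_n) (h : 'I_n -> R * Omega -> R).
Local Notation Z := (sde_remainder A x0 x h).
Hypothesis HZ : ito_martingale P T Fl M N h Z.
Hypothesis h_left : {ae P, forall w, forall a s, 0 < s <= T ->
  x r w a 0 @[r --> s^'-] --> h a (s, w)}.

Let Lh a : square_integrable time_space (h a). Proof. by case: HZ. Qed.
Let LZ a t : 0 <= t <= T -> L2 (Z a t). Proof. by case: HZ => _ + _; apply. Qed.

Definition state a t w : R := x t w a 0.

Definition drift_increment a t t' w : R :=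
  \sum_c A a c * time_integral (h c) t t' w.

Definition noise_increment a t t' w : R := Z a t' w - Z a t w.

(** What is lost over (t, t'] when the left limits are replaced by the state
    at t. *)
Definition left_error a t t' (p : R * Omega) : R :=
  strip t t' (h a) p - strip t t' (state a t \o snd) p.

Lemma drift_increment_L2 a t t' : t <= t' -> L2 (drift_increment a t t').
Proof.
move=> tt'; apply: square_integrable_sum => c; apply: square_integrableZ.
by case: (time_integral_L2 tt' (Lh c)).
Qed.

Lemma state_L2 a t : 0 <= t <= T -> L2 (state a t).
Proof.
move=> tT; have /andP[t0 _] := tT.
have := square_integrableD (square_integrableD (LZ a tT) (cst_L2 P (x0 a 0)))
  (drift_increment_L2 a t0).
by rewrite (_ : (fun w => _) = state a t)//; apply/funext => w;
  rewrite /sde_remainder /drift_increment /state; lra.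
Qed.

Lemma noise_increment_L2 a t t' : 0 <= t <= T -> 0 <= t' <= T ->
  L2 (noise_increment a t t').
Proof. by move=> tT tT'; apply: square_integrableB; exact: LZ. Qed.

Lemma state_increment a t t' : 0 <= t -> t <= t' -> t' <= T ->
  {ae P, forall w, state a t' w - state a t w =
    drift_increment a t t' w + noise_increment a t t' w}.
Proof.
move=> t0 tt' tT'.
have H : {ae P, forall w, forall c, square_integrable lebesgue_measure
    (fun s => strip 0 t' (h c) (s, w))}.
  by apply: filter_forall => c; exact: strip_section_L2_ae.
apply: filterS H => w Lw; rewrite /noise_increment /sde_remainder /drift_increment /state.
rewrite (eq_bigr (fun c => A a c * time_integral (h c) 0 t' w - A a c * time_integral (h c) 0 t w)).
  by rewrite sumrB; lra.
by move=> c _; rewrite (time_integralD t0 tt' (Lw c)); lra.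
Qed.

Let cZ a := \sum_(z : 'I_q * 'I_n) \sum_(y : 'I_q * 'I_n)
  `|N z.1 a z.2 * N y.1 a y.2 * K z.1 y.1|.

Let cZ_ge0 a : 0 <= cZ a.
Proof. by apply: sumr_ge0 => z _; apply: sumr_ge0. Qed.

Let noise_sqr_bound a t t' B : 0 <= t -> t <= t' -> t' <= T ->
  (forall c, inner time_space (strip t t' (h c)) (strip t t' (h c)) <= B) ->
  inner P (noise_increment a t t') (noise_increment a t t') <= cZ a * B.
Proof.
move=> t0 tt' tT' hB.
rewrite (martingale_increment_isometry T_gt0 Fl_usual M_levy a a HZ HZ t0 tt' tT').
rewrite mulr_suml; apply: ler_sum => z _; rewrite mulr_suml; apply: ler_sum => y _.
apply: le_trans (ler_norm _) _; rewrite normrM ler_wpM2l//.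
have B0 : 0 <= B by exact: le_trans (inner_ge0 _ _) (hB z.2).
apply: le_trans (cauchy_schwarz _ _) _; [exact: strip_L2|exact: strip_L2|].
rewrite -[leRHS](sqr_sqrtr B0) expr2.
by apply: ler_pM; rewrite ?l2norm_ge0// ler_wsqrtr.
Qed.

Let drift_bound a t t' B : t <= t' ->
  (forall c, inner time_space (strip t t' (h c)) (strip t t' (h c)) <= B) ->
  l2norm P (drift_increment a t t') <=
    (\sum_c `|A a c|) * (Num.sqrt (t' - t) * Num.sqrt B).
Proof.
move=> tt' hB.
have Lt c : L2 (time_integral (h c) t t') by case: (time_integral_L2 tt' (Lh c)).
apply: le_trans (ler_l2norm_sum _ _) _ => [c|]; first exact: square_integrableZ.
rewrite mulr_suml; apply: ler_sum => c _; rewrite l2normZ// ler_wpM2l//.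
have [_ H] := time_integral_L2 tt' (Lh c).
rewrite /l2norm -sqrtrM ?subr_ge0// ler_wsqrtr// (le_trans H)//.
by rewrite ler_wpM2l// subr_ge0.
Qed.

Let strip_le a t t' : inner time_space (strip t t' (h a)) (strip t t' (h a)) <=
  inner time_space (h a) (h a).
Proof.
apply: ler_inner_sqr => //; first exact: strip_L2.
by move=> p; rewrite /strip; case: ifP => // _; rewrite normr0.
Qed.

(** Drift and noise are both controlled by the L2 norm of the left limits. *)
Lemma state_bounded : exists2 B, 0 <= B & forall a t, 0 <= t <= T ->
  l2norm P (state a t) <= B.
Proof.
pose E := \sum_c inner time_space (h c) (h c).
have hE c t t' : inner time_space (strip t t' (h c)) (strip t t' (h c)) <= E.
  apply: le_trans (strip_le _ _ _) _; rewrite /E (bigD1 c)//= lerDl.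
  by apply: sumr_ge0 => *; exact: inner_ge0.
have E0 : 0 <= E by apply: sumr_ge0 => *; exact: inner_ge0.
have TT : 0 <= (0 : R) <= T by rewrite lexx ltW.
pose b a := l2norm P (state a 0) + ((\sum_c `|A a c|) * (Num.sqrt T * Num.sqrt E)
   + Num.sqrt (cZ a * E)).
have b0 a : 0 <= b a.
  by rewrite !addr_ge0 ?l2norm_ge0 ?sqrtr_ge0// !mulr_ge0 ?sqrtr_ge0// sumr_ge0.
exists (\sum_a b a); first by apply: sumr_ge0 => *; exact: b0.
move=> a t tT; have /andP[t0 tT1] := tT.
apply: (@le_trans _ _ (b a)); last first.
  by rewrite (bigD1 a)//= lerDl; apply: sumr_ge0 => *; exact: b0.
have Ld := drift_increment_L2 a t0; have Ln := noise_increment_L2 a TT tT.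
have Ls := state_L2 a TT.
rewrite (_ : l2norm P (state a t) = l2norm P (fun w => state a 0 w +
   (drift_increment a 0 t w + noise_increment a 0 t w))); last first.
  congr Num.sqrt; apply: inner_ae; try (exact: state_L2);
  try (apply: square_integrableD => //; exact: square_integrableD).
  - by apply: filterS (state_increment a (lexx 0) t0 tT1) => w <-; lra.
  - by apply: filterS (state_increment a (lexx 0) t0 tT1) => w <-; lra.
apply: le_trans (ler_l2normD Ls (square_integrableD Ld Ln)) _; rewrite lerD2l.
apply: le_trans (ler_l2normD Ld Ln) _; apply: lerD.
  apply: le_trans (drift_bound a t0 (fun c => hE c 0 t)) _.
  rewrite subr0; apply: ler_wpM2l; first exact: sumr_ge0.
  by apply: ler_wpM2r; [exact: sqrtr_ge0|exact: ler_wsqrtr].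
by rewrite /l2norm ler_wsqrtr// noise_sqr_bound.
Qed.

Lemma left_sequence (t s : R) : 0 <= t -> t < s -> s <= T -> exists r : nat -> R,
  [/\ forall m, t <= r m, forall m, r m < s & r m @[m --> \oo] --> s].
Proof.
move=> t0 ts sT.
exists (fun m => s - (s - t) / m.+1%:R); split.
- move=> m; rewrite lerBrDr -lerBrDl; rewrite ler_pdivrMr ?ltr0n//.
  by rewrite ler_peMr ?ler1n// subr_ge0 ltW.
- by move=> m; rewrite ltrBlDr ltrDl divr_gt0// subr_gt0.
rewrite -[X in _ --> X]subr0 -[X in _ --> _ - X](mulr0 (s - t)).
apply: cvgB; first exact: cvg_cst.
by apply: cvgM; [exact: cvg_cst|exact: cvg_harmonic].
Qed.

Let section_measurable a s : measurable_fun setT (fun w => h a (s, w)).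
Proof.
apply: measurableT_comp; last exact: pair1_measurable.
exact: square_integrable_measurable (Lh a).
Qed.

(** Fatou, along a sequence of times increasing to s. *)
Lemma left_limit_bound a t s xi B : 0 <= t -> t < s -> s <= T -> L2 xi ->
  (forall r, t <= r -> r < s ->
    inner P (fun w => state a r w - xi w) (fun w => state a r w - xi w) <= B) ->
  L2 (fun w => h a (s, w) - xi w) /\
  inner P (fun w => h a (s, w) - xi w) (fun w => h a (s, w) - xi w) <= B.
Proof.
move=> t0 ts sT Lxi HB; have [r [tr rs rcvg]] := left_sequence t0 ts sT.
have s0 : 0 < s by exact: le_lt_trans t0 ts.
apply: (l2norm_fatou (u := fun m w => state a (r m) w - xi w)).
- by apply: measurable_funB => //; case: Lxi.
- move=> m; apply: square_integrableB => //; apply: state_L2.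
  by rewrite (le_trans t0)//= (le_trans (ltW (rs m))).
- by move=> m; apply: HB.
- apply: filterS h_left => w Hw; apply: cvgB; last exact: cvg_cst.
  have /cvg_at_leftP := Hw a s (introT andP (conj s0 sT)).
  by apply; split.
Qed.

Lemma strip_bounded B : 0 <= B ->
  (forall a t, 0 <= t <= T -> l2norm P (state a t) <= B) ->
  forall a t t', 0 <= t -> t <= t' -> t' <= T ->
  inner time_space (strip t t' (h a)) (strip t t' (h a)) <= (t' - t) * B ^+ 2.
Proof.
move=> B0 xB a t t' t0 tt' tT'; apply: strip_sqr_le => // s /andP[ts st'].
have sT := le_trans st' tT'.
have [] := @left_limit_bound a t s (fun=> 0) (B ^+ 2) t0 ts sT (square_integrable0 P).
  move=> r tr rs; under [X in inner P X _]eq_fun do rewrite subr0.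
  under [X in inner P _ X]eq_fun do rewrite subr0.
  rewrite -l2norm_sqr lerXn2r ?nnegrE ?l2norm_ge0//; apply: xB.
  by rewrite (le_trans t0)//= (le_trans (ltW rs)).
move=> L H; move: H; rewrite -lee_fin EFin_inner_sqr//.
by under eq_integral do rewrite subr0.
Qed.

Lemma left_error_L2 a t t' : 0 <= t <= T -> square_integrable time_space (left_error a t t').
Proof.
move=> tT; apply: square_integrableB; first exact: strip_L2.
by apply: strip_snd_L2; exact: state_L2.
Qed.

(** In mean square the drift is Lipschitz and the noise 1/2-Hoelder in time; the
    last estimate integrates the resulting 1/2-Hoelder bound on the left limits
    over (t, t']. *)
Lemma state_regular : exists2 B, 0 <= B & forall a,
  (forall t, 0 <= t <= T -> l2norm P (state a t) <= B) /\
  (forall t t', 0 <= t -> t <= t' -> t' <= T ->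
   [/\ l2norm P (drift_increment a t t') <= B * (t' - t),
       l2norm P (noise_increment a t t') <= B * Num.sqrt (t' - t),
       l2norm P (fun w => drift_increment a t t' w + noise_increment a t t' w)
         <= B * Num.sqrt (t' - t) &
       l2norm time_space (left_error a t t') <= B * (t' - t)]).
Proof.
have [B0 B00 xB] := state_bounded.
pose bd := (\sum_a \sum_c `|A a c|) * B0.
pose bn := Num.sqrt (\sum_a cZ a) * B0.
pose bx := bd * Num.sqrt T + bn.
have bd0 : 0 <= bd by rewrite mulr_ge0// sumr_ge0// => *; rewrite sumr_ge0.
have bn0 : 0 <= bn by rewrite mulr_ge0// sqrtr_ge0.
have bdT0 : 0 <= bd * Num.sqrt T by rewrite mulr_ge0// sqrtr_ge0.
have hd a t t' : 0 <= t -> t <= t' -> t' <= T ->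
    l2norm P (drift_increment a t t') <= bd * (t' - t).
  move=> t0 tt' tT'; have dt0 : 0 <= t' - t by rewrite subr_ge0.
  apply: le_trans (drift_bound a tt' (fun c => strip_bounded B00 xB c t0 tt' tT')) _.
  rewrite sqrtrM// sqrtr_sqr ger0_norm// mulrA -expr2 sqr_sqrtr// /bd.
  rewrite -mulrA (mulrC B0); apply: ler_wpM2r; first by rewrite mulr_ge0.
  by rewrite [leRHS](bigD1 a)//= lerDl sumr_ge0// => *; rewrite sumr_ge0.
have hn a t t' : 0 <= t -> t <= t' -> t' <= T ->
    l2norm P (noise_increment a t t') <= bn * Num.sqrt (t' - t).
  move=> t0 tt' tT'; have dt0 : 0 <= t' - t by rewrite subr_ge0.
  apply: (@le_trans _ _ (Num.sqrt (cZ a * ((t' - t) * B0 ^+ 2)))).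
    rewrite ler_wsqrtr//; apply: noise_sqr_bound => // c; exact: strip_bounded.
  rewrite sqrtrM// sqrtrM// sqrtr_sqr ger0_norm// /bn (mulrC (Num.sqrt (t' - t))) mulrA.
  apply: ler_wpM2r; first exact: sqrtr_ge0.
  apply: ler_wpM2r => //; rewrite ler_wsqrtr// (bigD1 a)//= lerDl sumr_ge0//.
have hx a t t' : 0 <= t -> t <= t' -> t' <= T ->
    l2norm P (fun w => drift_increment a t t' w + noise_increment a t t' w)
         <= bx * Num.sqrt (t' - t).
  move=> t0 tt' tT'; have dt0 : 0 <= t' - t by rewrite subr_ge0.
  have tT : 0 <= t <= T by rewrite t0 (le_trans tt').
  have tT2 : 0 <= t' <= T by rewrite tT' (le_trans t0).
  apply: le_trans (ler_l2normD (drift_increment_L2 a tt') (noise_increment_L2 a tT tT2)) _.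
  rewrite /bx mulrDl; apply: lerD; last exact: hn.
  apply: le_trans (hd a t t' t0 tt' tT') _.
  rewrite -mulrA ler_wpM2l// -[leLHS]sqr_sqrtr// expr2 ler_wpM2r ?sqrtr_ge0//.
  by rewrite ler_wsqrtr//; lra.
have he a t t' : 0 <= t -> t <= t' -> t' <= T ->
    l2norm time_space (left_error a t t') <= bx * (t' - t).
  move=> t0 tt' tT'; have dt0 : 0 <= t' - t by rewrite subr_ge0.
  have tT : 0 <= t <= T by rewrite t0 (le_trans tt').
  have bx0 : 0 <= bx by rewrite addr_ge0.
  have Le := left_error_L2 a t' tT.
  have eE : left_error a t t' = strip t t' (left_error a t t').
    by apply/funext => p; rewrite /left_error /strip; case: ifP => //; rewrite subrr.
  suff : inner time_space (left_error a t t') (left_error a t t') <=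
      (t' - t) * (bx ^+ 2 * (t' - t)).
    move=> H; rewrite /l2norm -[leRHS]ger0_norm ?mulr_ge0// -sqrtr_sqr ler_wsqrtr//.
    by rewrite (le_trans H)// le_eqVlt; apply/orP; left; apply/eqP; ring.
  rewrite eE; apply: strip_sqr_le => // s sE; have /andP[ts st'] := sE.
  have sT := le_trans st' tT'.
  have [] := @left_limit_bound a t s (state a t) (bx ^+ 2 * (t' - t)) t0 ts sT (state_L2 a tT).
    move=> r tr rs; have rt' := le_trans (ltW rs) st'; have rT := le_trans rt' tT'.
    have rT2 : 0 <= r <= T by rewrite (le_trans t0).
    have -> : inner P (fun w => state a r w - state a t w) (fun w => state a r w - state a t w) =
        inner P (fun w => drift_increment a t r w + noise_increment a t r w)
          (fun w => drift_increment a t r w + noise_increment a t r w).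
      apply: inner_ae; try (exact: (state_increment a t0 tr rT)).
      - by apply: square_integrableB; exact: state_L2.
      - by apply: square_integrableD; [exact: drift_increment_L2|exact: noise_increment_L2].
      - by apply: square_integrableB; exact: state_L2.
      - by apply: square_integrableD; [exact: drift_increment_L2|exact: noise_increment_L2].
    have H := hx a t r t0 tr rT.
    rewrite -l2norm_sqr; apply: (le_trans (lerXn2r 2 _ _ H)); rewrite ?nnegrE ?l2norm_ge0//.
      by rewrite mulr_ge0// sqrtr_ge0.
    rewrite exprMn sqr_sqrtr ?subr_ge0// ler_wpM2l ?sqr_ge0//; lra.
  move=> L; rewrite -lee_fin EFin_inner_sqr//.
  apply: le_trans; rewrite le_eqVlt; apply/orP; left; apply/eqP; apply: eq_integral => w _.
  by rewrite /left_error /strip /= sE.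
exists (B0 + bd + bn + bx); first by rewrite !addr_ge0.
have bx0 : 0 <= bx by rewrite addr_ge0.
have up b c : 0 <= c -> b <= B0 + bd + bn + bx -> b * c <= (B0 + bd + bn + bx) * c.
  by move=> c0 bb; rewrite ler_wpM2r.
move=> a; split.
  by move=> t tT; apply: le_trans (xB a t tT) _; lra.
move=> t t' t0 tt' tT'; have dt0 : 0 <= t' - t by rewrite subr_ge0.
split.
- by apply: le_trans (hd a t t' t0 tt' tT') _; apply: up => //; lra.
- by apply: le_trans (hn a t t' t0 tt' tT') _; apply: up; [exact: sqrtr_ge0|lra].
- by apply: le_trans (hx a t t' t0 tt' tT') _; apply: up; [exact: sqrtr_ge0|lra].
- by apply: le_trans (he a t t' t0 tt' tT') _; apply: up => //; lra.
Qed.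

End Regularity.

(** * The equation for the covariance of two solutions *)

Section Small.
Context (R : realType) (T : R).
Implicit Types f g : R -> R -> R.

(** Errors of order 3/2 in the time step, the order of the product of a drift
    increment and a noise increment; negligible when summed over a fine mesh. *)
Definition small_increment f := exists C, forall t t', 0 <= t -> t <= t' -> t' <= T ->
  `|f t t'| <= C * ((t' - t) * Num.sqrt (t' - t)).

Lemma small_incrementD f g : small_increment f -> small_increment g ->
  small_increment (fun t t' => f t t' + g t t').
Proof.
move=> [C fC] [C' gC]; exists (C + C') => t t' t0 tt' tT'.
by rewrite (le_trans (ler_normD _ _))// mulrDl lerD ?fC ?gC.
Qed.

Lemma small_incrementZ c f : small_increment f ->
  small_increment (fun t t' => c * f t t').
Proof.
move=> [C fC]; exists (`|c| * C) => t t' t0 tt' tT'.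
by rewrite normrM -mulrA ler_wpM2l// fC.
Qed.

Lemma small_increment_sum (I : Type) (s : seq I) (f : I -> R -> R -> R) :
  (forall i, small_increment (f i)) ->
  small_increment (fun t t' => \sum_(i <- s) f i t t').
Proof.
move=> fs; elim: s => [|i s IH].
  exists 0 => t t' _ _ _; by rewrite big_nil normr0 mul0r.
have [C H] := small_incrementD (fs i) IH; exists C => t t' t0 tt' tT'.
by rewrite big_cons; exact: H.
Qed.

Lemma eq_small_increment f g : (forall t t', 0 <= t -> t <= t' -> t' <= T ->
  f t t' = g t t') -> small_increment f -> small_increment g.
Proof. by move=> fg [C fC]; exists C => t t' *; rewrite -fg// fC. Qed.

Lemma small_increment_le f C :
  (forall t t', 0 <= t -> t <= t' -> t' <= T ->
   `|f t t'| <= C * ((t' - t) * Num.sqrt (t' - t))) -> small_increment f.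
Proof. by exists C. Qed.

Lemma sqr_le_small (t t' : R) : 0 <= t -> t <= t' -> t' <= T ->
  (t' - t) * (t' - t) <= Num.sqrt T * ((t' - t) * Num.sqrt (t' - t)).
Proof.
move=> t0 tt' tT'; have dt0 : 0 <= t' - t by rewrite subr_ge0.
rewrite mulrCA ler_wpM2l// -{1}(sqr_sqrtr dt0) expr2 ler_wpM2r ?sqrtr_ge0//.
by rewrite ler_wsqrtr//; lra.
Qed.

End Small.

Section Covariance.
Context (R : realType) d (Omega : measurableType d) (P : probability Omega R).
Context (T : R) (T_gt0 : 0 < T) (Fl : R -> set (set Omega)).
Hypothesis Fl_usual : usual_filtration P T Fl.
Context (q : nat) (K : 'M[R]_q) (M : R -> Omega -> 'cV[R]_q).
Hypothesis M_levy : levy_process P T Fl K M.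
Local Notation L2 := (square_integrable P).
Local Notation time_space := ((@lebesgue_measure R \x P)%E).

Context (n : nat) (A : 'M[R]_n) (N : 'I_q -> 'M[R]_n) (x0 : 'cV[R]_n).
Context (x : R -> Omega -> 'cV[R]_n) (h : 'I_n -> R * Omega -> R).
Hypothesis HZ : ito_martingale P T Fl M N h (sde_remainder A x0 x h).
Hypothesis h_left : {ae P, forall w, forall a s, 0 < s <= T ->
  x r w a 0 @[r --> s^'-] --> h a (s, w)}.

Context (n' : nat) (A' : 'M[R]_n') (N' : 'I_q -> 'M[R]_n') (x0' : 'cV[R]_n').
Context (x' : R -> Omega -> 'cV[R]_n') (h' : 'I_n' -> R * Omega -> R).
Hypothesis HZ' : ito_martingale P T Fl M N' h' (sde_remainder A' x0' x' h').
Hypothesis h'_left : {ae P, forall w, forall a s, 0 < s <= T ->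
  x' r w a 0 @[r --> s^'-] --> h' a (s, w)}.
Hypothesis ax' : adapted T Fl x'.

Let Lh a : square_integrable time_space (h a). Proof. by case: HZ. Qed.
Let Lh' a : square_integrable time_space (h' a). Proof. by case: HZ'. Qed.

Definition covariance_mx t : 'M[R]_(n, n') :=
  \matrix_(a, b) inner P (state x a t) (state x' b t).

Local Notation y := (state x).
Local Notation y' := (state x').
Local Notation D := (drift_increment A h).
Local Notation D' := (drift_increment A' h').
Local Notation W := (noise_increment A x0 x h).
Local Notation W' := (noise_increment A' x0' x' h').

Let Ly a t : 0 <= t <= T -> L2 (y a t). Proof. exact: state_L2 HZ _ _. Qed.
Let Ly' a t : 0 <= t <= T -> L2 (y' a t). Proof. exact: state_L2 HZ' _ _. Qed.

Let strip_y_norm m (z : 'I_m -> R -> Omega -> R) a t t' B : t <= t' -> L2 (z a t) ->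
  l2norm P (z a t) <= B ->
  l2norm time_space (strip t t' (z a t \o snd)) <= B * Num.sqrt (t' - t).
Proof.
move=> tt' Lz zB; rewrite {1}/l2norm inner_strip_snd// /overlap minxx maxxx max_r ?subr_ge0//.
by rewrite sqrtrM ?subr_ge0// mulrC ler_wpM2r// sqrtr_ge0.
Qed.

(** Over (t, t'] the left limit may be frozen at the state of time t, at the price
    of [left_error]. *)
Lemma inner_strip_left a b : small_increment T (fun t t' =>
  inner time_space (strip t t' (h a)) (strip t t' (y' b t \o snd)) -
  (t' - t) * covariance_mx t a b).
Proof.
have [B B0 HB] := state_regular T_gt0 Fl_usual M_levy HZ h_left.
have [B' B0' HB'] := state_regular T_gt0 Fl_usual M_levy HZ' h'_left.
apply: (@small_increment_le _ _ _ (B * B')) => t t' t0 tt' tT'.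
have tT : 0 <= t <= T by rewrite t0 (le_trans tt').
have dt0 : 0 <= t' - t by rewrite subr_ge0.
have Le := left_error_L2 HZ a t' tT.
have Ls := strip_snd_L2 t t' (Ly a tT).
have Ls' := strip_snd_L2 t t' (Ly' b tT).
have -> : strip t t' (h a) = fun p => strip t t' (y a t \o snd) p + left_error x h a t t' p.
  by apply/funext => p; rewrite /left_error; lra.
rewrite (innerDl Ls Le Ls') inner_strip_snd; [|exact: Ly|exact: Ly'].
rewrite /overlap minxx maxxx max_r// mxE addrC addKr.
apply: le_trans (cauchy_schwarz Le Ls') _.
have [_ /(_ t t' t0 tt' tT')[_ _ _ e]] := HB a.
have [/(_ t tT) f _] := HB' b.
apply: le_trans (ler_pM (l2norm_ge0 _ _) (l2norm_ge0 _ _) e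
  (strip_y_norm tt' (Ly' b tT) f)) _.
by rewrite le_eqVlt; apply/orP; left; apply/eqP; ring.
Qed.

Lemma inner_strip_left_left a b : small_increment T (fun t t' =>
  inner time_space (strip t t' (h a)) (strip t t' (h' b)) -
  (t' - t) * covariance_mx t a b).
Proof.
have [B B0 HB] := state_regular T_gt0 Fl_usual M_levy HZ h_left.
have [B' B0' HB'] := state_regular T_gt0 Fl_usual M_levy HZ' h'_left.
apply: (eq_small_increment (f := fun t t' =>
  (inner time_space (strip t t' (h a)) (strip t t' (y' b t \o snd)) -
   (t' - t) * covariance_mx t a b) +
  inner time_space (strip t t' (h a)) (left_error x' h' b t t'))).
  move=> t t' t0 tt' tT'; have tT : 0 <= t <= T by rewrite t0 (le_trans tt').
  have -> : strip t t' (h' b) =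
      fun p => strip t t' (y' b t \o snd) p + left_error x' h' b t t' p.
    by apply/funext => p; rewrite /left_error; lra.
  rewrite (innerDr (strip_L2 t t' (Lh a)) (strip_snd_L2 t t' (Ly' b tT))
    (left_error_L2 HZ' b t' tT)).
  by lra.
apply: small_incrementD; first exact: inner_strip_left.
apply: (@small_increment_le _ _ _ (B * B')) => t t' t0 tt' tT'.
have tT : 0 <= t <= T by rewrite t0 (le_trans tt').
have dt0 : 0 <= t' - t by rewrite subr_ge0.
have Le := left_error_L2 HZ' b t' tT.
apply: le_trans (cauchy_schwarz (strip_L2 t t' (Lh a)) Le) _.
have [_ /(_ t t' t0 tt' tT')[_ _ _ e]] := HB' b.
have f : l2norm time_space (strip t t' (h a)) <= B * Num.sqrt (t' - t).
  have := strip_bounded HZ h_left B0 (fun a => (HB a).1) a t0 tt' tT'.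
  move=> /ler_wsqrtr; rewrite sqrtrM// sqrtr_sqr ger0_norm// mulrC.
  by [].
apply: le_trans (ler_pM (l2norm_ge0 _ _) (l2norm_ge0 _ _) f e) _.
by rewrite le_eqVlt; apply/orP; left; apply/eqP; ring.
Qed.

(** The noise increment is orthogonal to the state at time t, so that only the
    drift contributes. *)
Lemma inner_drift_state a b : small_increment T (fun t t' =>
  inner P (fun w => D a t t' w + W a t t' w) (y' b t) -
  (t' - t) * \sum_c A a c * covariance_mx t c b).
Proof.
apply: (eq_small_increment (f := fun t t' => \sum_c A a c *
  (inner time_space (strip t t' (h c)) (strip t t' (y' b t \o snd)) -
   (t' - t) * covariance_mx t c b))); last first.
  by apply: small_increment_sum => c; apply: small_incrementZ; exact: inner_strip_left.
move=> t t' t0 tt' tT'.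
have tT : 0 <= t <= T by rewrite t0 (le_trans tt').
have tT2 : 0 <= t' <= T by rewrite tT' (le_trans t0).
have my' : measurable_wrt (Fl t) (y' b t) by move=> B mB; exact: ax'.
have LD := drift_increment_L2 HZ a tt'.
have LW := noise_increment_L2 HZ a tT tT2.
have Ly'b := Ly' b tT.
have Lt c : L2 (time_integral (h c) t t') by case: (time_integral_L2 tt' (Lh c)).
rewrite (innerDl LD LW Ly'b) (innerC P (W a t t')).
rewrite (martingale_orthogonal Fl_usual M_levy a HZ t0 tt' tT' Ly'b my') addr0.
rewrite inner_suml//; last by move=> c; exact: square_integrableZ.
rewrite mulr_sumr -sumrB; apply: eq_bigr => c _.
by rewrite innerZl// (time_integral_inner tt' (Lh c) Ly'b); lra.
Qed.

(** The isometry gives the product of the two noise increments; every product that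
    involves a drift increment is of higher order. *)
Lemma inner_increments a b : small_increment T (fun t t' =>
  inner P (fun w => D a t t' w + W a t t' w) (fun w => D' b t t' w + W' b t t' w) -
  (t' - t) * \sum_(z : 'I_q * 'I_n) \sum_(y : 'I_q * 'I_n')
    N z.1 a z.2 * N' y.1 b y.2 * K z.1 y.1 * covariance_mx t z.2 y.2).
Proof.
have [B B0 HB] := state_regular T_gt0 Fl_usual M_levy HZ h_left.
have [B' B0' HB'] := state_regular T_gt0 Fl_usual M_levy HZ' h'_left.
apply: (eq_small_increment (f := fun t t' =>
  (\sum_(z : 'I_q * 'I_n) \sum_(y : 'I_q * 'I_n')
    (N z.1 a z.2 * N' y.1 b y.2 * K z.1 y.1) *
    (inner time_space (strip t t' (h z.2)) (strip t t' (h' y.2)) -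
     (t' - t) * covariance_mx t z.2 y.2)) +
  (inner P (D a t t') (fun w => D' b t t' w + W' b t t' w) +
   inner P (W a t t') (D' b t t')))).
  move=> t t' t0 tt' tT'.
  have tT : 0 <= t <= T by rewrite t0 (le_trans tt').
  have tT2 : 0 <= t' <= T by rewrite tT' (le_trans t0).
  have LD := drift_increment_L2 HZ a tt'.
  have LW := noise_increment_L2 HZ a tT tT2.
  have LD' := drift_increment_L2 HZ' b tt'.
  have LW' := noise_increment_L2 HZ' b tT tT2.
  rewrite (innerDl LD LW (square_integrableD LD' LW')) (innerDr LW LD' LW').
  rewrite (martingale_increment_isometry T_gt0 Fl_usual M_levy a b HZ HZ' t0 tt' tT').
  set S1 := \sum_(z : 'I_q * 'I_n) \sum_(y : 'I_q * 'I_n') _ * (_ - _).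
  set S2 := \sum_(z : 'I_q * 'I_n) \sum_(y : 'I_q * 'I_n') _ * inner _ _ _.
  set S3 := \sum_(z : 'I_q * 'I_n) \sum_(y : 'I_q * 'I_n') _ * covariance_mx _ _ _.
  suff -> : S1 = S2 - (t' - t) * S3 by lra.
  rewrite /S1 /S2 /S3 mulr_sumr -sumrB; apply: eq_bigr => z _.
  by rewrite mulr_sumr -sumrB; apply: eq_bigr => w _; rewrite mulrBr (mulrCA (t' - t)).
apply: small_incrementD.
  apply: small_increment_sum => z; apply: small_increment_sum => w.
  by apply: small_incrementZ; exact: inner_strip_left_left.
apply: (@small_increment_le _ _ _ (2 * (B * B'))) => t t' t0 tt' tT'.
have tT : 0 <= t <= T by rewrite t0 (le_trans tt').
have tT2 : 0 <= t' <= T by rewrite tT' (le_trans t0).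
have LD := drift_increment_L2 HZ a tt'.
have LW := noise_increment_L2 HZ a tT tT2.
have LD' := drift_increment_L2 HZ' b tt'.
have LW' := noise_increment_L2 HZ' b tT tT2.
have [_ /(_ t t' t0 tt' tT')[d1 n1 x1 _]] := HB a.
have [_ /(_ t t' t0 tt' tT')[d2 n2 x2 _]] := HB' b.
apply: le_trans (ler_normD _ _) _.
have -> : 2 * (B * B') * ((t' - t) * Num.sqrt (t' - t)) =
  (B * (t' - t)) * (B' * Num.sqrt (t' - t)) + (B * Num.sqrt (t' - t)) * (B' * (t' - t)).
  by ring.
apply: lerD.
  apply: le_trans (cauchy_schwarz LD (square_integrableD LD' LW')) _.
  by apply: ler_pM => //; exact: l2norm_ge0.
apply: le_trans (cauchy_schwarz LW LD') _.
by apply: ler_pM => //; exact: l2norm_ge0.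
Qed.

Lemma inner_state_increment a b t t' : 0 <= t -> t <= t' -> t' <= T ->
  covariance_mx t' a b - covariance_mx t a b =
  inner P (fun w => D a t t' w + W a t t' w) (y' b t) +
  inner P (y a t) (fun w => D' b t t' w + W' b t t' w) +
  inner P (fun w => D a t t' w + W a t t' w) (fun w => D' b t t' w + W' b t t' w).
Proof.
move=> t0 tt' tT'.
have tT : 0 <= t <= T by rewrite t0 (le_trans tt').
have tT2 : 0 <= t' <= T by rewrite tT' (le_trans t0).
have LX := square_integrableD (drift_increment_L2 HZ a tt') (noise_increment_L2 HZ a tT tT2).
have LX' := square_integrableD (drift_increment_L2 HZ' b tt') (noise_increment_L2 HZ' b tT tT2).
have Lya := Ly a tT; have Lyb := Ly' b tT.
rewrite !mxE.
have -> : inner P (y a t') (y' b t') = inner P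
    (fun w => y a t w + (D a t t' w + W a t t' w))
    (fun w => y' b t w + (D' b t t' w + W' b t t' w)).
  apply: inner_ae; [exact: Ly|exact: square_integrableD|exact: Ly'|exact: square_integrableD|..].
  - by apply: filterS (state_increment HZ a t0 tt' tT') => w <-; lra.
  - by apply: filterS (state_increment HZ' b t0 tt' tT') => w <-; lra.
rewrite (innerDl Lya LX (square_integrableD Lyb LX')).
rewrite (innerDr Lya Lyb LX') (innerDr LX Lyb LX'); lra.
Qed.

End Covariance.

(** An integrated form of F' = L(F) that asks for no differentiability. It holds for
    covariances as well as for classical solutions, and implies positivity. *)
Definition increment_ode (R : realType) (T : R) n m (L : 'M[R]_(n, m) -> 'M[R]_(n, m))
    (F : R -> 'M[R]_(n, m)) :=
  forall a b, small_increment T (fun t t' =>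
    (F t' a b - F t a b) - (t' - t) * L (F t) a b).

Lemma lyap_opE (R : realType) n m q (K : 'M[R]_q) (A : 'M[R]_n) N (B : 'M[R]_m) N' X a b :
  lyap_op K A N B N' X a b = \sum_c A a c * X c b + \sum_c B b c * X a c +
   \sum_(z : 'I_q * 'I_n) \sum_(y : 'I_q * 'I_m)
    N z.1 a z.2 * N' y.1 b y.2 * K z.1 y.1 * X z.2 y.2.
Proof.
rewrite /lyap_op !mxE; congr (_ + _ + _).
  by apply: eq_bigr => c _; rewrite mxE mulrC.
rewrite summxE -(pair_bigA _ (fun i c => \sum_(y : 'I_q * 'I_m)
  N i a c * N' y.1 b y.2 * K i y.1 * X c y.2))/=.
apply: eq_bigr => i _; rewrite summxE.
transitivity (\sum_j \sum_c \sum_e N i a c * N' j b e * K i j * X c e); last first.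
  rewrite exchange_big/=; apply: eq_bigr => c _.
  by rewrite -(pair_bigA _ (fun j e => N i a c * N' j b e * K i j * X c e)).
apply: eq_bigr => j _; rewrite !mxE mulr_sumr exchange_big/=.
apply: eq_bigr => e _; rewrite !mxE mulrA mulr_sumr mulr_suml; apply: eq_bigr => c _.
ring.
Qed.

Section CovarianceOde.
Context (R : realType) d (Omega : measurableType d) (P : probability Omega R).
Context (T : R) (T_gt0 : 0 < T) (Fl : R -> set (set Omega)).
Hypothesis Fl_usual : usual_filtration P T Fl.
Context (q : nat) (K : 'M[R]_q) (M : R -> Omega -> 'cV[R]_q).
Hypothesis M_levy : levy_process P T Fl K M.

(** The product rule: each of the two drifts contributes one term of L, and the
    noise contributes the double sum. *)
Lemma covariance_increment_ode n n' (A : 'M[R]_n) N x0 x h (A' : 'M[R]_n') N' x0' x' h' :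
  ito_martingale P T Fl M N h (sde_remainder A x0 x h) ->
  {ae P, forall w, forall a s, 0 < s <= T -> x r w a 0 @[r --> s^'-] --> h a (s, w)} ->
  adapted T Fl x ->
  ito_martingale P T Fl M N' h' (sde_remainder A' x0' x' h') ->
  {ae P, forall w, forall a s, 0 < s <= T -> x' r w a 0 @[r --> s^'-] --> h' a (s, w)} ->
  adapted T Fl x' ->
  increment_ode T (lyap_op K A N A' N') (covariance_mx P x x').
Proof.
move=> HZ hl ax HZ' hl' ax' a b.
have H1 := inner_drift_state T_gt0 Fl_usual M_levy HZ hl HZ' hl' ax' a b.
have H2 := inner_drift_state T_gt0 Fl_usual M_levy HZ' hl' HZ hl ax b a.
have H3 := inner_increments T_gt0 Fl_usual M_levy HZ hl HZ' hl' a b.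
apply: eq_small_increment (small_incrementD (small_incrementD H1 H2) H3).
move=> t t' t0 tt' tT'.
rewrite (inner_state_increment HZ HZ' a b t0 tt' tT') lyap_opE.
rewrite (innerC P (state x a t)).
rewrite (eq_bigr (fun c => A' b c * covariance_mx P x x' t a c)); last first.
  by move=> c _; rewrite !mxE innerC.
lra.
Qed.

End CovarianceOde.

(** * Positivity of the Lyapunov flow *)

Section QuadraticForms.
Context (R : realType).

Definition qform m n (X : 'M[R]_(m, n)) (u : 'cV[R]_m) (v : 'cV[R]_n) : R :=
  (u^T *m X *m v) 0 0.

Lemma qformE m n (X : 'M[R]_(m, n)) u v :
  qform X u v = \sum_(z : 'I_m * 'I_n) X z.1 z.2 * (u z.1 0 * v z.2 0).
Proof.
rewrite /qform mxE -(pair_bigA _ (fun a b => X a b * (u a 0 * v b 0)))/= exchange_big.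
apply: eq_bigr => b _; rewrite mxE mulr_suml; apply: eq_bigr => a _.
by rewrite mxE; ring.
Qed.

Lemma qformD m n (X Y : 'M[R]_(m, n)) u v : qform (X + Y) u v = qform X u v + qform Y u v.
Proof. by rewrite /qform mulmxDr mulmxDl mxE. Qed.

Lemma qformZ m n c (X : 'M[R]_(m, n)) u v : qform (c *: X) u v = c * qform X u v.
Proof. by rewrite /qform -scalemxAr -scalemxAl mxE. Qed.

Lemma qform_sum m n (I : Type) (s : seq I) (X : I -> 'M[R]_(m, n)) u v :
  qform (\sum_(i <- s) X i) u v = \sum_(i <- s) qform (X i) u v.
Proof.
elim: s => [|i s IH]; first by rewrite !big_nil /qform mulmx0 mul0mx mxE.
by rewrite !big_cons qformD IH.
Qed.

Lemma qformDl m n (X : 'M[R]_(m, n)) u u' v : qform X (u + u') v = qform X u v + qform X u' v.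
Proof. by rewrite /qform linearD/= !mulmxDl mxE. Qed.

Lemma qformDr m n (X : 'M[R]_(m, n)) u v v' : qform X u (v + v') = qform X u v + qform X u v'.
Proof. by rewrite /qform mulmxDr mxE. Qed.

Lemma qformZl m n (X : 'M[R]_(m, n)) c u v : qform X (c *: u) v = c * qform X u v.
Proof. by rewrite /qform linearZ/= -!scalemxAl mxE. Qed.

Lemma qformZr m n (X : 'M[R]_(m, n)) c u v : qform X u (c *: v) = c * qform X u v.
Proof. by rewrite /qform -scalemxAr mxE. Qed.

Lemma qform_mull m n k (B : 'M[R]_(k, m)) (X : 'M[R]_(m, n)) u v :
  qform (B *m X) u v = qform X (B^T *m u) v.
Proof. by rewrite /qform trmx_mul trmxK !mulmxA. Qed.

Lemma qform_mulr m n k (X : 'M[R]_(m, n)) (B : 'M[R]_(k, n)) u v :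
  qform (X *m B^T) u v = qform X u (B^T *m v).
Proof. by rewrite /qform !mulmxA. Qed.

Definition sqnorm n (v : 'cV[R]_n) : R := \sum_a v a 0 ^+ 2.

Lemma sqnorm_ge0 n (v : 'cV[R]_n) : 0 <= sqnorm v.
Proof. by apply: sumr_ge0 => a _; exact: sqr_ge0. Qed.

Lemma qform1 n (v : 'cV[R]_n) : qform 1%:M v v = sqnorm v.
Proof.
rewrite /qform mulmx1 mxE; apply: eq_bigr => a _; rewrite mxE; ring.
Qed.

Lemma qform1_mul k l m (B : 'M[R]_(k, m)) (C : 'M[R]_(l, m)) u v :
  qform 1%:M (B^T *m u) (C^T *m v) = qform (B *m C^T) u v.
Proof. by rewrite /qform trmx_mul trmxK mulmx1 !mulmxA. Qed.

Lemma qform1_mull m n (B : 'M[R]_(m, n)) u v :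
  qform 1%:M (B^T *m u) v = qform B u v.
Proof. by rewrite /qform trmx_mul trmxK mulmx1. Qed.

Lemma qform1_mulr m n (B : 'M[R]_(m, n)) u v :
  qform 1%:M u (B *m v) = qform B u v.
Proof. by rewrite /qform mulmx1 mulmxA. Qed.

Definition mxsum m n (X : 'M[R]_(m, n)) : R := \sum_(z : 'I_m * 'I_n) `|X z.1 z.2|.

Lemma mxsum_ge0 m n (X : 'M[R]_(m, n)) : 0 <= mxsum X.
Proof. exact: sumr_ge0. Qed.

Lemma qform_bound n (X : 'M[R]_n) v : `|qform X v v| <= mxsum X * sqnorm v.
Proof.
rewrite qformE; apply: le_trans (ler_norm_sum _ _ _) _.
rewrite mulr_suml; apply: ler_sum => -[a b] _ /=; rewrite normrM ler_wpM2l//.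
have le c : v c 0 ^+ 2 <= sqnorm v.
  by rewrite /sqnorm (bigD1 c)//= lerDl; apply: sumr_ge0 => *; exact: sqr_ge0.
have := le a; have := le b; move: (v a 0) (v b 0) => x y h1 h2.
have h3 := sqr_ge0 (x + y); have h4 := sqr_ge0 (x - y).
by rewrite ler_norml; apply/andP; split; nra.
Qed.

Definition psd n (X : 'M[R]_n) := forall v, 0 <= qform X v v.

(** Positive semidefiniteness of [K] in the form in which it makes the noise term of
    the Lyapunov operator a positive map. *)
Definition cov_positive q (K : 'M[R]_q) := forall n (X : 'M[R]_n) (u : 'I_q -> 'cV[R]_n),
  psd X -> 0 <= \sum_i \sum_j K i j * qform X (u i) (u j).

End QuadraticForms.

Section Positivity.
Context (R : realType) (T : R) (n q : nat) (K : 'M[R]_q) (A : 'M[R]_n) (N : 'I_q -> 'M[R]_n).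
Hypothesis T_gt0 : 0 < T.
Hypothesis K_pos : cov_positive K.
Local Notation L := (lyap_op K A N A N).

Lemma qform_lyap X v : qform (L X) v v = qform X (A^T *m v) v + qform X v (A^T *m v)
  + \sum_i \sum_j K i j * qform X ((N i)^T *m v) ((N j)^T *m v).
Proof.
rewrite /lyap_op !qformD qform_mull qform_mulr; congr (_ + _).
rewrite qform_sum; apply: eq_bigr => i _; rewrite qform_sum; apply: eq_bigr => j _.
by rewrite qformZ qform_mulr qform_mull.
Qed.

Lemma increment_ode_bounded (F : R -> 'M[R]_n) : increment_ode T L F ->
  exists2 B, 0 <= B & forall t, 0 <= t <= T -> mxsum (F t) <= B.
Proof.
move=> FL.
have /choice[C CP] : forall z : 'I_n * 'I_n, exists C, forall t, 0 <= t <= T ->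
    `|F t z.1 z.2| <= C.
  move=> [a b] /=; have [C H] := FL a b.
  exists (`|F 0 a b| + (T * `|L (F 0) a b| + `|C| * (T * Num.sqrt T))) => t /andP[t0 tT].
  have := H 0 t (lexx 0) t0 tT; rewrite subr0 => {}H.
  have E : F t a b = F 0 a b + (t * L (F 0) a b + (F t a b - F 0 a b - t * L (F 0) a b)) by lra.
  rewrite E (le_trans (ler_normD _ _))// lerD2l (le_trans (ler_normD _ _))// lerD//.
    by rewrite normrM ger0_norm// ler_wpM2r.
  apply: le_trans H _; apply: (@le_trans _ _ (`|C| * (t * Num.sqrt t))).
    by rewrite ler_wpM2r ?mulr_ge0 ?sqrtr_ge0// ler_norm.
  by rewrite ler_wpM2l// ler_pM ?sqrtr_ge0// ler_wsqrtr.
exists (\sum_z `|C z|); first exact: sumr_ge0.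
move=> t tT; apply: ler_sum => z _; apply: le_trans (CP z t tT) (ler_norm _).
Qed.

Let cN := \sum_i \sum_j `|K i j| * mxsum ((N i) *m (N j)^T).
Let cA := mxsum A + mxsum A^T + T * mxsum (A *m A^T).

Let lower (e : R) (X : 'M[R]_n) := forall v, - (e * sqnorm v) <= qform X v v.

(** A lower bound -e means that X + e 1 is positive semidefinite, and so is its
    image under the noise term; the image of e 1 is at most e cN. *)
Let lower_noise e X v : lower e X -> 0 <= e ->
  - (e * cN * sqnorm v) <= \sum_i \sum_j K i j * qform X ((N i)^T *m v) ((N j)^T *m v).
Proof.
move=> eX e0.
have pX : psd (X + e *: 1%:M).
  by move=> w; rewrite qformD qformZ qform1; have := eX w; lra.
have := K_pos (fun i => (N i)^T *m v) pX.
rewrite (eq_bigr (fun i => (\sum_j K i j * qform X ((N i)^T *m v) ((N j)^T *m v)) +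
   e * \sum_j K i j * qform (N i *m (N j)^T) v v)); last first.
  move=> i _; rewrite mulr_sumr -big_split/=; apply: eq_bigr => j _.
  by rewrite qformD qformZ qform1_mul; ring.
rewrite big_split/= -mulr_sumr => H.
suff H2 : \sum_i \sum_j K i j * qform (N i *m (N j)^T) v v <= cN * sqnorm v.
  have := ler_wpM2l e0 H2; move: H; rewrite mulrA; lra.
rewrite /cN mulr_suml; apply: ler_sum => i _; rewrite mulr_suml; apply: ler_sum => j _.
apply: le_trans (ler_norm _) _; rewrite normrM -mulrA ler_wpM2l//.
exact: qform_bound.
Qed.

(** One Euler step preserves a lower bound of the quadratic form up to a factor
    1 + O(t' - t) and an error of higher order: the drift acts by the
    congruence X |-> (1 + (t'-t) A) X (1 + (t'-t) A)^T, the noise by a positive map. *)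
Let euler_step (F : R -> 'M[R]_n) : increment_ode T L F ->
  exists c C, [/\ 0 <= c, 0 <= C & forall e t t', 0 <= e -> 0 <= t -> t <= t' -> t' <= T ->
    lower e (F t) ->
    lower (e * (1 + c * (t' - t)) + C * ((t' - t) * Num.sqrt (t' - t))) (F t')].
Proof.
move=> FL; have [B B0 FB] := increment_ode_bounded FL.
have /choice[C CP] := fun z : 'I_n * 'I_n => FL z.1 z.2.
pose c1 := \sum_z `|C z|.
have c10 : 0 <= c1 by exact: sumr_ge0.
have sA0 := mxsum_ge0 (A *m A^T).
have cA0 : 0 <= cA.
  apply: addr_ge0; first by apply: addr_ge0; exact: mxsum_ge0.
  by apply: mulr_ge0; [exact: ltW|exact: mxsum_ge0].
have cN0 : 0 <= cN by apply: sumr_ge0 => *; apply: sumr_ge0 => *; rewrite mulr_ge0// mxsum_ge0.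
have [c3 c30 H3] : exists2 c3, 0 <= c3 & forall t v, 0 <= t <= T ->
    `|qform (F t) (A^T *m v) (A^T *m v)| <= c3 * sqnorm v.
  exists (B * mxsum (A *m A^T)); first by rewrite mulr_ge0.
  move=> t v tT; apply: le_trans (qform_bound _ _) _.
  rewrite -mulrA ler_pM ?mxsum_ge0 ?sqnorm_ge0 ?FB//.
  rewrite -qform1 qform1_mul.
  exact: le_trans (ler_norm _) (qform_bound _ _).
exists (cA + cN), (c1 + c3 * Num.sqrt T); split.
- exact: addr_ge0.
- by rewrite addr_ge0// mulr_ge0// sqrtr_ge0.
move=> e t t' e0 t0 tt' tT' low v.
set dt := t' - t; have dt0 : 0 <= dt by rewrite subr_ge0.
have tT : 0 <= t <= T by rewrite t0 (le_trans tt').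
set r := dt * Num.sqrt dt; have r0 : 0 <= r by rewrite mulr_ge0// sqrtr_ge0.
pose S := F t' - F t - dt *: L (F t).
have SE (X Y V : 'M[R]_n) c i j : (X - Y - c *: V) i j = X i j - Y i j - c * V i j.
  by rewrite !mxE.
have HS : `|qform S v v| <= c1 * r * sqnorm v.
  apply: le_trans (qform_bound _ _) _; rewrite ler_wpM2r ?sqnorm_ge0//.
  rewrite /mxsum /c1 mulr_suml; apply: ler_sum => z _.
  rewrite SE; apply: le_trans (CP z t t' t0 tt' tT') _.
  by rewrite ler_wpM2r// ler_norm.
have FE : F t' = F t + dt *: L (F t) + S by rewrite /S addrAC addrA subrK addrC subrK.
clearbody S.
set w := v + dt *: (A^T *m v).
have wE : qform (F t) w w = qform (F t) v v +
   dt * (qform (F t) (A^T *m v) v + qform (F t) v (A^T *m v)) +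
   dt ^+ 2 * qform (F t) (A^T *m v) (A^T *m v).
  by rewrite /w !(qformDl, qformDr, qformZl, qformZr); ring.
have wn : sqnorm w <= (1 + cA * dt) * sqnorm v.
  have -> : sqnorm w = sqnorm v + dt * (qform A^T v v + qform A v v + dt * qform (A *m A^T) v v).
    rewrite -!qform1 /w !(qformDl, qformDr, qformZl, qformZr).
    by rewrite qform1_mul qform1_mull qform1_mulr; ring.
  have b1 := le_trans (ler_norm _) (qform_bound A v).
  have b2 := le_trans (ler_norm _) (qform_bound A^T v).
  have b3 := le_trans (ler_norm _) (qform_bound (A *m A^T) v).
  have b4 : dt * qform (A *m A^T) v v <= T * (mxsum (A *m A^T) * sqnorm v).
    apply: le_trans (ler_wpM2l dt0 b3) _.
    by rewrite ler_wpM2r ?mulr_ge0 ?sqnorm_ge0// /dt; lra.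
  have b5 : qform A^T v v + qform A v v + dt * qform (A *m A^T) v v <= cA * sqnorm v.
    by rewrite /cA; lra.
  by have := ler_wpM2l dt0 b5; lra.
have Hn := lower_noise v low e0.
have Hw := low w.
have Hd := sqr_le_small t0 tt' tT'; rewrite -/dt -/r in Hd.
have H3' := H3 t v tT.
have sv0 := sqnorm_ge0 v.
rewrite FE !qformD qformZ qform_lyap.
move: HS; rewrite ler_norml => /andP[HS _].
move: H3'; rewrite ler_norml => /andP[_ H3'].
have K1 := ler_wpM2l e0 wn.
have K2 := ler_wpM2l dt0 Hn.
have K3 : dt ^+ 2 * qform (F t) (A^T *m v) (A^T *m v) <= c3 * Num.sqrt T * r * sqnorm v.
  apply: (@le_trans _ _ (dt ^+ 2 * (c3 * sqnorm v))); first by rewrite ler_wpM2l ?sqr_ge0.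
  have := ler_wpM2l (mulr_ge0 c30 sv0) Hd; rewrite expr2.
  move: (Num.sqrt T) => sT; lra.
rewrite wE in Hw.
move: Hw K1 K2 K3 HS.
move: (qform (F t) v v) (qform (F t) (A^T *m v) v) (qform (F t) v (A^T *m v)).
move: (qform (F t) _ _) (\sum_(i < q) _) (qform S v v) (sqnorm w) (sqnorm v) (Num.sqrt T).
move=> G2 Nz Sv sw sv sT Qv d1 d2 Hw K1 K2 K3 HS.
lra.
Qed.

Let lower_psd (X : 'M[R]_n) : psd X -> lower 0 X.
Proof. by move=> pX v; rewrite mul0r oppr0. Qed.

(** Iterating the Euler step over a mesh of size t / m, the error is of order
    1 / sqrt m, uniformly exponential in [t]; positivity follows as m grows. *)
Theorem increment_ode_psd (F : R -> 'M[R]_n) : increment_ode T L F ->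
  psd (F 0) -> forall t, 0 <= t <= T -> psd (F t).
Proof.
move=> FL F0 t /andP[t0 tT].
have [c [C [c0 C0 step]]] := euler_step FL.
have iter (m : nat) : (0 < m)%N ->
    lower (m%:R * (C * ((t / m%:R) * Num.sqrt (t / m%:R))) * (1 + c * (t / m%:R)) ^+ m) (F t).
  move=> m0; have mR : 0 < m%:R :> R by rewrite ltr0n.
  set dl := t / m%:R; have dl0 : 0 <= dl by rewrite divr_ge0// ltW.
  set r := C * (dl * Num.sqrt dl).
  have r0 : 0 <= r by rewrite !mulr_ge0// sqrtr_ge0.
  have g1 : 1 <= 1 + c * dl by rewrite lerDl mulr_ge0.
  have tm : m%:R * dl = t by rewrite /dl mulrCA divff ?mulr1// gt_eqF.
  rewrite -[X in F X]tm.
  suff ind j : (j <= m)%N -> lower (j%:R * r * (1 + c * dl) ^+ j) (F (j%:R * dl)).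
    exact: ind (leqnn m).
  elim: j => [_|j IH jm].
    by rewrite !mul0r; exact: lower_psd.
  have {}IH := IH (ltnW jm).
  have e0 : 0 <= j%:R * r * (1 + c * dl) ^+ j.
    by rewrite !mulr_ge0// exprn_ge0// (le_trans ler01).
  have jj : j.+1%:R * dl - j%:R * dl = dl by rewrite -mulrBl -natrB// subSnn mul1r.
  have jT : j.+1%:R * dl <= T.
    by apply: le_trans tT; rewrite -tm ler_wpM2r// ler_nat.
  have := step _ (j%:R * dl) (j.+1%:R * dl) e0 (mulr_ge0 (ler0n _ _) dl0) _ jT IH.
  rewrite jj -/r => /(_ _) H v; apply: le_trans (H _ v); last first.
    by rewrite ler_wpM2r// ler_nat.
  rewrite lerN2 ler_wpM2r ?sqnorm_ge0// exprS.
  have E1 : 1 <= (1 + c * dl) * (1 + c * dl) ^+ j by rewrite -exprS exprn_ege1.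
  rewrite -natr1 mulrDl mul1r mulrDl; apply: lerD; last by rewrite ler_peMr.
  by rewrite le_eqVlt; apply/orP; left; apply/eqP; ring.
move=> v.
pose a := C * t * expR (c * t) * sqnorm v.
have a0 : 0 <= a by rewrite !mulr_ge0 ?expR_ge0 ?sqnorm_ge0.
have low (m : nat) : (0 < m)%N -> - (a * Num.sqrt (t / m%:R)) <= qform (F t) v v.
  move=> m0; have mR : 0 < m%:R :> R by rewrite ltr0n.
  apply: le_trans (iter m m0 v); rewrite lerN2 /a.
  set dl := t / m%:R; have dl0 : 0 <= dl by rewrite divr_ge0// ltW.
  have tm : m%:R * dl = t by rewrite /dl mulrCA divff ?mulr1// gt_eqF.
  have ex : (1 + c * dl) ^+ m <= expR (c * t).
    apply: (@le_trans _ _ (expR (c * dl) ^+ m)).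
      by rewrite lerXn2r ?nnegrE ?expR_ge0 ?expR_ge1Dx// addr_ge0// mulr_ge0.
    by rewrite -expRM_natl -tm mulrCA.
  have s0 := sqrtr_ge0 dl; have sv := sqnorm_ge0 v.
  rewrite [leRHS](_ : _ = (m%:R * (C * (dl * Num.sqrt dl))) * expR (c * t) * sqnorm v); last by rewrite -[X in C * X * _]tm; ring.
  by rewrite ler_wpM2r// ler_wpM2l// !mulr_ge0// ltW.
rewrite leNgt; apply/negP => neg.
set x := qform (F t) v v in neg low.
(* A mesh so fine that the lower bound exceeds the negative value x. *)
pose m := (Num.bound (a ^+ 2 * t / x ^+ 2)).+1.
have x2 : 0 < x ^+ 2 by rewrite exprn_even_gt0//= lt_eqF.
have := low m isT; rewrite lerNl => H.
have mR : 0 < m%:R :> R by rewrite ltr0n.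
have xN : 0 <= - x by rewrite oppr_ge0 ltW.
have : (- x) ^+ 2 <= (a * Num.sqrt (t / m%:R)) ^+ 2.
  apply: lerXn2r H; rewrite nnegrE//; apply: mulr_ge0 => //; exact: sqrtr_ge0.
rewrite sqrrN exprMn sqr_sqrtr ?divr_ge0 ?(ltW mR)// mulrA ler_pdivlMr// => {}H.
have : a ^+ 2 * t / x ^+ 2 < m%:R.
  apply: lt_le_trans (archi_boundP _) _; last by rewrite ler_nat.
  by apply: divr_ge0; [apply: mulr_ge0 => //; exact: sqr_ge0|exact: sqr_ge0].
by rewrite ltr_pdivrMr// => H2; move: H; rewrite mulrC leNgt H2.
Qed.

End Positivity.

(** * Levy covariances and classical solutions of the Lyapunov equation *)

Section LevyCovariancePositive.
Context (R : realType) d (Omega : measurableType d) (P : probability Omega R).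
Context (T : R) (T_gt0 : 0 < T) (Fl : R -> set (set Omega)).
Hypothesis Fl_usual : usual_filtration P T Fl.
Context (q : nat) (K : 'M[R]_q) (M : R -> Omega -> 'cV[R]_q).
Hypothesis M_levy : levy_process P T Fl K M.
Local Notation L2 := (square_integrable P).

(** Up to the factor T, the double sum is the expectation of the quadratic form of X
    at the random vector sum_i M_i(T) u_i. *)
Lemma levy_cov_positive : cov_positive K.
Proof.
move=> n X u pX; rewrite -(pmulr_rge0 _ T_gt0).
have TT : 0 <= T <= T by rewrite lexx ltW.
have LM i := levy_L2 Fl_usual M_levy i TT.
pose Y a w := \sum_i u i a 0 * M T w i 0.
have LY a : L2 (Y a).
  by apply: square_integrable_sum => i; exact: square_integrableZ.
have -> : T * \sum_i \sum_j K i j * qform X (u i) (u j) =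
    \sum_(z : 'I_n * 'I_n) X z.1 z.2 * inner P (Y z.1) (Y z.2).
  transitivity (\sum_i \sum_j \sum_(z : 'I_n * 'I_n)
      X z.1 z.2 * (u i z.1 0 * (u j z.2 0 * (K i j * T)))).
    rewrite mulr_sumr; apply: eq_bigr => i _; rewrite mulr_sumr; apply: eq_bigr => j _.
    by rewrite qformE !mulr_sumr; apply: eq_bigr => z _; ring.
  under eq_bigr do rewrite exchange_big/=.
  rewrite exchange_big/=; apply: eq_bigr => z _.
  rewrite inner_suml//; last by move=> i; exact: square_integrableZ.
  rewrite mulr_sumr; apply: eq_bigr => i _.
  rewrite inner_sumr//; [|by move=> j; exact: square_integrableZ|exact: square_integrableZ].
  rewrite mulr_sumr; apply: eq_bigr => j _.
  rewrite innerZl//; last exact: square_integrableZ.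
  by rewrite innerZr// (levy_covarianceE M_levy).
rewrite /inner -(Rintegral_lincomb _ _ measurableT _).2; last by move=> z; exact: integrable_mul.
apply: Rintegral_ge0 => w _.
have := pX (\col_a Y a w); rewrite qformE.
by rewrite (eq_bigr (fun z => X z.1 z.2 * (Y z.1 w * Y z.2 w)))// => z _; rewrite !mxE.
Qed.

End LevyCovariancePositive.

Section IvpIncrements.
Context (R : realType) (T : R) (n m q : nat) (K : 'M[R]_q).
Context (A : 'M[R]_n) (N : 'I_q -> 'M[R]_n) (B : 'M[R]_m) (N' : 'I_q -> 'M[R]_m).
Hypothesis T_gt0 : 0 < T.
Local Notation L := (lyap_op K A N B N').

Lemma lyap_lincomb c (X Y : 'M[R]_(n, m)) a b :
  L (c *: X - Y) a b = c * L X a b - L Y a b.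
Proof.
rewrite !lyap_opE 2!mulrDr !mulr_sumr !opprD addrACA [X in _ = X + _]addrACA.
rewrite -!sumrB; congr (_ + _ + _).
- by apply: eq_bigr => i _; rewrite !mxE; ring.
- by apply: eq_bigr => i _; rewrite !mxE; ring.
- apply: eq_bigr => z _; rewrite mulr_sumr -sumrB; apply: eq_bigr => y _.
  by rewrite !mxE; ring.
Qed.

Lemma lyap_bound : exists2 C, 0 <= C & forall X a b, `|L X a b| <= C * mxsum X.
Proof.
pose C := mxsum A + mxsum B + \sum_a \sum_b
  \sum_(z : 'I_q * 'I_n) \sum_(y : 'I_q * 'I_m) `|N z.1 a z.2 * N' y.1 b y.2 * K z.1 y.1|.
have C1 : 0 <= \sum_a \sum_b
  \sum_(z : 'I_q * 'I_n) \sum_(y : 'I_q * 'I_m) `|N z.1 a z.2 * N' y.1 b y.2 * K z.1 y.1|.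
  by do 3!(apply: sumr_ge0 => ? _); exact: sumr_ge0.
exists C; first by rewrite !addr_ge0 ?mxsum_ge0.
move=> X a b; have X0 := mxsum_ge0 X.
have Xle c e : `|X c e| <= mxsum X.
  by rewrite /mxsum (bigD1 (c, e))//= lerDl sumr_ge0.
rewrite lyap_opE /C !mulrDl.
apply: le_trans (ler_normD _ _) _; apply: lerD.
  apply: le_trans (ler_normD _ _) _; apply: lerD.
  - apply: le_trans (ler_norm_sum _ _ _) _.
    apply: (@le_trans _ _ (\sum_c `|A a c| * mxsum X)).
      by apply: ler_sum => c _; rewrite normrM ler_wpM2l.
    rewrite -mulr_suml ler_wpM2r// /mxsum -(pair_bigA _ (fun i j => `|A i j|))/=.
    by rewrite [leRHS](bigD1 a)//= lerDl sumr_ge0// => *; rewrite sumr_ge0.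
  - apply: le_trans (ler_norm_sum _ _ _) _.
    apply: (@le_trans _ _ (\sum_c `|B b c| * mxsum X)).
      by apply: ler_sum => c _; rewrite normrM ler_wpM2l.
    rewrite -mulr_suml ler_wpM2r// /mxsum -(pair_bigA _ (fun i j => `|B i j|))/=.
    by rewrite [leRHS](bigD1 b)//= lerDl sumr_ge0// => *; rewrite sumr_ge0.
apply: le_trans (ler_norm_sum _ _ _) _.
rewrite (bigD1 a)//= (bigD1 b)//= -!addrA mulrDl -[leLHS]addr0; apply: lerD; last first.
  rewrite mulr_ge0// addr_ge0//; first by do 2!(apply: sumr_ge0 => ? _); exact: sumr_ge0.
  by do 3!(apply: sumr_ge0 => ? _); exact: sumr_ge0.
rewrite mulr_suml; apply: ler_sum => z _; rewrite mulr_suml.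
apply: le_trans (ler_norm_sum _ _ _) _; apply: ler_sum => y _.
by rewrite normrM ler_wpM2l.
Qed.

Lemma is_derive_coord (F : R -> 'M[R]_(n, m)) t (dF : 'M[R]_(n, m)) a b :
  is_derive t (1 : R) F dF -> is_derive t (1 : R) (fun s => F s a b) (dF a b).
Proof.
move=> [dF1 dF2].
have cF : (fun h => h^-1 *: ((F \o shift t) (h *: (1 : R)) - F t)) @ 0^' --> dF.
  by rewrite -dF2; exact: dF1.
have c' : (fun h => h^-1 *: (((fun s => F s a b) \o shift t) (h *: (1 : R)) - F t a b)) @ 0^'
    --> dF a b.
  rewrite (_ : (fun h => _) = fun h =>
      (h^-1 *: ((F \o shift t) (h *: (1 : R)) - F t)) a b); last first.
    by apply/funext => h /=; rewrite !mxE.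
  exact: (continuous_cvg _ (@coord_continuous _ _ _ a b _) cF).
by split; [apply/cvg_ex; eexists; exact: c'|apply: cvg_lim].
Qed.

Lemma ivp_coord F0 F a b : ivp_solution T L F0 F ->
  [/\ {within `[0, T], continuous (fun s => F s a b)} &
      forall t, 0 < t < T -> is_derive t (1 : R) (fun s => F s a b) (L (F t) a b)].
Proof.
move=> [_ cF dF]; split; last by move=> t tT; apply: is_derive_coord; exact: dF.
move=> t; apply: (continuous_cvg _ (@coord_continuous _ _ _ a b _)); exact: cF.
Qed.

(** Mean value theorem, and the Lipschitz bound on F that it entails. *)
Lemma ivp_increment_ode F0 F : ivp_solution T L F0 F -> increment_ode T L F.
Proof.
move=> FL.
have /choice[C CP] : forall z : 'I_n * 'I_m, exists C, forall t, 0 <= t <= T ->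
    `|F t z.1 z.2| <= C.
  move=> [a b] /=; have [ca _] := ivp_coord a b FL.
  have cn : {within `[0, T], continuous (fun s => `|F s a b|)}.
    by move=> t; apply: continuous_cvg; [exact: norm_continuous|exact: ca].
  have [c _ H] := EVT_max (ltW T_gt0) cn.
  by exists `|F c a b| => t tT; apply: H; rewrite in_itv.
pose B1 := \sum_z `|C z|.
have FB t : 0 <= t <= T -> mxsum (F t) <= B1.
  by move=> tT; apply: ler_sum => z _; exact: le_trans (CP z t tT) (ler_norm _).
have B10 : 0 <= B1 by exact: sumr_ge0.
have [D D0 LD] := lyap_bound.
have mvt a b t t' : 0 <= t -> t < t' -> t' <= T -> exists2 s, t < s < t' &
    F t' a b - F t a b = L (F s) a b * (t' - t).
  move=> t0 tt' tT'; have [ca da] := ivp_coord a b FL.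
  have [||s] := @MVT R (fun s => F s a b) (fun s => L (F s) a b) t t' tt'.
  - move=> s; rewrite in_itv/= => /andP[ts st']; apply: da.
    by rewrite (le_lt_trans t0)// (lt_le_trans st').
  - apply: continuous_subspaceW ca => s /=; rewrite !in_itv/= => /andP[ts st'].
    by rewrite (le_trans t0)// (le_trans st').
  by rewrite in_itv/= => ts E; exists s.
have lip a b t t' : 0 <= t -> t <= t' -> t' <= T ->
    `|F t' a b - F t a b| <= D * B1 * (t' - t).
  move=> t0; rewrite le_eqVlt => /predU1P[->|tt'] tT'; first by rewrite !subrr normr0 mulr0.
  have [s /andP[ts st'] ->] := mvt a b t t' t0 tt' tT'.
  rewrite normrM (ger0_norm (_ : 0 <= t' - t)) ?subr_ge0 ?(ltW tt')// ler_wpM2r ?subr_ge0 ?(ltW tt')//.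
  apply: le_trans (LD _ _ _) _; rewrite ler_wpM2l// FB//.
  by rewrite (le_trans t0 (ltW ts))//= (le_trans (ltW st')).
move=> a b; pose D2 := D * (\sum_(z : 'I_n * 'I_m) D * B1).
have D20 : 0 <= D2 by rewrite mulr_ge0// sumr_ge0// => *; rewrite mulr_ge0.
apply: (@small_increment_le _ _ _ (D2 * Num.sqrt T)) => t t' t0 tt' tT'.
move: tt'; rewrite le_eqVlt => /predU1P[<-|tt'].
  by rewrite !subrr !mul0r subr0 normr0 mulr0.
have dt0 : 0 <= t' - t by rewrite subr_ge0 ltW.
have [s /andP[ts st'] ->] := mvt a b t t' t0 tt' tT'.
have -> : L (F s) a b * (t' - t) - (t' - t) * L (F t) a b =
    (t' - t) * L (1 *: F s - F t) a b by rewrite lyap_lincomb; ring.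
rewrite normrM ger0_norm//.
apply: (@le_trans _ _ ((t' - t) * (D2 * (t' - t)))); last first.
  rewrite mulrCA -[leRHS]mulrA ler_wpM2l// sqr_le_small// ltW//.
rewrite ler_wpM2l//; apply: le_trans (LD _ _ _) _.
rewrite /D2 -[leRHS]mulrA ler_wpM2l// mulr_suml; apply: ler_sum => z _.
rewrite scale1r !mxE; apply: le_trans (lip z.1 z.2 t s t0 (ltW ts) _) _.
  exact: le_trans (ltW st') tT'.
rewrite ler_wpM2l ?mulr_ge0//; lra.
Qed.

Lemma increment_ode_lincomb c (F G : R -> 'M[R]_(n, m)) :
  increment_ode T L F -> increment_ode T L G -> increment_ode T L (fun t => c *: F t - G t).
Proof.
move=> HF HG a b.
apply: eq_small_increment (small_incrementD (small_incrementZ c (HF a b))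
  (small_incrementZ (-1) (HG a b))) => t t' t0 tt' tT'.
by rewrite lyap_lincomb !mxE; ring.
Qed.

End IvpIncrements.

(** * Block matrices *)

Section Blocks.
Context (R : realType).

Lemma block_mxE_entry m1 m2 n1 n2 (X : 'M[R]_(m1, n1)) (Y : 'M[R]_(m1, n2))
    (V : 'M[R]_(m2, n1)) (W : 'M[R]_(m2, n2)) i j :
  block_mx X Y V W i j =
  match fintype.split i, fintype.split j with
  | inl a, inl b => X a b | inl a, inr b => Y a b
  | inr a, inl b => V a b | inr a, inr b => W a b
  end.
Proof.
by rewrite /block_mx mxE; case: (fintype.split i) => a; rewrite mxE; case: (fintype.split j).
Qed.

Lemma sum_block_mx (I : Type) (s : seq I) m1 m2 n1 n2 (X : I -> 'M[R]_(m1, n1))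
    (Y : I -> 'M[R]_(m1, n2)) (V : I -> 'M[R]_(m2, n1)) (W : I -> 'M[R]_(m2, n2)) :
  \sum_(i <- s) block_mx (X i) (Y i) (V i) (W i) =
  block_mx (\sum_(i <- s) X i) (\sum_(i <- s) Y i) (\sum_(i <- s) V i) (\sum_(i <- s) W i).
Proof.
elim: s => [|i s IH]; first by rewrite !big_nil block_mx0.
by rewrite !big_cons IH add_block_mx.
Qed.

Lemma lyap_op_tr n m q (K : 'M[R]_q) (A : 'M[R]_n) N (B : 'M[R]_m) N' X :
  (forall i j, K i j = K j i) ->
  (lyap_op K A N B N' X)^T = lyap_op K B N' A N X^T.
Proof.
move=> Ks; rewrite /lyap_op !linearD/= !trmx_mul trmxK addrC [_ + B *m _]addrC.
rewrite addrC; congr (_ + _).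
rewrite linear_sum/= exchange_big/=.
under eq_bigr do rewrite linear_sum/=.
rewrite exchange_big/=; rewrite exchange_big/=.
apply: eq_bigr => i _; apply: eq_bigr => j _.
by rewrite linearZ/= !trmx_mul trmxK mulmxA Ks.
Qed.

(** The three Lyapunov operators are the blocks of a single one, that of the
    block-diagonal system formed by the original and the reduced system. *)
Lemma lyap_op_block n m q (K : 'M[R]_q) (A : 'M[R]_n) N (B : 'M[R]_m) N'
    (X : 'M[R]_n) (Y : 'M[R]_(n, m)) (W : 'M[R]_m) :
  (forall i j, K i j = K j i) ->
  lyap_op K (block_mx A 0 0 B) (fun i => block_mx (N i) 0 0 (N' i))
    (block_mx A 0 0 B) (fun i => block_mx (N i) 0 0 (N' i)) (block_mx X Y Y^T W) =
  block_mx (lyap_op K A N A N X) (lyap_op K A N B N' Y)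
    (lyap_op K A N B N' Y)^T (lyap_op K B N' B N' W).
Proof.
move=> Ks; rewrite lyap_op_tr// /lyap_op.
under eq_bigr do under eq_bigr do
  rewrite tr_block_mx !trmx0 !mulmx_block !(mulmx0, mul0mx, addr0, add0r) scale_block_mx.
under eq_bigr do rewrite sum_block_mx.
rewrite sum_block_mx tr_block_mx !trmx0 !mulmx_block !(mulmx0, mul0mx, addr0, add0r).
by rewrite !add_block_mx.
Qed.

Lemma qform_block n m (X : 'M[R]_n) (Y : 'M[R]_(n, m)) (W : 'M[R]_m) u v :
  qform (block_mx X Y Y^T W) (col_mx u v) (col_mx u v) =
  qform X u u + 2 * qform Y u v + qform W v v.
Proof.
rewrite /qform tr_col_mx mul_row_block mul_row_col !mulmxDl.
rewrite [LHS]mxE [X in X + _ = _]mxE [X in _ + X = _]mxE.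
have -> : v^T *m Y^T *m u = (u^T *m Y *m v)^T by rewrite !trmx_mul trmxK mulmxA.
rewrite [(_^T) 0 0]mxE; lra.
Qed.

Lemma increment_ode_block T n m q (K : 'M[R]_q) (A : 'M[R]_n) N (B : 'M[R]_m) N' F1 F2 F3 :
  (forall i j, K i j = K j i) ->
  increment_ode T (lyap_op K A N A N) F1 ->
  increment_ode T (lyap_op K A N B N') F2 ->
  increment_ode T (lyap_op K B N' B N') F3 ->
  increment_ode T (lyap_op K (block_mx A 0 0 B) (fun i => block_mx (N i) 0 0 (N' i))
    (block_mx A 0 0 B) (fun i => block_mx (N i) 0 0 (N' i)))
    (fun t => block_mx (F1 t) (F2 t) (F2 t)^T (F3 t)).
Proof.
move=> Ks H1 H2 H3 i j.
apply: (eq_small_increment (f := fun t t' =>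
  match fintype.split i, fintype.split j with
  | inl a, inl b => (F1 t' a b - F1 t a b) - (t' - t) * lyap_op K A N A N (F1 t) a b
  | inl a, inr b => (F2 t' a b - F2 t a b) - (t' - t) * lyap_op K A N B N' (F2 t) a b
  | inr a, inl b => (F2 t' b a - F2 t b a) - (t' - t) * lyap_op K A N B N' (F2 t) b a
  | inr a, inr b => (F3 t' a b - F3 t a b) - (t' - t) * lyap_op K B N' B N' (F3 t) a b
  end)).
  move=> t t' _ _ _; rewrite lyap_op_block// !block_mxE_entry.
  have trE (X : 'M[R]_(n, m)) a b : X^T a b = X b a by rewrite mxE.
  by case: (fintype.split i) => a; case: (fintype.split j) => b; rewrite ?trE.
case: (fintype.split i) => a; case: (fintype.split j) => b.
- exact: H1.
- exact: H2.
- exact: H2.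
- exact: H3.
Qed.

Lemma norm2_sqr n m (X : 'M[R]_(n, m)) : norm2 X ^+ 2 = \sum_i \sum_j X i j ^+ 2.
Proof.
by rewrite /norm2 sqr_sqrtr//; do 2!(apply: sumr_ge0 => ? _); exact: sqr_ge0.
Qed.

Lemma norm2_sqr_col n (z : 'cV[R]_n) : norm2 z ^+ 2 = sqnorm z.
Proof. by rewrite norm2_sqr; apply: eq_bigr => i _; rewrite big_ord1. Qed.

Lemma sqr_dot_le n (z u : 'cV[R]_n) : ((z^T *m u) 0 0) ^+ 2 <= sqnorm z * sqnorm u.
Proof.
rewrite mxE /sqnorm; under eq_bigr do rewrite mxE.
have : 0 <= \sum_i \sum_j (z i 0 * u j 0 - z j 0 * u i 0) ^+ 2.
  by do 2!(apply: sumr_ge0 => ? _); exact: sqr_ge0.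
rewrite [X in _ <= X -> _](_ : _ = (\sum_i z i 0 ^+ 2) * (\sum_i u i 0 ^+ 2)
    + (\sum_i u i 0 ^+ 2) * (\sum_i z i 0 ^+ 2)
    - 2 * ((\sum_i z i 0 * u i 0) * (\sum_i z i 0 * u i 0))); first by rewrite expr2; lra.
rewrite !big_distrlr/= mulr_sumr -!big_split/= -sumrB; apply: eq_bigr => i _.
rewrite mulr_sumr -!big_split/= -sumrB; apply: eq_bigr => j _; ring.
Qed.

(** Cauchy-Schwarz, in the form z z^T <= |z|^2 I, transported by X. *)
Lemma psd_rank_one n m (X : 'M[R]_(n, m)) (z : 'cV[R]_m) :
  psd (norm2 z ^+ 2 *: (X *m X^T) - (X *m z) *m (X *m z)^T).
Proof.
move=> v; rewrite norm2_sqr_col -scaleN1r qformD !qformZ -!qform1_mul !qform1.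
rewrite mulN1r subr_ge0 {1}/sqnorm big_ord1 trmx_mul -mulmxA; exact: sqr_dot_le.
Qed.

End Blocks.

(** * Comparison of the joint covariance with the covariance functions *)

Section Covariance.
Context (R : realType) d (Omega : measurableType d) (P : probability Omega R).
Context (T : R) (T_gt0 : 0 < T) (Fl : R -> set (set Omega)).
Hypothesis Fl_usual : usual_filtration P T Fl.
Context (q : nat) (K : 'M[R]_q) (M : R -> Omega -> 'cV[R]_q).
Hypothesis M_levy : levy_process P T Fl K M.
Local Notation L2 := (square_integrable P).
Local Notation time_space := ((@lebesgue_measure R \x P)%E).

Context (n : nat) (A : 'M[R]_n) (N : 'I_q -> 'M[R]_n) (x0 : 'cV[R]_n).
Context (x : R -> Omega -> 'cV[R]_n) (h : 'I_n -> R * Omega -> R).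
Hypothesis HZ : ito_martingale P T Fl M N h (sde_remainder A x0 x h).

Context (n' : nat) (A' : 'M[R]_n') (N' : 'I_q -> 'M[R]_n') (x0' : 'cV[R]_n').
Context (x' : R -> Omega -> 'cV[R]_n') (h' : 'I_n' -> R * Omega -> R).
Hypothesis HZ' : ito_martingale P T Fl M N' h' (sde_remainder A' x0' x' h').

Let zT : 0 <= (0 : R) <= T. Proof. by rewrite lexx ltW. Qed.

Lemma strip_empty (f : R * Omega -> R) a : strip a a f = fun=> 0.
Proof. by apply/funext => p; rewrite /strip; case: ltP => // h1; rewrite leNgt h1. Qed.

(** At time 0 the isometry integrates over an empty interval. *)
Lemma state_start_norm m (B : 'M[R]_m) (N1 : 'I_q -> 'M[R]_m) y0 y g a :
  ito_martingale P T Fl M N1 g (sde_remainder B y0 y g) ->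
  l2norm P (fun w => state y a 0 w - y0 a 0) = 0.
Proof.
move=> HY; have -> : (fun w => state y a 0 w - y0 a 0) = sde_remainder B y0 y g a 0.
  apply/funext => w; rewrite /sde_remainder big1 ?subr0// => c _.
  by rewrite /time_integral strip_empty /Rintegral integral0 mulr0.
rewrite /l2norm (martingale_isometry T_gt0 Fl_usual M_levy a a HY HY zT zT).
rewrite big1 ?sqrtr0// => z _; rewrite big1// => y' _.
by rewrite strip_empty inner0l mulr0.
Qed.

Lemma covariance_init : covariance_mx P x x' 0 = x0 *m x0'^T.
Proof.
apply/matrixP => a b; rewrite !mxE big_ord1 mxE.
have L := state_L2 HZ a zT; have L' := state_L2 HZ' b zT.
have n0 := state_start_norm a HZ; have n0' := state_start_norm b HZ'.
set e := fun w => _ in n0; set e' := fun w => _ in n0'.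
have Le : L2 e by apply: square_integrableB => //; exact: cst_L2.
have Le' : L2 e' by apply: square_integrableB => //; exact: cst_L2.
have c1 := cst_L2 P (x0 a 0); have c2 := cst_L2 P (x0' b 0).
have z1 g : L2 g -> inner P e g = 0.
  move=> Lg; apply/eqP; rewrite -normr_le0.
  by apply: le_trans (cauchy_schwarz Le Lg) _; rewrite n0 mul0r.
have z2 g : L2 g -> inner P g e' = 0.
  move=> Lg; apply/eqP; rewrite -normr_le0.
  by apply: le_trans (cauchy_schwarz Lg Le') _; rewrite n0' mulr0.
have -> : state x a 0 = fun w => e w + x0 a 0 by apply/funext => w; rewrite /e; lra.
have -> : state x' b 0 = fun w => e' w + x0' b 0 by apply/funext => w; rewrite /e'; lra.
have Ls : L2 (fun w => e' w + x0' b 0) by exact: square_integrableD.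
rewrite innerDl// z1// add0r innerDr// z2// add0r /inner Rintegral_cst//.
have -> : fine (P [set: Omega]) = 1 by rewrite probability_setT.
by rewrite mulr1.
Qed.

Lemma inner_combination t (u : 'cV[R]_n) (v : 'cV[R]_n') : 0 <= t <= T ->
  inner P (fun w => \sum_a u a 0 * state x a t w) (fun w => \sum_b v b 0 * state x' b t w) =
  qform (covariance_mx P x x' t) u v.
Proof.
move=> tT.
have L a := state_L2 HZ a tT; have L' b := state_L2 HZ' b tT.
have Lu a : L2 (fun w => u a 0 * state x a t w) by exact: square_integrableZ.
have Lv b : L2 (fun w => v b 0 * state x' b t w) by exact: square_integrableZ.
rewrite inner_suml//; last exact: square_integrable_sum.
rewrite qformE -(pair_bigA _ (fun a b => covariance_mx P x x' t a b * (u a 0 * v b 0)))/=.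
apply: eq_bigr => a _; rewrite inner_sumr//; apply: eq_bigr => b _.
by rewrite innerZl// innerZr// mxE; ring.
Qed.

End Covariance.

Section Comparison.
Context (R : realType) d (Omega : measurableType d) (P : probability Omega R).
Context (T : R) (T_gt0 : 0 < T) (Fl : R -> set (set Omega)).
Hypothesis Fl_usual : usual_filtration P T Fl.
Context (q : nat) (K : 'M[R]_q) (M : R -> Omega -> 'cV[R]_q).
Hypothesis M_levy : levy_process P T Fl K M.
Local Notation L2 := (square_integrable P).
Local Notation time_space := ((@lebesgue_measure R \x P)%E).

Context (m : nat) (z0 : 'cV[R]_m).
Context (n : nat) (A : 'M[R]_n) (N : 'I_q -> 'M[R]_n) (X0 : 'M[R]_(n, m)).
Context (x : R -> Omega -> 'cV[R]_n) (h : 'I_n -> R * Omega -> R).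
Hypothesis HZ : ito_martingale P T Fl M N h (sde_remainder A (X0 *m z0) x h).
Hypothesis h_left : {ae P, forall w, forall a s, 0 < s <= T ->
  x r w a 0 @[r --> s^'-] --> h a (s, w)}.
Hypothesis ax : adapted T Fl x.

Context (n' : nat) (A' : 'M[R]_n') (N' : 'I_q -> 'M[R]_n') (X0' : 'M[R]_(n', m)).
Context (x' : R -> Omega -> 'cV[R]_n') (h' : 'I_n' -> R * Omega -> R).
Hypothesis HZ' : ito_martingale P T Fl M N' h' (sde_remainder A' (X0' *m z0) x' h').
Hypothesis h'_left : {ae P, forall w, forall a s, 0 < s <= T ->
  x' r w a 0 @[r --> s^'-] --> h' a (s, w)}.
Hypothesis ax' : adapted T Fl x'.

Context (F : R -> 'M[R]_n) (Fh : R -> 'M[R]_n') (Ft : R -> 'M[R]_(n, n')).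
Hypothesis F_sol : ivp_solution T (lyap_op K A N A N) (X0 *m X0^T) F.
Hypothesis Fh_sol : ivp_solution T (lyap_op K A' N' A' N') (X0' *m X0'^T) Fh.
Hypothesis Ft_sol : ivp_solution T (lyap_op K A N A' N') (X0 *m X0'^T) Ft.

(** The quadratic form of the block matrix with blocks F, Ft, Ft^T, Fh at the
    stacked vector (u; v). *)
Definition joint_form u v t : R :=
  qform (F t) u u + 2 * qform (Ft t) u v + qform (Fh t) v v.

Definition combined_state (u : 'cV[R]_n) (v : 'cV[R]_n') t w : R :=
  \sum_a u a 0 * state x a t w + \sum_b v b 0 * state x' b t w.

(** The difference of the two block matrices obeys the Lyapunov equation of the
    block-diagonal system and starts from a positive semidefinite matrix. *)
Lemma covariance_comparison u v t : 0 <= t <= T ->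
  L2 (combined_state u v t) /\
  inner P (combined_state u v t) (combined_state u v t) <= norm2 z0 ^+ 2 * joint_form u v t.
Proof.
move=> tT.
have L : L2 (fun w => \sum_a u a 0 * state x a t w).
  by apply: square_integrable_sum => a; apply: square_integrableZ; exact: state_L2 HZ _ _ tT.
have L' : L2 (fun w => \sum_b v b 0 * state x' b t w).
  by apply: square_integrable_sum => a; apply: square_integrableZ; exact: state_L2 HZ' _ _ tT.
split; first exact: square_integrableD.
have Ks i j := levy_cov_sym M_levy i j T_gt0.
have cov_ode := covariance_increment_ode T_gt0 Fl_usual M_levy.
pose Q s := norm2 z0 ^+ 2 *: block_mx (F s) (Ft s) (Ft s)^T (Fh s) -
  block_mx (covariance_mx P x x s) (covariance_mx P x x' s) (covariance_mx P x x' s)^T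
    (covariance_mx P x' x' s).
have Q0 : psd (Q 0).
  case: F_sol => F0 _ _; case: Ft_sol => Ft0 _ _; case: Fh_sol => Fh0 _ _.
  have init := covariance_init T_gt0 Fl_usual M_levy.
  rewrite /Q F0 Ft0 Fh0 (init _ _ _ _ _ _ HZ _ _ _ _ _ _ HZ).
  rewrite (init _ _ _ _ _ _ HZ _ _ _ _ _ _ HZ') (init _ _ _ _ _ _ HZ' _ _ _ _ _ _ HZ').
  rewrite !trmx_mul !trmxK.
  have := psd_rank_one (col_mx X0 X0') z0.
  by rewrite [col_mx _ _ *m z0]mul_col_mx !tr_col_mx !mul_col_row !trmx_mul.
have ode : increment_ode T
    (lyap_op K (block_mx A 0 0 A') (fun i => block_mx (N i) 0 0 (N' i))
       (block_mx A 0 0 A') (fun i => block_mx (N i) 0 0 (N' i))) Q.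
  apply: increment_ode_lincomb; apply: increment_ode_block => //.
  - exact: ivp_increment_ode F_sol.
  - exact: ivp_increment_ode Ft_sol.
  - exact: ivp_increment_ode Fh_sol.
  - exact: cov_ode HZ h_left ax HZ h_left ax.
  - exact: cov_ode HZ h_left ax HZ' h'_left ax'.
  - exact: cov_ode HZ' h'_left ax' HZ' h'_left ax'.
have K_pos := levy_cov_positive T_gt0 Fl_usual M_levy.
have := increment_ode_psd T_gt0 K_pos ode Q0 tT (col_mx u v).
rewrite /Q -scaleN1r qformD !qformZ !qform_block mulN1r subr_ge0 => cmp.
apply: le_trans cmp; rewrite /combined_state innerDl//; last exact: square_integrableD.
rewrite !innerDr// (innerC P (fun w => \sum_b v b 0 * state x' b t w) (fun w => \sum_a _)).
rewrite !(inner_combination HZ HZ _ _ tT, inner_combination HZ HZ' _ _ tT,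
  inner_combination HZ' HZ' _ _ tT); lra.
Qed.

Lemma ivp_cvg k l (B : 'M[R]_k) N1 (B' : 'M[R]_l) N1' G0 G a b (r : nat -> R) s :
  ivp_solution T (lyap_op K B N1 B' N1') G0 G ->
  (forall i, 0 <= r i <= T) -> 0 <= s <= T -> r i @[i --> \oo] --> s ->
  G (r i) a b @[i --> \oo] --> G s a b.
Proof.
move=> HG rT sT rs; have [/subspace_continuousP cG _] := ivp_coord a b HG.
have /cG {}cG : `[0, T]%classic s by rewrite /= in_itv.
apply: cvg_comp cG => D /= wD; have [k0 _ rD] := rs _ wD.
by exists k0 => // i /rD; apply; rewrite /= in_itv/=; exact: rT.
Qed.

Lemma joint_form_cvg u v (r : nat -> R) s :
  (forall i, 0 <= r i <= T) -> 0 <= s <= T -> r i @[i --> \oo] --> s ->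
  joint_form u v (r i) @[i --> \oo] --> joint_form u v s.
Proof.
move=> rT sT rs; rewrite /joint_form.
have cq k l (B : 'M[R]_k) N1 (B' : 'M[R]_l) N1' G0 G u1 v1 :
    ivp_solution T (lyap_op K B N1 B' N1') G0 G ->
    qform (G (r i)) u1 v1 @[i --> \oo] --> qform (G s) u1 v1.
  move=> HG; rewrite qformE; under eq_fun do rewrite qformE.
  apply: cvg_sum_seq => z; apply: cvgM; last exact: cvg_cst.
  exact: ivp_cvg HG _ _ _.
apply: cvgD; last exact: cq Fh_sol.
apply: cvgD; first exact: cq F_sol.
by apply: cvgM; [exact: cvg_cst|exact: cq Ft_sol].
Qed.

Definition combined_left (u : 'cV[R]_n) (v : 'cV[R]_n') (p : R * Omega) : R :=
  \sum_a u a 0 * h a p + \sum_b v b 0 * h' b p.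

Lemma combined_left_L2 u v : square_integrable time_space (combined_left u v).
Proof.
case: HZ => Lh _ _; case: HZ' => Lh' _ _.
by apply: square_integrableD; apply: square_integrable_sum => a; exact: square_integrableZ.
Qed.

(** Fatou, with a bound that varies with time and converges since F, Ft and Fh are
    continuous. *)
Lemma combined_left_bound u v s : 0 < s <= T ->
  (\int[P]_w ((combined_left u v (s, w)) ^+ 2)%:E <=
   (norm2 z0 ^+ 2 * joint_form u v s)%:E)%E.
Proof.
move=> sT; have /andP[s0 sT'] := sT.
have ml : measurable_fun setT (fun w => combined_left u v (s, w)).
  apply: measurableT_comp; last exact: pair1_measurable.
  exact: square_integrable_measurable (combined_left_L2 u v).
have [r [r0 rs rcvg]] := left_sequence (lexx 0) s0 sT'.
have rT i : 0 <= r i <= T by rewrite r0 (le_trans (ltW (rs i))).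
have st : 0 <= s <= T by rewrite ltW.
have cJ : norm2 z0 ^+ 2 * joint_form u v (r i) @[i --> \oo] -->
    norm2 z0 ^+ 2 * joint_form u v s.
  by apply: cvgM; [exact: cvg_cst|exact: joint_form_cvg].
have key e : 0 < e -> L2 (fun w => combined_left u v (s, w)) /\
    inner P (fun w => combined_left u v (s, w)) (fun w => combined_left u v (s, w)) <=
    norm2 z0 ^+ 2 * joint_form u v s + e.
  move=> e0.
  have [k _ Hk] : \forall i \near \oo, norm2 z0 ^+ 2 * joint_form u v (r i) <=
      norm2 z0 ^+ 2 * joint_form u v s + e.
    by apply: (cvgr_le _ cJ); rewrite ltrDl.
  apply: (l2norm_fatou (u := fun i w => combined_state u v (r (i + k)%N) w)) => //.
  - by move=> i; case: (covariance_comparison u v (rT (i + k)%N)).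
  - move=> i; apply: le_trans (Hk (i + k)%N (leq_addl _ _)).
    by case: (covariance_comparison u v (rT (i + k)%N)).
  - apply: filterS2 h_left h'_left => w Hw Hw'.
    rewrite (cvg_shiftn k (fun i => combined_state u v (r i) w) _).
    by apply: cvgD; apply: cvg_sum_seq => a; (apply: cvgM; first exact: cvg_cst);
      [have /cvg_at_leftP := Hw a s sT|have /cvg_at_leftP := Hw' a s sT];
      apply; split.
have [L1 _] := key _ ltr01.
rewrite -EFin_inner_sqr// lee_fin; apply/ler_addgt0Pr => e /key[].
by [].
Qed.

End Comparison.

(** * The output error *)

Lemma trace_qform (R : realType) p n m (C : 'M[R]_(p, n)) (X : 'M[R]_(n, m)) (D : 'M[R]_(p, m)) :
  \tr (C *m X *m D^T) = \sum_k qform X (row k C)^T (row k D)^T.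
Proof.
apply: eq_bigr => k _; rewrite /qform trmxK -!row_mul !mxE; apply: eq_bigr => j _.
by rewrite !mxE.
Qed.

Lemma qform_mx_integral (R : realType) (T : R) n m (G : R -> 'M[R]_(n, m)) u v :
  (forall a b, {within `[0, T], continuous (fun s => G s a b)}) ->
  lebesgue_measure.-integrable `[0, T] (EFin \o (fun s => qform (G s) u v)) /\
  \int[lebesgue_measure]_(s in `[0, T]) qform (G s) u v = qform (mx_integral 0 T G) u v.
Proof.
move=> cG.
have GE : (fun s => qform (G s) u v) =
    fun s => \sum_(z : 'I_n * 'I_m) (u z.1 0 * v z.2 0) * G s z.1 z.2.
  by apply/funext => s; rewrite qformE; apply: eq_bigr => z _; rewrite mulrC.
have Gi (z : 'I_n * 'I_m) :
    lebesgue_measure.-integrable `[0, T] (EFin \o (fun s => G s z.1 z.2)).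
  by apply: continuous_compact_integrable; [exact: segment_compact|exact: cG].
have [H1 H2] := @Rintegral_lincomb _ _ _ (@lebesgue_measure R) `[0, T]%classic _
  (index_enum ('I_n * 'I_m)%type) (fun z => u z.1 0 * v z.2 0) _ (measurable_itv _) Gi.
rewrite GE; split => //; rewrite H2 qformE; apply: eq_bigr => z _.
by rewrite mxE mulrC.
Qed.

Section OutputError.
Context (R : realType) d (Omega : measurableType d) (P : probability Omega R).
Context (T : R) (T_gt0 : 0 < T) (Fl : R -> set (set Omega)).
Hypothesis Fl_usual : usual_filtration P T Fl.
Context (q : nat) (K : 'M[R]_q) (M : R -> Omega -> 'cV[R]_q).
Hypothesis M_levy : levy_process P T Fl K M.
Local Notation L2 := (square_integrable P).
Local Notation time_space := ((@lebesgue_measure R \x P)%E).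

Context (m : nat) (z0 : 'cV[R]_m).
Context (n : nat) (A : 'M[R]_n) (N : 'I_q -> 'M[R]_n) (X0 : 'M[R]_(n, m)).
Context (x : R -> Omega -> 'cV[R]_n) (h : 'I_n -> R * Omega -> R).
Hypothesis HZ : ito_martingale P T Fl M N h (sde_remainder A (X0 *m z0) x h).
Hypothesis h_out : forall a s w, ~~ (0 < s <= T) -> h a (s, w) = 0.
Hypothesis h_left : {ae P, forall w, forall a s, 0 < s <= T ->
  x r w a 0 @[r --> s^'-] --> h a (s, w)}.
Hypothesis ax : adapted T Fl x.

Context (n' : nat) (A' : 'M[R]_n') (N' : 'I_q -> 'M[R]_n') (X0' : 'M[R]_(n', m)).
Context (x' : R -> Omega -> 'cV[R]_n') (h' : 'I_n' -> R * Omega -> R).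
Hypothesis HZ' : ito_martingale P T Fl M N' h' (sde_remainder A' (X0' *m z0) x' h').
Hypothesis h'_out : forall a s w, ~~ (0 < s <= T) -> h' a (s, w) = 0.
Hypothesis h'_left : {ae P, forall w, forall a s, 0 < s <= T ->
  x' r w a 0 @[r --> s^'-] --> h' a (s, w)}.
Hypothesis ax' : adapted T Fl x'.

Context (F : R -> 'M[R]_n) (Fh : R -> 'M[R]_n') (Ft : R -> 'M[R]_(n, n')).
Hypothesis F_sol : ivp_solution T (lyap_op K A N A N) (X0 *m X0^T) F.
Hypothesis Fh_sol : ivp_solution T (lyap_op K A' N' A' N') (X0' *m X0'^T) Fh.
Hypothesis Ft_sol : ivp_solution T (lyap_op K A N A' N') (X0 *m X0'^T) Ft.

Context (p : nat) (C : 'M[R]_(p, n)) (C' : 'M[R]_(p, n')).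
Let u k : 'cV[R]_n := (row k C)^T.
Let v k : 'cV[R]_n' := - (row k C')^T.

Lemma sqr_output_error t w :
  norm2 (C *m x t w - C' *m x' t w) ^+ 2 =
  \sum_k combined_state x x' (u k) (v k) t w ^+ 2.
Proof.
rewrite norm2_sqr; apply: eq_bigr => k _; rewrite big_ord1 !mxE; congr (_ ^+ 2).
rewrite /combined_state -sumrN; congr (_ + _); apply: eq_bigr => a _; rewrite /state !mxE//.
by rewrite mulNr.
Qed.

Let g (s : R * Omega) : R := \sum_k combined_left h h' (u k) (v k) s ^+ 2.

Let g_ge0 s : 0 <= g s.
Proof. by apply: sumr_ge0 => k _; exact: sqr_ge0. Qed.

Let mg : measurable_fun setT g.
Proof.
apply: measurable_sum => k; apply: measurable_funX.
exact: square_integrable_measurable (combined_left_L2 HZ HZ' (u k) (v k)).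
Qed.

Let mgE : measurable_fun setT (fun s => (g s)%:E).
Proof. exact/measurable_EFinP. Qed.

(** A path and its left limits differ at countably many times only, so that the
    jointly measurable left limits may be integrated instead. *)
Lemma output_error_left :
  (\int[P]_w \int[lebesgue_measure]_(t in `[0%R, T])
      ((norm2 (C *m x t w - C' *m x' t w) ^+ 2)%:E) <=
   \int[time_space]_z (g z)%:E)%E.
Proof.
rewrite fubini_tonelli2//.
apply: le_integral_ae_measurable_r.
- by apply: measurable_fun_fubini_tonelli_G => // z; rewrite lee_fin.
- by move=> w; apply: integral_ge0 => t _; rewrite lee_fin sqr_ge0.
- by move=> w; apply: integral_ge0 => t _; rewrite lee_fin.
apply: filterS2 h_left h'_left => w Hw Hw'.
have mgw : measurable_fun setT (fun s => g (s, w)).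
  apply: measurableT_comp mg _; exact: pair2_measurable.
rewrite (@integral_countable _ _ (fun s => g (s, w)))//.
  apply: ge0_subset_integral => //; last by move=> s _; rewrite lee_fin.
  exact/measurable_EFinP.
apply: (@sub_countable _ _ _ (\bigcup_(o in [set: option ('I_n + 'I_n')])
   match o with
   | Some (inl a) => [set s | 0 < s <= T /\ x s w a 0 <> h a (s, w)]
   | Some (inr b) => [set s | 0 < s <= T /\ x' s w b 0 <> h' b (s, w)]
   | None => [set 0]
   end)).
  apply: subset_card_le => s [] /=; rewrite in_itv/= => /andP[s0 st] neq.
  have [->|sn0] := eqVneq s 0; first by exists None.
  have sT : 0 < s <= T by rewrite lt_neqAle eq_sym sn0 s0.
  apply: contrapT => H; apply: neq; rewrite sqr_output_error.
  apply: eq_bigr => k _; rewrite /combined_state /combined_left /state.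
  congr ((_ + _) ^+ 2); apply: eq_bigr => a _; congr (_ * _); apply: contrapT => xs; apply: H.
    by exists (Some (inl a)).
  by exists (Some (inr a)).
apply: bigcup_countable => // -[[a|b]|] _; last exact: countable1.
- apply: (@countable_jumps _ (fun s => x s w a 0) (fun s => h a (s, w))
    [set s | 0 < s <= T]) => s sT; exact: Hw.
- apply: (@countable_jumps _ (fun s => x' s w b 0) (fun s => h' b (s, w))
    [set s | 0 < s <= T]) => s sT; exact: Hw'.
Qed.

Let J s := \sum_k norm2 z0 ^+ 2 * joint_form F Fh Ft (u k) (v k) s.

(** Tonelli, and the bound on second moments at each time; at time 0, where the left
    limits are set to 0, the bound is nonnegative because it dominates a second
    moment. *)
Lemma output_error_bound :
  (\int[time_space]_z (g z)%:E <=
   \int[lebesgue_measure]_(s in `[0%R, T]) (J s)%:E)%E.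
Proof.
rewrite fubini_tonelli1//.
rewrite [leRHS]integral_mkcond; apply: le_integral_nonmeasurable => s _; rewrite /fubini_F.
  by apply: integral_ge0 => w _; rewrite lee_fin.
have [sT|sT] := boolP (0 < s <= T).
  rewrite patchE mem_set/=; last by rewrite in_itv/=; case/andP: sT => /ltW -> ->.
  rewrite (_ : (fun w => _) = fun w =>
    \sum_k ((combined_left h h' (u k) (v k) (s, w)) ^+ 2)%:E)%E; last first.
    by apply/funext => w; rewrite /g -sumEFin.
  rewrite ge0_integral_sum//; last 2 first.
  - move=> k; apply/measurable_EFinP/measurable_funX.
    apply: measurableT_comp; last exact: pair1_measurable.
    exact: square_integrable_measurable (combined_left_L2 HZ HZ' (u k) (v k)).
  - by move=> k w _; rewrite lee_fin sqr_ge0.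
  rewrite /J -sumEFin; apply: lee_sum => k _.
  exact: (combined_left_bound T_gt0 Fl_usual M_levy HZ h_left ax HZ' h'_left ax').
rewrite integral0_eq; last first.
  move=> w _; rewrite /g big1// => k _; rewrite /combined_left !big1 ?addr0 ?expr0n//.
    by move=> b _; rewrite h'_out ?mulr0.
  by move=> a _; rewrite h_out ?mulr0.
rewrite patchE; case: ifPn => // /set_mem/=; rewrite in_itv/= => sT'.
rewrite lee_fin; apply: sumr_ge0 => k _; apply: le_trans (inner_ge0 P _) _; last first.
  exact: (covariance_comparison T_gt0 Fl_usual M_levy HZ h_left ax HZ' h'_left ax'
    F_sol Fh_sol Ft_sol (u k) (v k) sT').2.
Qed.

Lemma integral_joint_form :
  (\int[lebesgue_measure]_(s in `[0%R, T]) (J s)%:E =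
   ((\tr (C *m mx_integral 0 T F *m C^T) - 2 * \tr (C *m mx_integral 0 T Ft *m C'^T)
         + \tr (C' *m mx_integral 0 T Fh *m C'^T)) * norm2 z0 ^+ 2)%:E)%E.
Proof.
have I1 k := qform_mx_integral (u k) (u k) (fun a b => (ivp_coord a b F_sol).1).
have I2 k := qform_mx_integral (u k) (v k) (fun a b => (ivp_coord a b Ft_sol).1).
have I3 k := qform_mx_integral (v k) (v k) (fun a b => (ivp_coord a b Fh_sol).1).
have i2 k : lebesgue_measure.-integrable `[0, T]
    (EFin \o (fun s => 2 * qform (Ft s) (u k) (v k))).
  rewrite (_ : _ \o _ = fun s => ((2 : R)%:E * (qform (Ft s) (u k) (v k))%:E)%E)//.
  by apply: integrableZl => //; case: (I2 k).
have i12 k : lebesgue_measure.-integrable `[0, T]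
    (EFin \o (fun s => qform (F s) (u k) (u k) + 2 * qform (Ft s) (u k) (v k))).
  rewrite (_ : _ \o _ = ((EFin \o (fun s => qform (F s) (u k) (u k))) \+
     (EFin \o (fun s => (2 * qform (Ft s) (u k) (v k))%R)))%E)//.
  by apply: integrableD => //; case: (I1 k).
have i123 k : lebesgue_measure.-integrable `[0, T]
    (EFin \o (fun s => joint_form F Fh Ft (u k) (v k) s)).
  rewrite (_ : _ \o _ = ((EFin \o
      (fun s => (qform (F s) (u k) (u k) + 2 * qform (Ft s) (u k) (v k))%R)) \+
     (EFin \o (fun s => qform (Fh s) (v k) (v k))))%E)//.
  by apply: integrableD => //; case: (I3 k).
have [JI JE] := @Rintegral_lincomb _ _ _ (@lebesgue_measure R) `[0, T]%classic _
  (index_enum 'I_p) (fun=> norm2 z0 ^+ 2) _ (measurable_itv _) i123.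
have <- : (\int[lebesgue_measure]_(s in `[0%R, T]) J s)%:E =
    (\int[lebesgue_measure]_(s in `[0%R, T]) (J s)%:E)%E.
  by rewrite /Rintegral fineK//; exact: integrable_fin_num.
rewrite JE -mulr_sumr mulrC; congr (_ * _)%:E.
rewrite !trace_qform mulr_sumr -sumrB -big_split; apply: eq_bigr => k _ /=.
rewrite /joint_form RintegralD//; last by case: (I3 k).
rewrite RintegralD//; last by case: (I1 k).
rewrite RintegralZl//; last by case: (I2 k).
rewrite (I1 k).2 (I2 k).2 (I3 k).2 /u /v -scaleN1r !qformZr qformZl; ring.
Qed.

End OutputError.

Theorem lemma2p2 (R : realType) (d : measure_display)
    (Omega : measurableType d) (P : probability Omega R)
    (T : R) (T_gt0 : 0 < T)
    (Fl : R -> set (set Omega)) (Fl_usual : usual_filtration P T Fl)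
    (n nh m p q : nat)
    (K : 'M[R]_q) (M : R -> Omega -> 'cV[R]_q)
    (M_levy : levy_process P T Fl K M)
    (A : 'M[R]_n) (N : 'I_q -> 'M[R]_n) (X0 : 'M[R]_(n, m)) (C : 'M[R]_(p, n))
    (Ah : 'M[R]_nh) (Nh : 'I_q -> 'M[R]_nh) (Xh0 : 'M[R]_(nh, m))
    (Ch : 'M[R]_(p, nh))
    (L_inv : bijective (lyap_op K A N A N))
    (Lh_inv : bijective (lyap_op K Ah Nh Ah Nh))
    (z0 : 'cV[R]_m)
    (x : R -> Omega -> 'cV[R]_n) (xh : R -> Omega -> 'cV[R]_nh)
    (x_sol : sde_solution P T Fl M A N (X0 *m z0) x)
    (xh_sol : sde_solution P T Fl M Ah Nh (Xh0 *m z0) xh)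
    (F : R -> 'M[R]_n) (Fh : R -> 'M[R]_nh) (Ft : R -> 'M[R]_(n, nh))
    (F_sol : ivp_solution T (lyap_op K A N A N) (X0 *m X0^T) F)
    (Fh_sol : ivp_solution T (lyap_op K Ah Nh Ah Nh) (Xh0 *m Xh0^T) Fh)
    (Ft_sol : ivp_solution T (lyap_op K A N Ah Nh) (X0 *m Xh0^T) Ft) :
  let y := fun t w => C *m x t w in
  let yh := fun t w => Ch *m xh t w in
  let PT := mx_integral 0 T F in
  let PhT := mx_integral 0 T Fh in
  let PtT := mx_integral 0 T Ft in
  (\int[P]_w \int[lebesgue_measure]_(t in `[0%R, T])
      ((norm2 (y t w - yh t w) ^+ 2)%:E)
    <= ((\tr (C *m PT *m C^T) - 2 * \tr (C *m PtT *m Ch^T)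
         + \tr (Ch *m PhT *m Ch^T)) * norm2 z0 ^+ 2)%:E)%E.
Proof.
cbv zeta.
have [h [HZ h_out h_left]] := sde_solution_L2 T_gt0 Fl_usual M_levy x_sol.
have [hh [HZh hh_out hh_left]] := sde_solution_L2 T_gt0 Fl_usual M_levy xh_sol.
have [ax _ _] := x_sol; have [axh _ _] := xh_sol.
rewrite -(integral_joint_form z0 F_sol Fh_sol Ft_sol C Ch).
apply: le_trans (output_error_left HZ h_left HZh hh_left C Ch) _.
exact: (output_error_bound T_gt0 Fl_usual M_levy HZ h_out h_left ax HZh hh_out hh_left axh
  F_sol Fh_sol Ft_sol).
Qed.
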